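(* Let $G$ be a finite abelian group and $\mathbb{F}$ an algebraically closed field. If $\mathcal{A}$ is a direct limit of matrix algebras over $\mathbb{F}$ endowed with elementary $G$-gradings and $\mathcal{D}$ is a $G$-graded-division algebra with support $T$ that is central simple as an algebra, then the following statements are equivalent: (i) $\mathcal{A}\otimes\mathcal{D}$ is (graded-isomorphic to) a direct limit of matrix algebras with elementary $G$-gradings; (ii) $x_T\cdot K_0^{\mathrm{gr}}(\mathcal{A})^+=K_0^{\mathrm{gr}}(\mathcal{A})^+$, where $x_T=\sum_{t\in T}t\in\mathbb{Z}_{\ge0}G$; (iii) $|T|\cdot K_0^{\mathrm{gr}}(\mathcal{A})^+=K_0^{\mathrm{gr}}(\mathcal{A})^+$ and $\operatorname{supp}(x_T)\supseteq S$, where $S=\{j\in\hat G/\Gamma\mid e'_jK_0^{\mathrm{gr}}(\mathcal{A})\ne0\}$. Moreover, if this is the case, then $\mathcal{A}\otimes\mathcal{D}\cong\mathcal{A}$ as $G$-graded algebras.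
   Context: All algebras are associative and unital over $\mathbb{F}$; central simple algebras are finite-dimensional. A $G$-grading on $\mathcal{A}$ is a decomposition $\mathcal{A}=\bigoplus_{g\in G}\mathcal{A}_g$ into subspaces with $\mathcal{A}_g\mathcal{A}_h\subseteq\mathcal{A}_{gh}$; homomorphisms of graded algebras preserve components. The support is $\{g\mid\mathcal{A}_g\ne0\}$. A graded-division algebra is a $G$-graded unital algebra in which every nonzero homogeneous element is invertible; its support is a subgroup of $G$. Tensor products (over $\mathbb{F}$) are graded by $\deg(a\otimes b)=\deg a\deg b$. An elementary grading on $\mathrm{M}_n(\mathbb{F})$ is one of the form $\deg E_{ij}=g_ig_j^{-1}$ for some $(g_1,\dots,g_n)\in G^n$. ''Direct limit of matrix algebras with elementary gradings'' means the direct limit of a sequence $\mathcal{A}_0\to\mathcal{A}_1\to\mathcal{A}_2\to\cdots$ of unital embeddings of graded algebras, where each $\mathcal{A}_i$ is a matrix algebra over $\mathbb{F}$ with an elementary grading. Graded $K_0$: for a unital $G$-graded algebra $\mathcal{A}$, $K_0^{\mathrm{gr}}(\mathcal{A})^+$ is the commutative monoid (under $\oplus$) of isomorphism classes $[P]$ of finitely generated projective graded left $\mathcal{A}$-modules; $K_0^{\mathrm{gr}}(\mathcal{A})$ is its group completion, a $\mathbb{Z}G$-module via $g[P]=[P^{[g]}]$, where $P^{[g]}_h=P_{hg^{-1}}$. The positive cone $K_0^{\mathrm{gr}}(\mathcal{A})^+$ is invariant under the action of $\mathbb{Z}_{\ge0}G$. Let $\Gamma=\mathrm{Gal}(\overline{\mathbb{Q}}/\mathbb{Q})$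 act on $\hat G=\mathrm{Hom}(G,\overline{\mathbb{Q}}^\times)$ by post-composition. For an orbit $j\in\hat G/\Gamma$ put $e_j=\sum_{\chi\in j}e_\chi\in\mathbb{Q}G$, where $e_\chi=\frac1{|G|}\sum_{g\in G}\chi(g)^{-1}g$; these are the primitive idempotents of $\mathbb{Q}G$. For each $j$, pick an integer $n_j>0$ such that $e'_j:=n_je_j\in\mathbb{Z}G$. For $z\in\mathbb{Q}G$, $\operatorname{supp}(z)=\{j\in\hat G/\Gamma\mid e_jz\neq0\}$. *)

(* Defs.v *)
From HB Require Import structures.
From mathcomp Require Import all_boot all_order all_fingroup all_algebra.
From mathcomp Require Import all_field all_character.
From mathcomp Require Import boolp.

Set Implicit Arguments.
Unset Strict Implicit.
Unset Printing Implicit Defensive.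

Import Order.TTheory GRing.Theory Num.Theory.
Local Open Scope ring_scope.

Definition direct_decomposition (I : finType) (V : nmodType)
    (C : I -> V -> Prop) : Prop :=
  forall x : V, exists! f : {ffun I -> V},
    (forall i, C i (f i)) /\ x = \sum_i f i.

Section GradedAlgebras.
Variables (gT : finGroupType) (F : fieldType).

Record grading (A : algType F) := Grading {
  gcomp : gT -> A -> Prop;
  gcomp0 : forall g, gcomp g 0;
  gcompZD : forall g (k : F) x y,
    gcomp g x -> gcomp g y -> gcomp g (k *: x + y);
  gcomp_decomp : direct_decomposition gcomp;
  gcompM : forall g h x y,
    gcomp g x -> gcomp h y -> gcomp (g * h)%g (x * y) }.

Record gralg := GrAlg { galg :> algType F; galg_grading : grading galg }.

Definition acomp (A : gralg) : gT -> A -> Prop := gcomp (galg_grading A).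

Definition graded_hom (A B : gralg) (f : {lrmorphism A -> B}) : Prop :=
  forall g x, acomp g x -> acomp g (f x).

Definition graded_iso (A B : gralg) : Prop :=
  exists f : {lrmorphism A -> B}, bijective f /\ graded_hom f.

Definition graded_support (A : algType F) (gr : grading A) : {set gT} :=
  [set g | `[< exists2 x, gcomp gr g x & x != 0 >]].

Definition graded_division (D : falgType F) (gr : grading D) : Prop :=
  forall g x, gcomp gr g x -> x != 0 -> x \is a GRing.unit.

Definition central_simple (D : falgType F) : Prop :=
  'Z({:D})%VS = 1%VS /\
  forall I : {vspace D}, ({:D} * I <= I)%VS -> (I * {:D} <= I)%VS ->
    I = 0%VS \/ I = {:D}%VS.

Lemma direct_decompositionP (I : finType) (V : nmodType) (C : I -> V -> Prop) :
  (forall i, C i 0) ->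
  (forall x, exists2 f : {ffun I -> V},
     (forall i, C i (f i)) & x = \sum_i f i) ->
  (forall i (f g : {ffun I -> V}),
     (forall j, C j (f j)) -> (forall j, C j (g j)) ->
     \sum_j f j = \sum_j g j -> f i = g i) ->
  direct_decomposition C.
Proof.
move=> C0 ex uq x; have [f Cf xE] := ex x; exists f; split=> // g [Cg xE'].
by apply/ffunP => i; apply: uq => //; rewrite -xE -xE'.
Qed.

Section Elementary.
Variables (n : nat) (d : {ffun 'I_n.+1 -> gT}).

(* E_ij is homogeneous of degree d_i d_j^-1. *)
Definition elem_comp (g : gT) (M : 'M[F]_n.+1) : Prop :=
  forall i j, M i j != 0 -> (d i * (d j)^-1)%g = g.

Lemma elem_comp0 g : elem_comp g 0.
Proof. by move=> i j; rewrite mxE eqxx. Qed.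

Lemma elem_compZD g k (x y : 'M[F]_n.+1) :
  elem_comp g x -> elem_comp g y -> elem_comp g (k *: x + y).
Proof.
move=> gx gy i j; rewrite !mxE => nz.
have [x0|/gx//] := eqVneq (x i j) 0; apply: gy.
by move: nz; rewrite x0 mulr0 add0r.
Qed.

Lemma elem_comp_decomp : direct_decomposition elem_comp.
Proof.
apply: direct_decompositionP; first exact: elem_comp0.
  move=> M; exists [ffun g =>
      \matrix_(i, j) if (d i * (d j)^-1)%g == g then M i j else 0].
    by move=> g i j; rewrite ffunE mxE; case: ifP => [/eqP//|]; rewrite eqxx.
  apply/matrixP => i j; rewrite summxE (bigD1 (d i * (d j)^-1)%g) //= big1.
    by rewrite ffunE mxE eqxx addr0.
  by move=> g ng; rewrite ffunE mxE eq_sym (negPf ng).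
move=> g f f' Cf Cf' /matrixP E; apply/matrixP => i j.
have key (e : {ffun gT -> 'M[F]_n.+1}) : (forall h, elem_comp h (e h)) ->
    e g i j = if (d i * (d j)^-1)%g == g then (\sum_h e h) i j else 0.
  move=> Ce; case: eqP => [<-|ne].
    rewrite summxE (bigD1 (d i * (d j)^-1)%g) //= big1 ?addr0 // => h nh.
    by apply/eqP; apply: contraTT nh => /Ce ->; rewrite negbK.
  by apply/eqP; apply: contra_notT ne => /Ce.
by rewrite !key // E.
Qed.

Lemma elem_compM g h (x y : 'M[F]_n.+1) :
  elem_comp g x -> elem_comp h y -> elem_comp (g * h)%g (x * y).
Proof.
move=> gx hy i j; rewrite mxE => nz.
have [k] : exists k, x i k * y k j != 0.
  apply/existsP; apply: contraNT nz => /existsPn all0.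
  by rewrite big1 // => k _; apply/eqP; move: (all0 k); rewrite negbK.
rewrite mulf_eq0 negb_or => /andP[/gx <- /hy <-].
by rewrite mulgA mulgKV.
Qed.

Definition elementary : gralg :=
  GrAlg (Grading elem_comp0 elem_compZD elem_comp_decomp elem_compM).

End Elementary.

(* Sequential colimit in the category of graded unital algebras. An algType   *)
(* is nonzero; the zero algebra receives no constraint, since every cocone    *)
(* to it extends uniquely.                                                    *)
Definition is_direct_limit (B : nat -> gralg)
    (phi : forall i, {lrmorphism B i -> B i.+1})
    (A : gralg) (psi : forall i, {lrmorphism B i -> A}) : Prop :=
  [/\ forall i, graded_hom (psi i),
      forall i x, psi i.+1 (phi i x) = psi i x &
      forall (C : gralg) (xi : forall i, {lrmorphism B i -> C}),
        (forall i, graded_hom (xi i)) ->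
        (forall i x, xi i.+1 (phi i x) = xi i x) ->
      exists2 f : {lrmorphism A -> C},
        graded_hom f /\ (forall i x, f (psi i x) = xi i x) &
        forall f' : {lrmorphism A -> C},
          graded_hom f' -> (forall i x, f' (psi i x) = xi i x) -> f' =1 f].

Definition elementary_limit (A : gralg) : Prop :=
  exists (n : nat -> nat) (d : forall i, {ffun 'I_(n i).+1 -> gT})
         (phi : forall i,
            {lrmorphism elementary (d i) -> elementary (d i.+1)})
         (psi : forall i, {lrmorphism elementary (d i) -> A}),
    (forall i, injective (phi i) /\ graded_hom (phi i)) /\
    is_direct_limit phi psi.

End GradedAlgebras.

(* A ⊗ D for a finite-dimensional D with its chosen basis (b_i): the function  *)
(* x stands for sum_i x_i ⊗ b_i.                                              *)
Definition tens (F : fieldType) (A : algType F) (D : falgType F) : Type :=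
  {ffun 'I_(\dim {:D}) -> A}.

Section Tensor.
Variables (F : fieldType) (A : algType F) (D : falgType F).
Local Notation T := (tens A D).
Local Notation b := (vbasis {:D}).

HB.instance Definition _ :=
  GRing.Lmodule.copy T {ffun 'I_(\dim {:D}) -> A}.

Definition pure (a : A) (d : D) : T := [ffun i => coord b i d *: a].

Definition tens_mul (x y : T) : T :=
  \sum_i \sum_j pure (x i * y j) (b`_i * b`_j).

Definition tens_one : T := pure 1 1.

Lemma coord_fullv (d : D) : d = \sum_i coord b i d *: b`_i.
Proof. exact: coord_vbasis (memvf d). Qed.

Lemma pure_linearl d : linear (pure^~ d).
Proof.
by move=> k x y; apply/ffunP => i; rewrite !ffunE scalerDr !scalerA mulrC.
Qed.

Lemma pure_linearr a : linear (pure a).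
Proof.
by move=> k x y; apply/ffunP => i; rewrite !ffunE linearP scalerDl scalerA.
Qed.

HB.instance Definition _ a :=
  GRing.isLinear.Build F D T *:%R (pure a) (pure_linearr a).

Definition pure_r d a := pure a d.
HB.instance Definition _ d :=
  GRing.isLinear.Build F A T *:%R (pure_r d) (pure_linearl d).

Lemma pure_rE d a : pure_r d a = pure a d. Proof. by []. Qed.

Lemma tensE (x : T) : x = \sum_i pure (x i) b`_i.
Proof.
apply/ffunP => j; rewrite sum_ffunE (bigD1 j) //= big1.
  by rewrite addr0 ffunE coord_free ?eqxx ?scale1r // (basis_free (vbasisP _)).
move=> i ne; rewrite ffunE coord_free ?(basis_free (vbasisP _)) //.
by rewrite (negPf ne) scale0r.
Qed.

Lemma tens_mul_linearl y : linear (tens_mul^~ y).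
Proof.
move=> k x x'; rewrite /tens_mul scaler_sumr -big_split; apply: eq_bigr => i _.
rewrite scaler_sumr -big_split; apply: eq_bigr => j _ /=.
by rewrite !ffunE mulrDl -scalerAl -!pure_rE linearP.
Qed.

Lemma tens_mul_linearr x : linear (tens_mul x).
Proof.
move=> k y y'; rewrite /tens_mul scaler_sumr -big_split; apply: eq_bigr => i _.
rewrite scaler_sumr -big_split; apply: eq_bigr => j _ /=.
by rewrite !ffunE mulrDr -scalerAr -!pure_rE linearP.
Qed.

HB.instance Definition _ x :=
  GRing.isLinear.Build F T T *:%R (tens_mul x) (tens_mul_linearr x).
Definition tens_mul_r y x := tens_mul x y.
HB.instance Definition _ y :=
  GRing.isLinear.Build F T T *:%R (tens_mul_r y) (tens_mul_linearl y).

Lemma tens_mul_rE x y : tens_mul_r y x = tens_mul x y. Proof. by []. Qed.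

Lemma pureM a d a' d' : tens_mul (pure a d) (pure a' d') = pure (a * a') (d * d').
Proof.
rewrite [in RHS](coord_fullv d) mulr_suml linear_sum; apply: eq_bigr => i _.
rewrite [in RHS](coord_fullv d') mulr_sumr linear_sum; apply: eq_bigr => j _.
rewrite !ffunE -!scalerAl -!scalerAr !linearZ /=.
by rewrite -!pure_rE !linearZ.
Qed.

Lemma tens_mul_suml n (u : 'I_n -> T) y :
  tens_mul (\sum_i u i) y = \sum_i tens_mul (u i) y.
Proof. exact: (linear_sum (tens_mul_r y)). Qed.

Lemma tens_mul_sumr n (u : 'I_n -> T) x :
  tens_mul x (\sum_i u i) = \sum_i tens_mul x (u i).
Proof. exact: (linear_sum (tens_mul x)). Qed.

Lemma tens_mulA : associative tens_mul.
Proof.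
move=> x y z; rewrite (tensE x) (tensE y) (tensE z) !tens_mul_suml.
apply: eq_bigr => i _; rewrite tens_mul_sumr.
rewrite (tens_mul_sumr (fun j => pure (y j) b`_j)) tens_mul_suml.
apply: eq_bigr => j _; rewrite !tens_mul_sumr; apply: eq_bigr => k _.
by rewrite !pureM !mulrA.
Qed.

Lemma tens_mul1 : left_id tens_one tens_mul.
Proof.
move=> x; rewrite {2}(tensE x) {1}(tensE x) tens_mul_sumr.
by apply: eq_bigr => i _; rewrite pureM !mul1r.
Qed.

Lemma tens_mulr1 : right_id tens_one tens_mul.
Proof.
move=> x; rewrite {2}(tensE x) {1}(tensE x) tens_mul_suml.
by apply: eq_bigr => i _; rewrite pureM !mulr1.
Qed.

Lemma tens_mulDl : left_distributive tens_mul +%R.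
Proof. by move=> x y z; rewrite -!tens_mul_rE linearD. Qed.

Lemma tens_mulDr : right_distributive tens_mul +%R.
Proof. by move=> x y z; rewrite linearD. Qed.

Lemma tens_one_neq0 : tens_one != 0.
Proof.
apply/eqP => /ffunP E; have /eqP[] := oner_neq0 D.
rewrite (coord_fullv 1) big1 // => i _; move: (E i); rewrite !ffunE => /eqP.
by rewrite scaler_eq0 oner_eq0 orbF => /eqP ->; rewrite scale0r.
Qed.

HB.instance Definition _ := GRing.Zmodule_isNzRing.Build T
  tens_mulA tens_mul1 tens_mulr1 tens_mulDl tens_mulDr tens_one_neq0.

Lemma tens_scaleAl (k : F) (x y : T) : k *: (x * y) = (k *: x) * y.
Proof. by rewrite [RHS](linearZ_LR (tens_mul_r y)). Qed.

Lemma tens_scaleAr (k : F) (x y : T) : k *: (x * y) = x * (k *: y).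
Proof. by rewrite [RHS](linearZ_LR (tens_mul x)). Qed.

HB.instance Definition _ := GRing.Lmodule_isLalgebra.Build F T tens_scaleAl.
HB.instance Definition _ := GRing.Lalgebra_isAlgebra.Build F T tens_scaleAr.

Lemma pure_universal (V : lmodType F) (beta : A -> D -> V) :
  (forall d, linear (beta^~ d)) -> (forall a, linear (beta a)) ->
  exists2 f : {linear T -> V}, forall a d, f (pure a d) = beta a d &
    forall g : {linear T -> V},
      (forall a d, g (pure a d) = beta a d) -> g =1 f.
Proof.
move=> bl br.
pose f (x : T) := \sum_i beta (x i) b`_i.
have fl : linear f.
  move=> k x y; rewrite /f scaler_sumr -big_split; apply: eq_bigr => i _ /=.
  by rewrite !ffunE bl.
pose fL := GRing.isLinear.Build F T V *:%R f fl.
pose f' : {linear T -> V} := HB.pack f fL.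
have fpure a d : f (pure a d) = beta a d.
  pose g : {linear D -> V} := HB.pack (beta a)
    (GRing.isLinear.Build F D V *:%R (beta a) (br a)).
  rewrite -[RHS]/(g d) [in RHS](coord_fullv d) linear_sum.
  apply: eq_bigr => i _; rewrite ffunE linearZ /=.
  pose h : {linear A -> V} := HB.pack (beta^~ b`_i)
    (GRing.isLinear.Build F A V *:%R (beta^~ b`_i) (bl b`_i)).
  by rewrite -[LHS]/(h _) linearZ.
exists f' => // g gE x; rewrite [in LHS](tensE x) linear_sum.
by apply: eq_bigr => i _; rewrite gE.
Qed.

End Tensor.

Section GradedTensor.
Variables (gT : finGroupType) (abG : abelian [set: gT]) (F : fieldType).

Section Projection.
Variables (A : algType F) (gr : grading gT A).

Definition gproj_ex x := cid (gcomp_decomp gr x).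
Definition gproj (g : gT) (x : A) : A := projT1 (gproj_ex x) g.

Lemma gprojP g x : gcomp gr g (gproj g x).
Proof. by rewrite /gproj; case: (gproj_ex x) => f [] /= []. Qed.

Lemma gproj_sum x : x = \sum_g gproj g x.
Proof. by rewrite /gproj; case: (gproj_ex x) => f [] /= []. Qed.

Lemma gproj_uniq x (f : {ffun gT -> A}) :
  (forall g, gcomp gr g (f g)) -> x = \sum_g f g -> forall g, gproj g x = f g.
Proof.
rewrite /gproj; case: (gproj_ex x) => f' [] /= [Cf' xE'] uq Cf xE g.
by rewrite (uq f).
Qed.

Lemma gproj_linear g : linear (gproj g).
Proof.
move=> k x y; pose f : {ffun gT -> A} := [ffun g => k *: gproj g x + gproj g y].
rewrite (@gproj_uniq _ f) ?ffunE // => [h|].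
  by rewrite ffunE; apply: gcompZD; apply: gprojP.
rewrite {1}(gproj_sum x) {1}(gproj_sum y) scaler_sumr -big_split.
by apply: eq_bigr => h _; rewrite ffunE.
Qed.

HB.instance Definition _ g :=
  GRing.isLinear.Build F A A *:%R (gproj g) (gproj_linear g).

Lemma gproj_id g h x : gcomp gr h x -> gproj g x = if g == h then x else 0.
Proof.
move=> Cx; pose f : {ffun gT -> A} := [ffun g => if g == h then x else 0].
rewrite (@gproj_uniq _ f) ?ffunE // => [k|].
  by rewrite ffunE; case: eqP => [->|_] //; apply: gcomp0.
by rewrite (bigD1 h) //= big1 ?ffunE ?eqxx ?addr0 // => k /negPf nk; rewrite ffunE nk.
Qed.

End Projection.

Variables (A : gralg gT F) (D : falgType F) (gD : grading gT D).
Local Notation T := (tens A D).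

(* (A ⊗ D)_g is spanned by the a ⊗ d with deg a * deg d = g.                  *)
Definition tens_comp (g : gT) (x : T) : Prop :=
  exists s : seq (A * D),
    (forall p, p \in s ->
       exists h k, [/\ acomp h p.1, gcomp gD k p.2 & (h * k)%g = g]) /\
    x = \sum_(p <- s) pure p.1 p.2.

Lemma tens_comp0 g : tens_comp g 0.
Proof. by exists [::]; rewrite big_nil. Qed.

Lemma tens_compZD g (k : F) x y :
  tens_comp g x -> tens_comp g y -> tens_comp g (k *: x + y).
Proof.
move=> [s [sP ->]] [t [tP ->]].
exists ([seq (k *: p.1, p.2) | p <- s] ++ t); split.
  move=> p; rewrite mem_cat => /orP[/mapP[q qs ->]|/tP//].
  have [h [l [Ah Dl <-]]] := sP q qs; exists h, l; split=> //=.
  by rewrite -[k *: _]addr0; apply: gcompZD => //; apply: gcomp0.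
rewrite big_cat big_map scaler_sumr; congr (_ + _); apply: eq_bigr => p _ /=.
by rewrite -!pure_rE linearZ.
Qed.

Lemma tens_compD g x y : tens_comp g x -> tens_comp g y -> tens_comp g (x + y).
Proof. by move=> gx gy; rewrite -[x]scale1r; apply: tens_compZD. Qed.

Lemma tens_comp_sum (I : finType) g (u : I -> T) :
  (forall i, tens_comp g (u i)) -> tens_comp g (\sum_i u i).
Proof. by move=> uP; elim/big_ind: _ => //; [apply: tens_comp0|apply: tens_compD]. Qed.

Lemma tens_comp_pure h k a d :
  acomp h a -> gcomp gD k d -> tens_comp (h * k)%g (pure a d).
Proof.
move=> Aa Dd; exists [:: (a, d)]; split; last by rewrite big_seq1.
by move=> p; rewrite inE => /eqP ->; exists h, k.
Qed.

Definition tens_proj (g : gT) (x : T) : T :=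
  \sum_i \sum_h
    pure (gproj (galg_grading A) h (x i)) (gproj gD (h^-1 * g)%g (vbasis {:D})`_i).

Lemma tens_proj_linear g : linear (tens_proj g).
Proof.
move=> k x y; rewrite /tens_proj scaler_sumr -big_split; apply: eq_bigr => i _.
rewrite scaler_sumr -big_split; apply: eq_bigr => h _ /=.
by rewrite !ffunE linearP -!pure_rE linearP.
Qed.

HB.instance Definition _ g :=
  GRing.isLinear.Build F T T *:%R (tens_proj g) (tens_proj_linear g).

Lemma tens_proj_pure g a d : tens_proj g (pure a d) =
  \sum_h pure (gproj (galg_grading A) h a) (gproj gD (h^-1 * g)%g d).
Proof.
rewrite /tens_proj exchange_big; apply: eq_bigr => h _ /=.
rewrite [in RHS](coord_fullv d) !linear_sum; apply: eq_bigr => i _.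
by rewrite !ffunE !linearZ -!pure_rE linearZ.
Qed.

Lemma tens_proj_id g h x :
  tens_comp h x -> tens_proj g x = if g == h then x else 0.
Proof.
move=> [s [sP ->]]; rewrite linear_sum big_seq [in RHS]big_seq.
have E p : p \in s ->
    tens_proj g (pure p.1 p.2) = if g == h then pure p.1 p.2 else 0.
  case/sP => k [l [Ak Dl <-]]; rewrite tens_proj_pure (bigD1 k) //= big1.
    rewrite (gproj_id _ Ak) (gproj_id _ Dl) eqxx addr0.
    by rewrite (can2_eq (mulKVg k) (mulKg k)); case: eqP => // _; rewrite linear0.
  by move=> k' /negPf nk; rewrite (gproj_id _ Ak) nk -pure_rE linear0.
rewrite (eq_bigr (fun p => if g == h then pure p.1 p.2 else 0)).
  by case: eqP => // _; rewrite big1.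
by move=> p; exact: E.
Qed.

Lemma tens_comp_proj g x : tens_comp g (tens_proj g x).
Proof.
apply: tens_comp_sum => i; apply: tens_comp_sum => h.
rewrite -{1}[g](mulKVg h); apply: tens_comp_pure; exact: gprojP.
Qed.

Lemma tens_proj_sum x : x = \sum_g tens_proj g x.
Proof.
rewrite {1}[x]tensE exchange_big; apply: eq_bigr => i _.
rewrite exchange_big /= {1}(gproj_sum (galg_grading A) (x i)) -pure_rE linear_sum.
apply: eq_bigr => h _; rewrite /= /pure_r {1}(gproj_sum gD (vbasis _)`_i) linear_sum.
rewrite (reindex_inj (mulgI h^-1%g)); by [].
Qed.

Lemma tens_comp_decomp : direct_decomposition tens_comp.
Proof.
apply: direct_decompositionP; first exact: tens_comp0.
  move=> x; exists [ffun g => tens_proj g x].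
    by move=> g; rewrite ffunE; apply: tens_comp_proj.
  by rewrite {1}[x]tens_proj_sum; apply: eq_bigr => g _; rewrite ffunE.
have key g (f : {ffun gT -> T}) : (forall h, tens_comp h (f h)) ->
    f g = tens_proj g (\sum_h f h).
  move=> Cf; rewrite linear_sum (bigD1 g) //= big1 ?addr0.
    by rewrite (tens_proj_id _ (Cf g)) eqxx.
  by move=> h nh; rewrite (tens_proj_id _ (Cf h)) eq_sym (negPf nh).
by move=> g f f' Cf Cf' E; rewrite (key g f) // (key g f') // E.
Qed.

Lemma tens_compM g h (x y : T) :
  tens_comp g x -> tens_comp h y -> tens_comp (g * h)%g (x * y).
Proof.
move=> [s [sP ->]] [t [tP ->]].
exists [seq (p.1 * q.1, p.2 * q.2) | p <- s, q <- t]; split.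
  move=> p /allpairsP[[q r] /= [/sP[k [l [Ak Dl <-]]] /tP[k' [l' [Ak' Dl' <-]]] ->]].
  exists (k * k')%g, (l * l')%g; split=> /=; try exact: gcompM.
  rewrite !mulgA; congr (_ * _)%g; rewrite -!mulgA; congr (_ * _)%g.
  by apply: (centsP abG); rewrite inE.
rewrite big_allpairs_dep mulr_suml; apply: eq_bigr => p _.
by rewrite mulr_sumr; apply: eq_bigr => q _; exact: pureM.
Qed.

Definition gtensor : gralg gT F :=
  @GrAlg gT F T (Grading tens_comp0 tens_compZD tens_comp_decomp tens_compM).

End GradedTensor.

Section GradedModules.
Variables (gT : finGroupType) (F : fieldType) (A : gralg gT F).

(* A is unital, so F acts on an A-module by k |-> k%:A.                        *)
Record grmod := GrMod {
  gmod :> lmodType A;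
  mcomp : gT -> gmod -> Prop;
  mcomp0 : forall g, mcomp g 0;
  mcompZD : forall g (k : F) x y,
    mcomp g x -> mcomp g y -> mcomp g (k%:A *: x + y);
  mcomp_decomp : direct_decomposition mcomp;
  mcompA : forall g h a x,
    acomp g a -> mcomp h x -> mcomp (g * h)%g (a *: x) }.

Definition finitely_generated (M : lmodType A) : Prop :=
  exists (n : nat) (v : 'I_n -> M),
    forall x, exists c : 'I_n -> A, x = \sum_i c i *: v i.

Definition projective (M : lmodType A) : Prop :=
  forall (N N' : lmodType A) (p : {linear N -> N'}) (f : {linear M -> N'}),
    (forall y, exists x, p x = y) ->
    exists h : {linear M -> N}, forall x, p (h x) = f x.

Record fgpmod := FgpMod {
  fgp_mod :> grmod;
  fgp_fg : finitely_generated fgp_mod;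
  fgp_proj : projective fgp_mod }.

Definition grmod_iso (P Q : grmod) : Prop :=
  exists f : {linear P -> Q},
    bijective f /\ forall g x, mcomp g x -> mcomp g (f x).

Lemma grmod_iso_refl P : grmod_iso P P.
Proof. by exists idfun; split=> //; exists idfun. Qed.

Lemma grmod_iso_trans P Q R : grmod_iso P Q -> grmod_iso Q R -> grmod_iso P R.
Proof.
move=> [f [bf hf]] [g [bg hg]]; exists (g \o f).
by split=> [|h x /hf /hg //]; apply: bij_comp.
Qed.

Lemma grmod_iso_sym P Q : grmod_iso P Q -> grmod_iso Q P.
Proof.
move=> [f [[g fK gK] hf]].
have gl : linear g by apply: can2_linear fK gK.
pose g' : {linear Q -> P} := HB.pack g (GRing.isLinear.Build A Q P *:%R g gl).
exists g'; split=> [|h y Qy]; first by exists f.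
have [e [[Ce gyE] _]] := mcomp_decomp (g y).
have [e' [_ uq]] := mcomp_decomp y.
have E1 : e' = [ffun i => f (e i)].
  apply: uq; split=> [i|]; first by rewrite ffunE; apply: hf.
  rewrite -{1}(gK y) {1}gyE linear_sum.
  by apply: eq_bigr => i _; rewrite ffunE.
have E2 : e' = [ffun i => if i == h then y else 0].
  apply: uq; split=> [i|].
    by rewrite ffunE; case: eqP => [->|_] //; apply: mcomp0.
  rewrite (bigD1 h) //= big1 ?ffunE ?eqxx ?addr0 // => i /negPf ni.
  by rewrite ffunE ni.
have : f (e h) = y.
  by move: E1; rewrite E2 => /ffunP/(_ h); rewrite !ffunE eqxx.
by move=> <-; rewrite /= fK.
Qed.

Section DirectSum.
Variables P Q : grmod.

Definition dsum_comp (g : gT) (x : P * Q) : Prop := mcomp g x.1 /\ mcomp g x.2.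

Lemma dsum_comp0 g : dsum_comp g 0.
Proof. by split; apply: mcomp0. Qed.

Lemma dsum_compZD g (k : F) x y :
  dsum_comp g x -> dsum_comp g y -> dsum_comp g (k%:A *: x + y).
Proof. by move=> [x1 x2] [y1 y2]; split; apply: mcompZD. Qed.

Lemma dsum_comp_decomp : direct_decomposition dsum_comp.
Proof.
move=> [x y].
have [e [[Ce xE] uq]] := mcomp_decomp x.
have [e' [[Ce' yE] uq']] := mcomp_decomp y.
exists [ffun i => (e i, e' i)]; split.
  split=> [i|]; first by rewrite ffunE.
  apply/eqP; rewrite -pair_eqE /= (raddf_sum fst) (raddf_sum snd) /=.
  rewrite {1}xE {1}yE; apply/andP.
  by split; apply/eqP; apply: eq_bigr => i _; rewrite ffunE.
move=> f [Cf fE]; apply/ffunP => i; rewrite ffunE [RHS]surjective_pairing.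
have -> : e = [ffun i => (f i).1].
  apply: uq; split=> [j|]; first by rewrite ffunE; case: (Cf j).
  by move/(congr1 fst): fE; rewrite (raddf_sum fst) /= => ->;
     apply: eq_bigr => j _; rewrite ffunE.
have -> : e' = [ffun i => (f i).2].
  apply: uq'; split=> [j|]; first by rewrite ffunE; case: (Cf j).
  by move/(congr1 snd): fE; rewrite (raddf_sum snd) /= => ->;
     apply: eq_bigr => j _; rewrite ffunE.
by rewrite !ffunE.
Qed.

Lemma dsum_compA g h a x :
  acomp g a -> dsum_comp h x -> dsum_comp (g * h)%g (a *: x).
Proof. by move=> Aa [x1 x2]; split; apply: mcompA. Qed.

Definition dsum_gr : grmod :=
  @GrMod (P * Q)%type _ dsum_comp0 dsum_compZD dsum_comp_decomp dsum_compA.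

End DirectSum.

Section Shift.
Variables (g : gT) (P : grmod).

Definition shift_comp (h : gT) (x : P) : Prop := mcomp (h * g^-1)%g x.

Lemma shift_comp0 h : shift_comp h 0.
Proof. exact: mcomp0. Qed.

Lemma shift_compZD h (k : F) x y :
  shift_comp h x -> shift_comp h y -> shift_comp h (k%:A *: x + y).
Proof. exact: mcompZD. Qed.

Lemma shift_comp_decomp : direct_decomposition shift_comp.
Proof.
move=> x; have [e [[Ce xE] uq]] := mcomp_decomp x.
exists [ffun h => e (h * g^-1)%g]; split.
  split=> [h|]; first by rewrite ffunE; apply: Ce.
  rewrite xE (reindex_inj (mulIg g^-1%g)); apply: eq_bigr => h _.
  by rewrite ffunE.
move=> f [Cf fE]; have -> : e = [ffun h => f (h * g)%g].
  apply: uq; split=> [h|].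
    by rewrite ffunE; move: (Cf (h * g)%g); rewrite /shift_comp mulgK.
  rewrite fE (reindex_inj (mulIg g)); apply: eq_bigr => h _.
  by rewrite ffunE.
by apply/ffunP => h; rewrite !ffunE mulgKV.
Qed.

Lemma shift_compA h k a x :
  acomp h a -> shift_comp k x -> shift_comp (h * k)%g (a *: x).
Proof. by move=> Aa Px; rewrite /shift_comp -mulgA; apply: mcompA. Qed.

Definition shift_gr : grmod :=
  GrMod shift_comp0 shift_compZD shift_comp_decomp shift_compA.

End Shift.

Section Zero.
Local Notation Z := ('rV[A]_0).

Lemma zero_all (x y : Z) : x = y. Proof. by rewrite [x]thinmx0 [y]thinmx0. Qed.

Lemma zero_decomp : direct_decomposition (fun (_ : gT) (_ : Z) => True).
Proof.
move=> x; exists 0; split=> [|f _]; first by split=> //; apply: zero_all.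
by apply/ffunP => g; apply: zero_all.
Qed.

Definition zero_gr : grmod :=
  @GrMod Z (fun _ _ => True) (fun=> I) (fun _ _ _ _ _ _ => I) zero_decomp
    (fun _ _ _ _ _ _ => I).

Lemma zero_fg : finitely_generated zero_gr.
Proof. by exists 0, (fun=> 0) => x; exists (fun=> 0); apply: zero_all. Qed.

Lemma zero_proj : projective zero_gr.
Proof.
move=> N N' p f _; exists \0 => x; rewrite linear0.
by rewrite (zero_all x 0) linear0.
Qed.

Definition zero_fgp : fgpmod := FgpMod zero_fg zero_proj.

End Zero.

Section Fgp.
Variables P Q : fgpmod.

Lemma dsum_fg : finitely_generated (dsum_gr P Q).
Proof.
have [m [u uP]] := fgp_fg P; have [n [v vP]] := fgp_fg Q.
exists (m + n)%N, (fun i => match split i with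
                            | inl j => (u j, 0) | inr j => (0, v j) end).
move=> [x y]; have [c ->] := uP x; have [d ->] := vP y.
exists (fun i => match split i with inl j => c j | inr j => d j end).
rewrite big_split_ord.
have sl i : split (lshift n i) = inl i := unsplitK (inl i).
have sr i : split (rshift m i) = inr i := unsplitK (inr i).
under eq_bigr => i _ do rewrite sl.
rewrite -[RHS]/(_ + _) [X in _ = _ + X](eq_bigr (fun i => d i *: ((0, v i) : dsum_gr P Q)));
  last by move=> i _; rewrite sr.
apply/eqP; rewrite -pair_eqE /= !(raddf_sum fst) !(raddf_sum snd) /=.
apply/andP; split; apply/eqP.
  by rewrite [X in _ + X]big1 ?addr0 // => i _; rewrite /= scaler0.
by rewrite [X in X + _]big1 ?add0r // => i _; rewrite /= scaler0.
Qed.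

Lemma dsum_proj : projective (dsum_gr P Q).
Proof.
move=> N N' p f ps.
have l1 : linear (fun x : P => f (x, 0)).
  by move=> k x y; rewrite -linearP; congr (f _); apply/eqP;
     rewrite -pair_eqE /= scaler0 addr0 !eqxx.
have l2 : linear (fun y : Q => f (0, y)).
  by move=> k x y; rewrite -linearP; congr (f _); apply/eqP;
     rewrite -pair_eqE /= scaler0 addr0 !eqxx.
pose f1 : {linear P -> N'} := HB.pack (fun x : P => f (x, 0))
  (GRing.isLinear.Build A P N' *:%R _ l1).
pose f2 : {linear Q -> N'} := HB.pack (fun y : Q => f (0, y))
  (GRing.isLinear.Build A Q N' *:%R _ l2).
have [h1 h1P] := fgp_proj f1 ps; have [h2 h2P] := fgp_proj f2 ps.
have hl : linear (fun z : dsum_gr P Q => h1 z.1 + h2 z.2).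
  by move=> k x y; rewrite !linearP scalerDr addrACA.
pose h : {linear dsum_gr P Q -> N} := HB.pack (fun z => h1 z.1 + h2 z.2)
  (GRing.isLinear.Build A (dsum_gr P Q) N *:%R _ hl).
exists h => -[x y] /=.
rewrite linearD h1P h2P /= -linearD; congr (f _); apply/eqP.
by rewrite -pair_eqE /= addr0 add0r !eqxx.
Qed.

Definition dsum : fgpmod := FgpMod dsum_fg dsum_proj.

(* P^[g], with the same underlying module as P and P^[g]_h = P_(h g^-1).      *)
Definition shift (g : gT) : fgpmod :=
  @FgpMod (shift_gr g P) (fgp_fg P) (@fgp_proj P).

End Fgp.

Lemma dsum_iso (P P' Q Q' : grmod) :
  grmod_iso P P' -> grmod_iso Q Q' -> grmod_iso (dsum_gr P Q) (dsum_gr P' Q').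
Proof.
move=> [f [[f' fK f'K] hf]] [g [[g' gK g'K] hg]].
have l : linear (fun z : dsum_gr P Q => (f z.1, g z.2) : dsum_gr P' Q').
  by move=> k x y; rewrite !linearP.
pose h : {linear dsum_gr P Q -> dsum_gr P' Q'} :=
  HB.pack (fun z : dsum_gr P Q => (f z.1, g z.2) : dsum_gr P' Q')
    (GRing.isLinear.Build A (dsum_gr P Q) (dsum_gr P' Q') *:%R _ l).
exists h; split.
  by exists (fun z => (f' z.1, g' z.2)) => [[x y]|[x y]] /=;
     rewrite ?fK ?gK ?f'K ?g'K.
by move=> i [x y] [/= Px Qy]; split; [apply: hf|apply: hg].
Qed.

Lemma dsum_isoC (P Q : grmod) : grmod_iso (dsum_gr P Q) (dsum_gr Q P).
Proof.
have l : linear (fun z : dsum_gr P Q => (z.2, z.1) : dsum_gr Q P) by [].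
pose h : {linear dsum_gr P Q -> dsum_gr Q P} :=
  HB.pack (fun z : dsum_gr P Q => (z.2, z.1) : dsum_gr Q P)
    (GRing.isLinear.Build A (dsum_gr P Q) (dsum_gr Q P) *:%R _ l).
exists h; split.
  by exists (fun z => (z.2, z.1)) => -[].
by move=> i [x y] [].
Qed.

Lemma dsum_isoA (P Q R : grmod) :
  grmod_iso (dsum_gr P (dsum_gr Q R)) (dsum_gr (dsum_gr P Q) R).
Proof.
pose s (z : dsum_gr P (dsum_gr Q R)) : dsum_gr (dsum_gr P Q) R :=
  ((z.1, z.2.1), z.2.2).
have l : linear s by [].
pose h : {linear dsum_gr P (dsum_gr Q R) -> dsum_gr (dsum_gr P Q) R} :=
  HB.pack s (GRing.isLinear.Build A (dsum_gr P (dsum_gr Q R))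
    (dsum_gr (dsum_gr P Q) R) *:%R s l).
exists h; split.
  by exists (fun z => (z.1.1, (z.1.2, z.2))) => [[? []]|[[]]].
by move=> i [x [y z]] [? []].
Qed.

Lemma dsum_iso0 (P : grmod) : grmod_iso (dsum_gr zero_gr P) P.
Proof.
have l : linear (fun z : dsum_gr zero_gr P => z.2) by [].
pose h : {linear dsum_gr zero_gr P -> P} :=
  HB.pack (fun z : dsum_gr zero_gr P => z.2)
    (GRing.isLinear.Build A (dsum_gr zero_gr P) P *:%R _ l).
exists h; split.
  exists (fun x => (0, x)) => [[x y]|x] //=.
  by congr (_, _); apply: zero_all.
by move=> i [x y] [].
Qed.

Lemma shift_iso g (P Q : grmod) :
  grmod_iso P Q -> grmod_iso (shift_gr g P) (shift_gr g Q).
Proof.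
move=> [f [bf hf]]; exists f; split=> // h x; exact: hf.
Qed.

End GradedModules.

(* MathComp's nmodType and zmodType cannot host K_0: a quotient of the type   *)
(* of all modules lives in a universe above the carriers of the modules, which *)
(* the library's universe constraints exclude for nmodType.                   *)
Definition quot (X : Type) (R : X -> X -> Prop) : Type :=
  {C : X -> Prop | exists x, C = R x}.

Section Quotient.
Variables (X : Type) (R : X -> X -> Prop).

Definition cls (x : X) : quot R := exist _ (R x) (ex_intro _ x erefl).

Definition quot_repr (c : quot R) : X := projT1 (cid (proj2_sig c)).

Lemma reprK c : cls (quot_repr c) = c.
Proof.
rewrite /quot_repr; case: c => C CP; case: cid => /= x E.
by apply: eq_exist; rewrite /= -E.
Qed.

Hypotheses (Rr : forall x, R x x) (Rs : forall x y, R x y -> R y x)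
  (Rt : forall x y z, R x y -> R y z -> R x z).

Lemma clsP x y : cls x = cls y <-> R x y.
Proof.
split=> [[E]|Rxy]; first by rewrite E.
apply: eq_exist => /=; apply: funext => z; apply: propext.
by split=> [/(Rt (Rs Rxy))|/(Rt Rxy)].
Qed.

Lemma clsK x : R (quot_repr (cls x)) x.
Proof. by apply/clsP; rewrite reprK. Qed.

End Quotient.

Section K0.
Variables (gT : finGroupType) (F : fieldType) (A : gralg gT F).

Definition K0plus : Type := quot (fun P Q : fgpmod A => grmod_iso P Q).

Definition k0p_class (P : fgpmod A) : K0plus := cls _ P.

Definition k0p_zero : K0plus := k0p_class (zero_fgp A).

Definition k0p_add (x y : K0plus) : K0plus :=
  k0p_class (dsum (quot_repr x) (quot_repr y)).

Definition k0p_shift (g : gT) (x : K0plus) : K0plus :=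
  k0p_class (shift (quot_repr x) g).

Lemma k0p_classP P Q : k0p_class P = k0p_class Q <-> grmod_iso P Q.
Proof.
apply: clsP; [by move=> ?; exact: grmod_iso_refl|by move=> ? ?; exact: grmod_iso_sym|].
by move=> ? ? ?; exact: grmod_iso_trans.
Qed.

Lemma k0p_ind (P : K0plus -> Prop) :
  (forall M, P (k0p_class M)) -> forall x, P x.
Proof. by move=> H x; rewrite -(reprK x); apply: H. Qed.

Lemma k0p_reprK P : grmod_iso (quot_repr (k0p_class P)) P.
Proof. by apply/k0p_classP; exact: reprK. Qed.

Lemma k0p_addE P Q : k0p_add (k0p_class P) (k0p_class Q) = k0p_class (dsum P Q).
Proof. by apply/k0p_classP; apply: dsum_iso; apply: k0p_reprK. Qed.

Lemma k0p_shiftE g P : k0p_shift g (k0p_class P) = k0p_class (shift P g).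
Proof. by apply/k0p_classP; apply: shift_iso; apply: k0p_reprK. Qed.

Lemma k0p_addA : associative k0p_add.
Proof.
elim/k0p_ind=> P; elim/k0p_ind=> Q; elim/k0p_ind=> R.
by rewrite !k0p_addE; apply/k0p_classP; apply: dsum_isoA.
Qed.

Lemma k0p_addC : commutative k0p_add.
Proof.
elim/k0p_ind=> P; elim/k0p_ind=> Q.
by rewrite !k0p_addE; apply/k0p_classP; apply: dsum_isoC.
Qed.

Lemma k0p_add0 : left_id k0p_zero k0p_add.
Proof.
elim/k0p_ind=> P; rewrite k0p_addE; apply/k0p_classP; exact: dsum_iso0.
Qed.

HB.instance Definition _ :=
  Monoid.isComLaw.Build K0plus k0p_zero k0p_add k0p_addA k0p_addC k0p_add0.

(* Elements of (Z_>=0)G act on K0plus and elements of ZG act on K0, by         *)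
(* (sum_g z_g g) x = sum_g z_g (g x).                                         *)
Definition k0p_muln (n : nat) (x : K0plus) : K0plus :=
  iter n (k0p_add x) k0p_zero.

Definition k0p_act (z : {ffun gT -> nat}) (x : K0plus) : K0plus :=
  \big[k0p_add/k0p_zero]_(g : gT) k0p_muln (z g) (k0p_shift g x).

(* (a, b) stands for a - b.                                                   *)
Definition k0_rel (p q : K0plus * K0plus) : Prop :=
  exists c, k0p_add (k0p_add p.1 q.2) c = k0p_add (k0p_add q.1 p.2) c.

Definition K0 : Type := quot k0_rel.

Definition k0_diff (a b : K0plus) : K0 := cls _ (a, b).

Definition k0_zero : K0 := k0_diff k0p_zero k0p_zero.

Definition k0_add (x y : K0) : K0 :=
  k0_diff (k0p_add (quot_repr x).1 (quot_repr y).1)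
          (k0p_add (quot_repr x).2 (quot_repr y).2).

Definition k0_opp (x : K0) : K0 := k0_diff (quot_repr x).2 (quot_repr x).1.

Definition k0_shift (g : gT) (x : K0) : K0 :=
  k0_diff (k0p_shift g (quot_repr x).1) (k0p_shift g (quot_repr x).2).

Lemma k0_rel_refl p : k0_rel p p.
Proof. by exists k0p_zero. Qed.

Lemma k0_rel_sym p q : k0_rel p q -> k0_rel q p.
Proof. by move=> [c E]; exists c. Qed.

Lemma k0_rel_trans p q r : k0_rel p q -> k0_rel q r -> k0_rel p r.
Proof.
case: p q r => [a a'] [b b'] [c c'] [u /= E] [v /= E'].
exists (k0p_add (k0p_add b b') (k0p_add u v)) => /=.
transitivity (k0p_add (k0p_add (k0p_add a b') u) (k0p_add (k0p_add b c') v)).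
  by rewrite (AC (2*(2*2)) ((1*4*5)*(3*2*6))).
by rewrite E E' (AC (3*3) ((4*2)*((1*5)*(3*6)))).
Qed.

Lemma k0_diffP a b c d :
  k0_diff a b = k0_diff c d <->
  exists e, k0p_add (k0p_add a d) e = k0p_add (k0p_add c b) e.
Proof. exact: (clsP k0_rel_refl k0_rel_sym k0_rel_trans). Qed.

Lemma k0_ind (P : K0 -> Prop) : (forall a b, P (k0_diff a b)) -> forall x, P x.
Proof. by move=> H x; rewrite -(reprK x); case: (quot_repr x) => a b; apply: H. Qed.

Lemma k0_reprK a b :
  exists c, k0p_add (k0p_add (quot_repr (k0_diff a b)).1 b) c =
            k0p_add (k0p_add a (quot_repr (k0_diff a b)).2) c.
Proof. exact: (clsK k0_rel_refl k0_rel_sym k0_rel_trans (a, b)). Qed.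

Lemma k0p_shiftD g x y :
  k0p_shift g (k0p_add x y) = k0p_add (k0p_shift g x) (k0p_shift g y).
Proof.
elim/k0p_ind: x => P; elim/k0p_ind: y => Q.
rewrite k0p_addE !k0p_shiftE k0p_addE; apply/k0p_classP.
by exists idfun; split=> //; exists idfun.
Qed.

Lemma k0_addE a b c d :
  k0_add (k0_diff a b) (k0_diff c d) = k0_diff (k0p_add a c) (k0p_add b d).
Proof.
apply/k0_diffP; have [u E] := k0_reprK a b; have [v E'] := k0_reprK c d.
exists (k0p_add u v).
transitivity (k0p_add
    (k0p_add (k0p_add (quot_repr (k0_diff a b)).1 b) u)
    (k0p_add (k0p_add (quot_repr (k0_diff c d)).1 d) v)).
  by rewrite (AC (2*2*2) ((1*3*5)*(2*4*6))).
by rewrite E E' (AC (3*3) ((1*4)*(2*5)*(3*6))).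
Qed.

Lemma k0_oppE a b : k0_opp (k0_diff a b) = k0_diff b a.
Proof.
apply/k0_diffP; have [u E] := k0_reprK a b; exists u.
by rewrite k0p_addC (k0p_addC b) k0p_addC -?E; rewrite (k0p_addC _ a) E.
Qed.

Lemma k0_shiftE g a b :
  k0_shift g (k0_diff a b) = k0_diff (k0p_shift g a) (k0p_shift g b).
Proof.
apply/k0_diffP; have [u E] := k0_reprK a b; exists (k0p_shift g u).
by rewrite -!k0p_shiftD E.
Qed.

Lemma k0_addA : associative k0_add.
Proof.
elim/k0_ind=> a a'; elim/k0_ind=> b b'; elim/k0_ind=> c c'.
by rewrite !k0_addE !k0p_addA.
Qed.

Lemma k0_addC : commutative k0_add.
Proof.
elim/k0_ind=> a a'; elim/k0_ind=> b b'.
by rewrite !k0_addE (k0p_addC a) (k0p_addC a').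
Qed.

Lemma k0_add0 : left_id k0_zero k0_add.
Proof. by elim/k0_ind=> a a'; rewrite k0_addE !k0p_add0. Qed.

Lemma k0_addN : left_inverse k0_zero k0_opp k0_add.
Proof.
elim/k0_ind=> a b; rewrite k0_oppE k0_addE; apply/k0_diffP.
by exists k0p_zero; rewrite (k0p_addC b) !(k0p_addC _ k0p_zero).
Qed.

HB.instance Definition _ :=
  Monoid.isComLaw.Build K0 k0_zero k0_add k0_addA k0_addC k0_add0.

Definition k0_mulz (m : int) (x : K0) : K0 :=
  match m with
  | Posz n => iter n (k0_add x) k0_zero
  | Negz n => k0_opp (iter n.+1 (k0_add x) k0_zero)
  end.

Definition k0_act (z : {ffun gT -> int}) (x : K0) : K0 :=
  \big[k0_add/k0_zero]_(g : gT) k0_mulz (z g) (k0_shift g x).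

End K0.

Section GroupAlgebra.
Variable gT : finGroupType.
Local Notation G := [set: gT].

(* Hom(G, Qbar^x): algC is an algebraic closure of Q, and the linear          *)
(* characters of G are its homomorphisms to algC^x.                           *)
Definition char_dual : {set Iirr G} := [set i | 'chi_i \is a linear_char].

(* Every ring endomorphism of algC is an automorphism fixing Q.               *)
Definition galois_orbit (i : Iirr G) : {set Iirr G} :=
  [set k | `[< exists u : {rmorphism algC -> algC}, 'chi_k = cfAut u 'chi_i >]].

Definition galois_orbits : {set {set Iirr G}} :=
  [set galois_orbit i | i in char_dual].

(* A group ring RG is represented by functions gT -> R, and the elements of   *)
(* QG are seen in algC G, where the e_chi live.                               *)
Definition gring_mul (x y : {ffun gT -> algC}) : {ffun gT -> algC} :=
  [ffun g => \sum_h x h * y (h^-1 * g)%g].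

Definition e_chi (i : Iirr G) : {ffun gT -> algC} :=
  [ffun g => (#|gT|%:R)^-1 * ('chi_i g)^-1].

Definition e_orbit (j : {set Iirr G}) : {ffun gT -> algC} :=
  \sum_(i in j) e_chi i.

Definition gring_supp (z : {ffun gT -> algC}) : {set {set Iirr G}} :=
  [set j in galois_orbits | gring_mul (e_orbit j) z != 0].

Definition subset_sum (R : pzSemiRingType) (T : {set gT}) : {ffun gT -> R} :=
  [ffun g => (g \in T)%:R].

End GroupAlgebra.

(* Main.v *)
Require Import Defs.
From HB Require Import structures.
From mathcomp Require Import all_boot all_order all_fingroup all_algebra.
From mathcomp Require Import pgroup all_field all_character.
From mathcomp Require Import boolp.

Set Implicit Arguments.
Unset Strict Implicit.
Unset Printing Implicit Defensive.

Import Order.TTheory GRing.Theory Num.Theory.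
Local Open Scope ring_scope.

(** The algebra [A] is the union of a chain of matrix algebras [A_i] with
  elementary gradings ([elementary_limit_exhausted]). Put [eps_i = E_00] in
  [A_i], and let [v_i] be the class of the graded module [A eps_i]. Over the
  algebraically closed field, [D] has a homogeneous basis [X_t], for [t] in the
  group [T], of invertible elements commuting up to scalars; [|T|] is nonzero
  in the field, and averaging over conjugation by the [X_t] projects [D] onto
  its centre ([avgE]).

  K-theory. A finitely generated projective graded module is given by a
  homogeneous idempotent matrix, whose entries lie in some [A_i]; there it
  splits into rank-one pieces, and the module is a sum of shifts of [A eps_i]
  ([cone_generated]). Likewise an equality between sums of shifts of [v_i]
  is witnessed at some level, where it is an equality of multiplicities of
  degrees ([cone_relation]). So the positive cone is a limit of free modules of
  rank one over the semiring of natural combinations of [G]; in particular it is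
  cancellative and torsion-free ([cone_cancel]).

  From (i) to (ii). If [A (x) D] is a limit of matrix algebras [B_k], then some
  [B_k = M_N] contains [A_i] and [D]. As a graded module over [D] the space
  [F^N] is free, and right multiplication by [X_t], spread along the matrix
  units of [A_i], is a unit of degree [t] commuting with [A_i] and with [D];
  it lies in [A], the centralizer of [D] ([limit_commuting_unit]). Multiplication
  by this unit identifies [A eps_i] with its shift by [t]. Thus each [v_i] is
  invariant under [T], so that its multiplicities at a deeper level are constant
  on the cosets of [T], and [v_i] is a multiple of [x_T]
  ([invariant_cone_divisible]).

  From (ii) to the isomorphism. If [v_i = x_T [Q]] then [A eps_i] is [Q (x) D] as a
  graded module, and [D] acts on it from the right; this is a copy of [D] in
  [eps_i A eps_i], and so a copy in [A] commuting with [A_i]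
  ([divisible_copies]). Along a subsequence, let [D_k] be a copy of [D]
  commuting with [A_k] and contained in [A_(k+1)]. Two commuting copies of [D] are
  exchanged by the Casimir element [sum_t X_t (x) X_t^-1], a unit of neutral degree, and
  the product of these flips over [k] converges to an endomorphism of [A]
  that moves each [D_k] to [D_(k+1)]. The place of [D_0] becomes free for the
  factor [D] of [A (x) D], which gives [A (x) D = A] ([absorb_iso]) and hence (i).

  Finally (ii) and (iii) are equivalent because [x_T^2 = |T| x_T], and because
  [|T| - x_T] is [|T|] times the sum of the idempotents [e_j] outside the support
  of [x_T] ([off_support_sum]); torsion-freeness allows clearing denominators
  ([support_divisible]). *)


(** * Homogeneous components *)

Section GradedBasics.
Variables (gT : finGroupType) (F : fieldType).
Implicit Types A B : gralg gT F.

Definition hproj A (g : gT) : A -> A := gproj (galg_grading A) g.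
HB.instance Definition _ A g := GRing.Linear.copy (@hproj A g) (gproj (galg_grading A) g).

Lemma hprojP A g (x : A) : acomp g (hproj g x).
Proof. exact: gprojP. Qed.

Lemma hproj_sum A (x : A) : x = \sum_g hproj g x.
Proof. exact: gproj_sum. Qed.

Lemma hproj_id A g h (x : A) : acomp h x -> hproj g x = if g == h then x else 0.
Proof. exact: gproj_id. Qed.

Lemma acomp0 A g : acomp g (0 : A). Proof. exact: gcomp0. Qed.

Lemma acompZ A g k (x : A) : acomp g x -> acomp g (k *: x).
Proof. by move=> gx; rewrite -[_ *: _]addr0; apply: gcompZD => //; apply: gcomp0. Qed.

Lemma acompD A g (x y : A) : acomp g x -> acomp g y -> acomp g (x + y).
Proof. by move=> gx gy; rewrite -[x]scale1r; apply: gcompZD. Qed.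

Lemma acomp_sum A (I : Type) (r : seq I) (P : pred I) g (u : I -> A) :
  (forall i, P i -> acomp g (u i)) -> acomp g (\sum_(i <- r | P i) u i).
Proof. by move=> uP; elim/big_ind: _ => //; [apply: acomp0|apply: acompD]. Qed.

Lemma acompM A g h (x y : A) : acomp g x -> acomp h y -> acomp (g * h)%g (x * y).
Proof. exact: gcompM. Qed.

Lemma acomp_hproj A g (x : A) : hproj g x = x -> acomp g x.
Proof. by move=> <-; apply: hprojP. Qed.

Lemma hprojM A g h (x y : A) :
  acomp g x -> hproj (g * h)%g (x * y) = x * hproj h y.
Proof.
move=> gx; rewrite {1}(hproj_sum y) mulr_sumr linear_sum (bigD1 h) //= big1.
  by rewrite addr0 (hproj_id _ (acompM gx (hprojP h y))) eqxx.
move=> k nk; rewrite (hproj_id _ (acompM gx (hprojP k y))).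
by rewrite (inj_eq (mulgI g)) eq_sym (negPf nk).
Qed.

(** Comparing components in [x * 1 = x] shows that the neutral component of 1
  is a right unit. *)
Lemma acomp1 A : acomp 1%g (1 : A).
Proof.
have key (x : A) : x = x * hproj 1%g 1.
  rewrite {1}(hproj_sum x) [in RHS](hproj_sum x) mulr_suml; apply: eq_bigr => h _.
  rewrite -(hprojM _ _ (hprojP h x)) mulg1 mulr1.
  by rewrite (hproj_id _ (hprojP h x)) eqxx.
by apply: acomp_hproj; rewrite [RHS]key mul1r.
Qed.

Lemma acomp_neq0_inj A g h (x : A) : acomp g x -> acomp h x -> x != 0 -> g = h.
Proof.
move=> gx hx; apply: contraNeq => ngh.
by move: (hproj_id g gx); rewrite eqxx (hproj_id _ hx) (negPf ngh) => <-.
Qed.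

Lemma acomp_inverse A g (x y : A) :
  acomp g x -> x * y = 1 -> y * x = 1 -> acomp g^-1%g y.
Proof.
move=> gx xy yx; apply: acomp_hproj.
have: x * hproj g^-1%g y = 1.
  by rewrite -(hprojM _ _ gx) mulgV xy (hproj_id _ (acomp1 A)) eqxx.
by move/(congr1 (fun z => y * z)); rewrite mulrA yx mul1r mulr1.
Qed.

Lemma hproj_hom A B (f : {lrmorphism A -> B}) : graded_hom f ->
  forall g x, hproj g (f x) = f (hproj g x).
Proof.
move=> hf g x; rewrite {1}(hproj_sum x) !linear_sum (bigD1 g) //= big1.
  by rewrite addr0 (hproj_id _ (hf _ _ (hprojP g x))) eqxx.
by move=> h nh; rewrite (hproj_id _ (hf _ _ (hprojP h x))) eq_sym (negPf nh).
Qed.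

Lemma graded_hom_reflect A B (f : {lrmorphism A -> B}) :
  graded_hom f -> injective f -> forall g x, acomp g (f x) -> acomp g x.
Proof.
move=> hf fI g x gfx; apply: acomp_hproj; apply: fI.
by rewrite -(hproj_hom hf) (hproj_id _ gfx) eqxx.
Qed.

End GradedBasics.

(** * Exhausting a direct limit by matrix algebras *)

(** The universal property is tested against the union of the images of the
  matrix algebras, which therefore has to be an algebra in its own right. *)
Section GradedSubalgebra.
Variables (gT : finGroupType) (F : fieldType) (A : gralg gT F) (P : A -> Prop).
Hypotheses (P1 : P 1) (PZD : forall k x y, P x -> P y -> P (k *: x + y))
  (PM : forall x y, P x -> P y -> P (x * y))
  (Pproj : forall g x, P x -> P (hproj g x)).

Definition sub_pred : {pred A} := [pred x | `[< P x >]].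

Lemma sub_pred_subalg : GRing.subalg_closed sub_pred.
Proof.
split; first by rewrite inE; apply/asboolP.
  by move=> k x y; rewrite !inE => /asboolP Px /asboolP Py; apply/asboolP; apply: PZD.
by move=> x y; rewrite !inE => /asboolP Px /asboolP Py; apply/asboolP; apply: PM.
Qed.

HB.instance Definition _ := GRing.isSubalgClosed.Build F A sub_pred sub_pred_subalg.

Record subalg := Subalg { sub_val :> A; sub_valP : sub_val \in sub_pred }.
HB.instance Definition _ := [isSub for sub_val].
HB.instance Definition _ := [Choice of subalg by <:].
HB.instance Definition _ := [SubChoice_isSubAlgebra of subalg by <:].

Definition sub_comp (g : gT) (x : subalg) : Prop := acomp g (val x).

Lemma sub_comp0 g : sub_comp g 0. Proof. by rewrite /sub_comp raddf0; apply: acomp0. Qed.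

Lemma sub_compZD g (k : F) x y :
  sub_comp g x -> sub_comp g y -> sub_comp g (k *: x + y).
Proof. by rewrite /sub_comp linearP; apply: gcompZD. Qed.

Lemma sub_val_closed (x : subalg) : P (val x).
Proof. by have := sub_valP x; rewrite inE => /asboolP. Qed.

Definition sub_in x (Px : P x) : subalg :=
  @Subalg x (introT (asboolP (P x)) Px).

Lemma sub_comp_decomp : direct_decomposition sub_comp.
Proof.
apply: direct_decompositionP; first exact: sub_comp0.
  move=> x; exists [ffun g => sub_in (Pproj g (sub_val_closed x))].
    by move=> g; rewrite ffunE; apply: hprojP.
  apply: val_inj; rewrite raddf_sum {1}(hproj_sum (val x)).
  by apply: eq_bigr => g _; rewrite ffunE.
have key g (f : {ffun gT -> subalg}) : (forall h, sub_comp h (f h)) ->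
    val (f g) = hproj g (val (\sum_h f h)).
  move=> Cf; rewrite raddf_sum linear_sum (bigD1 g) //= big1 ?addr0.
    by rewrite (hproj_id _ (Cf g)) eqxx.
  by move=> h nh; rewrite (hproj_id _ (Cf h)) eq_sym (negPf nh).
by move=> g f f' Cf Cf' E; apply: val_inj; rewrite key // E -key.
Qed.

Lemma sub_compM g h x y :
  sub_comp g x -> sub_comp h y -> sub_comp (g * h)%g (x * y).
Proof. by rewrite /sub_comp rmorphM; apply: acompM. Qed.

Definition sub_gralg : gralg gT F :=
  GrAlg (Grading sub_comp0 sub_compZD sub_comp_decomp sub_compM).

Lemma sub_incl_linear : linear (val : sub_gralg -> A).
Proof. by move=> k x y; apply: linearP. Qed.

Lemma sub_incl_monoid : monoid_morphism (val : sub_gralg -> A).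
Proof. by split; [apply: rmorph1|move=> x y; apply: rmorphM]. Qed.

Definition sub_incl : {lrmorphism sub_gralg -> A} := HB.pack (val : sub_gralg -> A)
  (GRing.isLinear.Build F sub_gralg A _ _ sub_incl_linear)
  (GRing.isMonoidMorphism.Build sub_gralg A _ sub_incl_monoid).

End GradedSubalgebra.
Section Exhaustion.
Variables (gT : finGroupType) (F : fieldType).
Implicit Types A : gralg gT F.

Lemma elem_E n (d : {ffun 'I_n.+1 -> gT}) i j :
  @acomp gT F (elementary F d) (d i * (d j)^-1)%g (delta_mx i j).
Proof.
by move=> k l; rewrite mxE; case: andP => [[/eqP -> /eqP ->]//|]; rewrite eqxx.
Qed.

(** Matrix algebras are simple: a nonzero entry [M a b] yields every
  [E_kk] from [E_ka M E_bk], and hence 1. *)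
Lemma mx_hom_inj n (R : algType F) (f : {lrmorphism 'M[F]_n.+1 -> R}) :
  injective f.
Proof.
apply: raddf_inj => M fM0; apply/matrixP => a b; rewrite mxE.
apply/eqP; apply: contraT => nz; case/eqP: (oner_neq0 R); rewrite -(rmorph1 f).
have -> : 1 = \sum_k (M a b)^-1 *: (delta_mx k a * M * delta_mx b k) :> 'M[F]_n.+1.
  rewrite -[1]/(1%:M) mx1_sum_delta; apply: eq_bigr => k _.
  apply/matrixP => i j; rewrite !mxE (bigD1 b) //= big1 ?addr0.
    rewrite !mxE (bigD1 a) //= big1 ?addr0 => [|l /negPf nl].
      rewrite !mxE !eqxx !andbT; case: (i == k); case: (j == k) => //=;
        rewrite ?mul0r ?mulr0 // mul1r mulr1 mulVf //.
    by rewrite !mxE nl andbF mul0r.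
  by move=> l /negPf nl; rewrite [X in _ * X]mxE nl /= mulr0.
by rewrite raddf_sum big1 // => k _; rewrite [LHS](linearZ_LR f) !rmorphM fM0 mulr0 mul0r scaler0.
Qed.

(** The concrete form of the direct limit: the connecting maps are recovered
  from the chain of images, since the [psi i] are injective. *)
Definition exhausts A n (d : forall i : nat, {ffun 'I_(n i).+1 -> gT})
    (psi : forall i, {lrmorphism elementary F (d i) -> A}) : Prop :=
  [/\ forall i, graded_hom (psi i),
      forall i M, exists M', psi i.+1 M' = psi i M &
      forall a, exists i M, psi i M = a].

(** The mediating map into the union of the images, followed by the inclusion,
  is the identity by uniqueness; so the union is everything. *)
Lemma elementary_limit_exhausted A : elementary_limit A ->
  exists n d psi, @exhausts A n d psi.
Proof.
move=> [n [d [phi [psi [phiP [hpsi compat univ]]]]]]; exists n, d, psi; split=> //.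
  by move=> i M; exists (phi i M).
pose P (a : A) := exists i M, psi i M = a.
have up i j M : (i <= j)%N -> exists M', psi j M' = psi i M.
  elim: j => [|j IH]; first by rewrite leqn0 => /eqP E; move: M; rewrite E => M; exists M.
  rewrite leq_eqVlt => /orP[/eqP E|/IH [M' <-]]; first by move: M {IH}; rewrite E => M; exists M.
  by exists (phi j M').
have P1 : P 1 by exists 0%N, 1; rewrite rmorph1.
have PZD k x y : P x -> P y -> P (k *: x + y).
  move=> [i [M <-]] [j [N <-]].
  have [M' <-] := up i (maxn i j) M (leq_maxl _ _).
  have [N' <-] := up j (maxn i j) N (leq_maxr _ _).
  by exists (maxn i j), (k *: M' + N'); rewrite linearP.
have PM x y : P x -> P y -> P (x * y).
  move=> [i [M <-]] [j [N <-]].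
  have [M' <-] := up i (maxn i j) M (leq_maxl _ _).
  have [N' <-] := up j (maxn i j) N (leq_maxr _ _).
  by exists (maxn i j), (M' * N'); rewrite rmorphM.
have Pproj g x : P x -> P (hproj g x).
  by move=> [i [M <-]]; exists i, (hproj g M); rewrite hproj_hom.
pose S := sub_gralg P1 PZD PM Pproj.
have psiS i M : P (psi i M) by exists i, M.
pose xi0 i (M : elementary F (d i)) : S := sub_in (psiS i M).
have xil i : linear (xi0 i).
  by move=> k x y; apply: val_inj; rewrite linearP /= linearP.
have xim i : monoid_morphism (xi0 i).
  by split=> [|x y]; apply: val_inj; rewrite ?rmorph1 ?rmorphM /= ?rmorph1 ?rmorphM.
pose xi i : {lrmorphism elementary F (d i) -> S} := HB.pack (xi0 i)
   (GRing.isLinear.Build F _ _ _ _ (xil i))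
   (GRing.isMonoidMorphism.Build _ _ _ (xim i)).
have hxi i : graded_hom (xi i) by move=> g x; exact: hpsi.
have [|f [hf fE] _] := univ S xi hxi.
  by move=> i x; apply: val_inj; exact: compat.
have [f' _ uq] := univ A psi hpsi compat.
pose v : {lrmorphism S -> A} := sub_incl P1 PZD PM Pproj.
have hv : graded_hom v by [].
move=> a.
have <- : v (f a) = a.
  have -> : v (f a) = f' a.
    apply: (uq (v \o f)) => [g x|i x]; first by move=> /hf.
    by rewrite /= fE.
  by symmetry; apply: (uq idfun).
exact: (@sub_val_closed gT F A P (f a)).
Qed.

End Exhaustion.

Section Levels.
Variables (gT : finGroupType) (F : fieldType) (A : gralg gT F).
Variables (n : nat -> nat) (d : forall i : nat, {ffun 'I_(n i).+1 -> gT}).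
Variable psi : forall i, {lrmorphism elementary F (d i) -> A}.
Hypothesis psiP : exhausts psi.

Definition level (i : nat) (a : A) : Prop := exists M, psi i M = a.

Lemma level_le i j a : (i <= j)%N -> level i a -> level j a.
Proof.
elim: j => [|j IH]; first by rewrite leqn0 => /eqP ->.
rewrite leq_eqVlt => /orP[/eqP ->//|/IH H /H [M <-]].
by case: psiP => _ /(_ j M) [M' <-] _; exists M'.
Qed.

Lemma levelM i x y : level i x -> level i y -> level i (x * y).
Proof. by move=> [M <-] [N <-]; exists (M * N); rewrite rmorphM. Qed.

Lemma levelZD i k x y : level i x -> level i y -> level i (k *: x + y).
Proof. by move=> [M <-] [N <-]; exists (k *: M + N); rewrite linearP. Qed.

Lemma level_family (I : finType) (f : I -> A) i0 :
  exists j, (i0 <= j)%N /\ forall i, level j (f i).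
Proof.
have lev (x : I) : exists i, level i (f x).
  by case: psiP => _ _ /(_ (f x)) [i [M E]]; exists i, M.
have /choice [h hP] := lev.
exists (i0 + \sum_x h x)%N; split; first exact: leq_addr.
move=> x; apply: level_le (hP x); rewrite (bigD1 x) //=.
by rewrite addnCA leq_addr.
Qed.

Lemma psi_inj i : injective (psi i). Proof. exact: mx_hom_inj. Qed.

Lemma psi_graded i : graded_hom (psi i). Proof. by case: psiP. Qed.

Lemma psi_reflect i g M : acomp g (psi i M) -> @acomp _ _ (elementary F (d i)) g M.
Proof. exact: (graded_hom_reflect (@psi_graded i) (@psi_inj i)). Qed.

Definition unit_mx i (a b : 'I_(n i).+1) : A := psi i (delta_mx a b).

Lemma unit_mxM i a b c e :
  @unit_mx i a b * @unit_mx i c e = if b == c then @unit_mx i a e else 0.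
Proof.
rewrite /unit_mx -rmorphM /=.
have -> : (delta_mx a b * delta_mx c e : 'M[F]_((n i).+1)) =
    if b == c then delta_mx a e else 0.
  rewrite -[LHS]/(_ *m _); case: eqP => [->|/eqP nbc]; first by rewrite mul_delta_mx.
  by rewrite mul_delta_mx_0.
by case: ifP; rewrite ?linear0.
Qed.

Lemma unit_mx_sum i : \sum_a @unit_mx i a a = 1.
Proof. by rewrite /unit_mx -linear_sum -mx1_sum_delta rmorph1. Qed.

Lemma acomp_unit_mx i a b : acomp (d i a * (d i b)^-1)%g (@unit_mx i a b).
Proof. exact/psi_graded/elem_E. Qed.

Lemma psi_unit_mx i M : psi i M = \sum_a \sum_b M a b *: @unit_mx i a b.
Proof.
rewrite {1}(matrix_sum_delta M) linear_sum; apply: eq_bigr => a _.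
by rewrite linear_sum; apply: eq_bigr => b _; rewrite linearZ.
Qed.

(** Up to shift, [A_i E_00] is the only simple graded module of the matrix
  algebra [A_i]; the module it generates over [A] stands for the whole level
  in K-theory. *)
Definition corner_idem i : A := @unit_mx i ord0 ord0.

Lemma acomp_corner_idem i : acomp 1%g (corner_idem i).
Proof. by rewrite -(mulgV (d i ord0)); apply: acomp_unit_mx. Qed.

Lemma corner_idemM i : corner_idem i * corner_idem i = corner_idem i.
Proof. by rewrite unit_mxM eqxx. Qed.

Lemma corner_idem_neq0 i : corner_idem i != 0.
Proof.
rewrite /corner_idem /unit_mx raddf_eq0; last exact: psi_inj.
by apply/eqP => /matrixP/(_ ord0 ord0) /eqP; rewrite !mxE eqxx oner_eq0.
Qed.

Lemma corner_scalar i x : level i x -> corner_idem i * x = x ->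
  x * corner_idem i = x -> exists c : F, x = c *: corner_idem i.
Proof.
move=> [M <-] l r; exists (M ord0 ord0).
have <- : psi i (delta_mx ord0 ord0 *m M *m delta_mx ord0 ord0) = psi i M.
  by rewrite -[X in psi i X]/(_ * _ * _) !rmorphM /= l r.
rewrite /corner_idem /unit_mx -linearZ /=; congr (psi i _).
apply/matrixP => a b; rewrite !mxE (bigD1 ord0) //= big1 ?addr0.
  rewrite !mxE (bigD1 ord0) //= big1 ?addr0 => [|l' /negPf nl].
    rewrite !mxE !eqxx andbT /=.
    by case: (a == ord0); case: (b == ord0); rewrite /= ?mul1r ?mul0r ?mulr1 ?mulr0.
  by rewrite mxE nl andbF mul0r.
by move=> k /negPf nk; rewrite [X in _ * X]mxE nk mulr0.
Qed.

End Levels.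
(** * Graded-division algebras over an algebraically closed field *)

Section Eigenvector.
Import VectorInternalTheory.

Lemma falg_eigenvector (F : closedFieldType) (D : falgType F) (x : D) :
  exists (c : F) (v : D), v != 0 /\ v * x = c *: v.
Proof.
pose f := amulr x : 'End(D).
have [c] : exists c, root (char_poly (f2mx f)) c.
  apply/closed_rootP; rewrite size_char_poly; apply/negP => /eqP [] dim0.
  by have := FalgType_proper D; rewrite /= dim0.
rewrite -eigenvalue_root_char => /eigenvalueP[v vE nzv].
exists c, (r2v v); split.
  by apply: contraNneq nzv => v0; rewrite -[v]r2vK v0 linear0.
have -> : r2v v * x = f (r2v v) by rewrite /f lfunE.
by rewrite unlock /= r2vK vE linearZ.
Qed.

End Eigenvector.

Section DivisionAlgebra.
Variables (gT : finGroupType) (abG : abelian [set: gT]) (F : closedFieldType).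
Variables (D : falgType F) (gD : grading gT D).
Hypotheses (hDdiv : graded_division gD) (hDcs : central_simple D).
Local Notation DG := (GrAlg gD).
Local Notation T := (graded_support gD).

(** A finite-dimensional algebra over an algebraically closed field has no
  division subalgebra beyond the scalars: [x - c] kills an eigenvector. *)
Lemma neutral_scalar (x : D) : gcomp gD 1%g x -> exists c : F, x = c%:A.
Proof.
move=> x1; have [c [v [nzv vx]]] := falg_eigenvector x; exists c.
apply/eqP; rewrite -subr_eq0; apply: contraNT nzv => nz.
have u : x - c%:A \is a GRing.unit.
  apply: (hDdiv (g := 1%g)) nz; rewrite addrC -scaleNr.
  by apply: gcompZD => //; apply: (@acomp1 _ _ DG).
by rewrite -(mulrK u v) mulrBr vx -scalerAr mulr1 subrr mul0r.
Qed.

(** One homogeneous vector per degree is a basis, because the neutral component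
  is the ground field; the choice [X 1 = 1] makes the [X_1]-coordinate the
  canonical projection to the ground field. *)
Definition hbasis (t : gT) : D :=
  if t == 1%g then 1 else
  if pselect (exists2 x, gcomp gD t x & x != 0) is left h
  then projT1 (cid2 h) else 0.
Local Notation X := hbasis.

Lemma hbasisP t : gcomp gD t (X t).
Proof.
rewrite /hbasis; case: (t =P 1%g) => [->|_]; first exact: (@acomp1 _ _ DG).
by case: pselect => [h|_]; [case: cid2|apply: gcomp0].
Qed.

Lemma hbasis_neq0 t : (X t != 0) = (t \in T).
Proof.
rewrite inE /hbasis; case: (t =P 1%g) => [->|_].
  rewrite oner_neq0; symmetry; apply/asboolP; exists 1; last exact: oner_neq0.
  exact: (@acomp1 _ _ DG).
case: pselect => [h|h].
  by case: cid2 => /= x _ ->; symmetry; apply/asboolP.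
by rewrite eqxx; symmetry; apply/asboolP.
Qed.

Lemma hbasis1 : X 1%g = 1. Proof. by rewrite /hbasis eqxx. Qed.

Lemma hbasis_unit t : t \in T -> X t \is a GRing.unit.
Proof. by rewrite -hbasis_neq0; apply: hDdiv; apply: hbasisP. Qed.

Lemma support_in t (x : D) : gcomp gD t x -> x != 0 -> t \in T.
Proof. by move=> tx nz; rewrite inE; apply/asboolP; exists x. Qed.

Lemma gcompV t (x : D) : gcomp gD t x -> x != 0 -> gcomp gD t^-1%g x^-1.
Proof.
move=> tx nz; have u := hDdiv tx nz.
by apply: (@acomp_inverse _ _ DG t x); rewrite ?mulrV ?mulVr.
Qed.

Lemma support1 : 1%g \in T.
Proof. by apply: (@support_in _ 1); [apply: (@acomp1 _ _ DG)|apply: oner_neq0]. Qed.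

Lemma support_group : group_set T.
Proof.
apply/group_setP; split=> [|s t sT tT]; first exact: support1.
apply: (@support_in _ (X s * X t)); first by apply: gcompM; apply: hbasisP.
by rewrite mulrI_eq0 ?hbasis_neq0 //; apply/mulrI/hbasis_unit.
Qed.
Local Notation TG := (group support_group).

Lemma supportM s t : s \in T -> t \in T -> (s * t)%g \in T.
Proof. exact: (@groupM _ TG). Qed.

Lemma supportMl s t : s \in T -> ((s * t)%g \in T) = (t \in T).
Proof. exact: (@groupMl _ TG). Qed.

Lemma gcomp_hbasis t (x : D) : gcomp gD t x -> exists c : F, x = c *: X t.
Proof.
move=> tx; have [x0|nz] := eqVneq x 0; first by exists 0; rewrite scale0r.
have tT := support_in tx nz; have u := hbasis_unit tT.
have [|c E] := @neutral_scalar (x / X t).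
  rewrite -(mulgV t); apply: gcompM tx _; apply: gcompV; first exact: hbasisP.
  by rewrite hbasis_neq0.
by exists c; rewrite -(mulrVK u x) E mulr_algl.
Qed.

Definition hcoef (t : gT) (x : D) : F :=
  projT1 (cid (gcomp_hbasis (gprojP gD t x))).

Lemma hcoefE t x : gproj gD t x = hcoef t x *: X t.
Proof. by rewrite /hcoef; case: cid. Qed.

Lemma hbasis_expand (x : D) : x = \sum_(t in T) hcoef t x *: X t.
Proof.
rewrite {1}(gproj_sum gD x) [RHS]big_mkcond /=; apply: eq_bigr => t _.
rewrite hcoefE; case: ifPn => // tT.
by move: tT; rewrite -hbasis_neq0 negbK => /eqP ->; rewrite scaler0.
Qed.

Lemma hcoef_uniq t x c : t \in T -> gproj gD t x = c *: X t -> hcoef t x = c.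
Proof.
rewrite -hbasis_neq0 hcoefE => nz /eqP.
by rewrite -subr_eq0 -scalerBl scaler_eq0 (negPf nz) orbF subr_eq0 => /eqP.
Qed.

Lemma hcoef_linear t : t \in T -> forall (k : F) x y,
  hcoef t (k *: x + y) = k * hcoef t x + hcoef t y.
Proof.
move=> tT k x y; apply: hcoef_uniq => //.
by rewrite linearP /= !hcoefE scalerDl scalerA.
Qed.

Lemma hcoef0 t : t \in T -> hcoef t 0 = 0.
Proof. by move=> tT; apply: hcoef_uniq => //; rewrite linear0 scale0r. Qed.

Lemma hcoef_sum t (I : Type) (r : seq I) (P : pred I) (k : I -> F) (x : I -> D) :
  t \in T -> hcoef t (\sum_(i <- r | P i) k i *: x i) =
    \sum_(i <- r | P i) k i * hcoef t (x i).
Proof.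
move=> tT; elim: r => [|i r IH]; first by rewrite !big_nil hcoef0.
by rewrite !big_cons; case: ifP => // _; rewrite hcoef_linear // IH.
Qed.

Lemma hcoef_hbasis s t : s \in T -> hcoef s (X t) = (s == t)%:R.
Proof.
move=> sT; apply: hcoef_uniq => //; rewrite (gproj_id _ (hbasisP t)).
by case: eqP => [->|_]; rewrite ?scale1r ?scale0r.
Qed.

Lemma hcoef_delta t : t \in T -> hcoef t (X t) = 1.
Proof. by move=> tT; rewrite hcoef_hbasis ?eqxx. Qed.

Lemma central_neutral (x : D) : (forall s, s \in T -> X s * x = x * X s) ->
  exists c : F, x = c%:A.
Proof.
move=> xC; have : x \in 'Z({:D})%VS.
  rewrite memv_cap memvf /=; apply/centvP => y _.
  rewrite (hbasis_expand y) mulr_sumr mulr_suml; apply: eq_bigr => s sT.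
  by rewrite -scalerAr -scalerAl xC.
by have [-> _] := hDcs; move/vlineP.
Qed.

Definition avg (d : D) : D := \sum_(t in T) X t * d / X t.

Lemma conj_homogeneous t (x d : D) : gcomp gD t x -> x != 0 ->
  x * d / x = X t * d / X t.
Proof.
move=> tx nz; have tT := support_in tx nz; have [c E] := gcomp_hbasis tx.
have nzc : c != 0 by apply: contraNneq nz => c0; rewrite E c0 scale0r.
rewrite E invrZ ?unitfE ?hbasis_unit //.
by rewrite -!scalerAl -scalerAr scalerA divff ?scale1r.
Qed.

(** Averaging over conjugation by homogeneous units lands in the centre, which
  consists of scalars, and so extracts the neutral component. *)
Lemma avgE (d : D) : avg d = (#|T|%:R * hcoef 1%g d)%:A.
Proof.
have cen e : exists c : F, avg e = c%:A.
  apply: central_neutral => s sT; have us := hbasis_unit sT.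
  apply: (canRL (mulrVK us)); rewrite /avg mulr_sumr mulr_suml.
  rewrite [RHS](reindex_inj (mulgI s)) /=.
  rewrite [RHS](eq_bigl (fun t => t \in T)) => [|t]; last first.
    exact: supportMl.
  apply: eq_bigr => t tT; have ut := hbasis_unit tT.
  rewrite -(@conj_homogeneous (s * t)%g (X s * X t)).
  - by rewrite invrM // !mulrA.
  - by apply: gcompM; apply: hbasisP.
  by rewrite mulrI_eq0 ?hbasis_neq0 //; apply/mulrI.
have avgZ k e f : avg (k *: e + f) = k *: avg e + avg f.
  rewrite /avg scaler_sumr -big_split; apply: eq_bigr => t _ /=.
  by rewrite mulrDr mulrDl -scalerAr -scalerAl.
have avg0 : avg 0 = 0.
  by rewrite /avg big1 // => t _; rewrite mulr0 mul0r.
have avg1 t : t \in T -> avg (X t) = (#|T|%:R * (1%g == t)%:R)%:A * X t.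
  move=> tT; case: eqP => [<-|/eqP nt].
    rewrite mulr1 /avg (eq_bigr (fun=> 1)) => [|s sT].
      by rewrite sumr_const hbasis1 mulr1 scaler_nat.
    by rewrite hbasis1 mulr1 divrr ?hbasis_unit.
  rewrite mulr0 scale0r mul0r; have [c E] := cen (X t).
  apply/eqP; apply: contraNT nt => nz; apply/eqP.
  apply: (@acomp_neq0_inj _ _ DG) (nz); first by rewrite E; apply/acompZ/acomp1.
  rewrite /avg; apply: (@acomp_sum _ _ DG) => s sT.
  have cG : t = (s * t * s^-1)%g by rewrite (centsP abG s _ t) ?inE // mulgK.
  rewrite {1}cG; apply: gcompM; first by apply: gcompM; apply: hbasisP.
  by apply: gcompV; rewrite ?hbasis_neq0 //; apply: hbasisP.
rewrite {1}(hbasis_expand d).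
transitivity (\sum_(t in T) hcoef t d *: avg (X t)).
  apply: (big_rec2 (fun x y => avg x = y)); first exact: avg0.
  by move=> t x y tT <-; apply: avgZ.
rewrite (bigD1 1%g) ?support1 //= big1 => [|t /andP[tT /negPf nt]].
  by rewrite addr0 avg1 ?support1 // eqxx mulr1 hbasis1 mulr1 scalerA mulrC.
by rewrite avg1 // eq_sym nt mulr0 scale0r mul0r scaler0.
Qed.

Lemma commutation_scalar s t : s \in T -> t \in T ->
  exists2 c : F, c != 0 & X s * X t = c *: (X t * X s).
Proof.
move=> sT tT; have us := hbasis_unit sT; have ut := hbasis_unit tT.
have [c E] : exists c : F, X s * X t / X s = c *: X t.
  apply: gcomp_hbasis; rewrite {1}(_ : t = (s * t * s^-1)%g).
    apply: gcompM; first by apply: gcompM; apply: hbasisP.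
    by apply: gcompV; rewrite ?hbasis_neq0 //; apply: hbasisP.
  by rewrite (centsP abG s _ t) ?inE // mulgK.
have E' : X s * X t = c *: (X t * X s) by rewrite scalerAl -E mulrVK.
exists c => //; apply: contraTneq isT => c0.
have : X s * X t == 0 by rewrite E' c0 scale0r.
rewrite mulrI_eq0; last exact: mulrI.
by rewrite -[_ == _]negbK hbasis_neq0 tT.
Qed.

(** If [s] in [T] had order the characteristic [p], then conjugation by [X_s]
  would scale each [X_t] by a [p]-th root of unity, that is by 1. *)
Lemma card_support_neq0 : #|T|%:R != 0 :> F.
Proof.
apply/negP => T0; have cT : (0 < #|T|)%N by rewrite (cardD1 1%g) support1.
have [p pp pc] : exists2 p, prime p & p \in [pchar F] /\ (p %| #|T|)%N.
  have [p pC] := natf0_pchar cT T0; exists p; first exact: pcharf_prime pC.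
  by split=> //; rewrite (dvdn_pcharf pC).
case: pc => pC pd; have [s sT os] := @Cauchy _ p TG pp pd.
have [|c E] := @central_neutral (X s).
  move=> t tT; have [b nzb E] := commutation_scalar sT tT.
  have pw k : X s ^+ k * X t = b ^+ k *: (X t * X s ^+ k).
    elim: k => [|k IH]; first by rewrite !expr0 mul1r mulr1 scale1r.
    rewrite exprS -mulrA IH -scalerAr [X s * (X t * _)]mulrA E.
    by rewrite -scalerAl scalerA -mulrA -exprSr.
  have xk k : gcomp gD (s ^+ k)%g (X s ^+ k).
    elim: k => [|k IH]; first exact: (@acomp1 _ _ DG).
    by rewrite expgS exprS; apply: gcompM => //; apply: hbasisP.
  have : gcomp gD 1%g (X s ^+ p) by rewrite -(expg_order s) os; apply: xk.
  case/neutral_scalar => a aE; move: (pw p); rewrite aE.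
  have nza : a != 0.
    apply: contraTneq (hbasis_unit sT) => a0; apply/negP => /(unitrX p).
    by rewrite aE a0 scale0r unitr0.
  rewrite mulr_algl mulr_algr scalerA => /eqP.
  rewrite -subr_eq0 -scalerBl scaler_eq0 (negPf (_ : X t != 0)) ?hbasis_neq0 //.
  rewrite orbF -{1}[a]mul1r -mulrBl mulf_eq0 (negPf nza) orbF => /eqP b1.
  have : pFrobenius_aut pC (b - 1) = 0.
    rewrite rmorphB rmorph1 /= pFrobenius_autE; apply/eqP.
    by rewrite -oppr_eq0 opprB b1.
  by move/eqP; rewrite fmorph_eq0 subr_eq0 => /eqP b1'; rewrite E b1' scale1r.
have := order_gt1 s; rewrite os prime_gt1 // => /esym/eqP; apply.
have X1 : @acomp _ _ DG 1%g (X s) by rewrite E; apply/acompZ/acomp1.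
by rewrite (acomp_neq0_inj (hbasisP s : @acomp _ _ DG s (X s)) X1) ?hbasis_neq0.
Qed.

End DivisionAlgebra.
(** * Homomorphisms out of the tensor product *)

Section TensorHom.
Variables (F : fieldType) (A : algType F) (D : falgType F) (C : algType F).
Variables (f : {lrmorphism A -> C}) (g : {lrmorphism D -> C}).
Hypothesis fgC : forall a d, f a * g d = g d * f a.
Local Notation b := (vbasis {:D}).

Definition tens_hom_fun (x : tens A D) : C := \sum_i f (x i) * g b`_i.

Lemma tens_hom_linear : linear tens_hom_fun.
Proof.
move=> k x y; rewrite /tens_hom_fun scaler_sumr -big_split; apply: eq_bigr => i _ /=.
by rewrite !ffunE linearP mulrDl -scalerAl.
Qed.

HB.instance Definition _ :=
  GRing.isLinear.Build F (tens A D) C *:%R tens_hom_fun tens_hom_linear.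

Lemma tens_hom_pure a d : tens_hom_fun (pure a d) = f a * g d.
Proof.
rewrite [d in RHS]coord_fullv linear_sum mulr_sumr; apply: eq_bigr => i _.
by rewrite ffunE !linearZ /= -scalerAl -scalerAr.
Qed.

Lemma tens_hom_monoid : monoid_morphism tens_hom_fun.
Proof.
split=> [|x y]; first by rewrite tens_hom_pure !rmorph1 mulr1.
rewrite (tensE x) mulr_suml !linear_sum mulr_suml; apply: eq_bigr => i _.
rewrite (tensE y) mulr_sumr !linear_sum mulr_sumr; apply: eq_bigr => j _.
rewrite /= -[pure _ _ * _]/(tens_mul _ _) pureM !tens_hom_pure !rmorphM.
by rewrite -!mulrA; congr (_ * _); rewrite !mulrA fgC.
Qed.

HB.instance Definition _ :=
  GRing.isMonoidMorphism.Build (tens A D) C tens_hom_fun tens_hom_monoid.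

Definition tens_hom : {lrmorphism tens A D -> C} := tens_hom_fun.

End TensorHom.

Section TensorFactors.
Variables (gT : finGroupType) (abG : abelian [set: gT]) (F : fieldType).
Variables (A : gralg gT F) (D : falgType F) (gD : grading gT D).
Local Notation AD := (gtensor abG A gD).
Local Notation DG := (GrAlg gD).

Definition inl_fun (a : A) : AD := pure a 1.
Definition inr_fun (d : D) : AD := pure 1 d.

Lemma inl_linear : linear inl_fun. Proof. exact: pure_linearl. Qed.
Lemma inr_linear : linear inr_fun. Proof. exact: pure_linearr. Qed.

Lemma inl_monoid : monoid_morphism inl_fun.
Proof.
split=> // x y; rewrite -[RHS]/(tens_mul (pure x 1) (pure y 1)) pureM mulr1 //.
Qed.

Lemma inr_monoid : monoid_morphism inr_fun.
Proof.
split=> // x y; rewrite -[RHS]/(tens_mul (pure 1 x) (pure 1 y)) pureM mulr1 //.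
Qed.

HB.instance Definition _ := GRing.isLinear.Build F A AD *:%R inl_fun inl_linear.
HB.instance Definition _ := GRing.isMonoidMorphism.Build A AD inl_fun inl_monoid.
HB.instance Definition _ := GRing.isLinear.Build F D AD *:%R inr_fun inr_linear.
HB.instance Definition _ := GRing.isMonoidMorphism.Build D AD inr_fun inr_monoid.

Definition tens_inl : {lrmorphism A -> AD} := inl_fun.
Definition tens_inr : {lrmorphism D -> AD} := inr_fun.

Lemma pure_inlr a d : pure a d = tens_inl a * tens_inr d :> AD.
Proof.
by rewrite -[RHS]/(tens_mul (pure a 1) (pure 1 d)) pureM mulr1 mul1r.
Qed.

Lemma tens_inlrC a d : tens_inl a * tens_inr d = tens_inr d * tens_inl a.
Proof.
rewrite -[LHS]/(tens_mul (pure a 1) (pure 1 d)) -[RHS]/(tens_mul (pure 1 d) (pure a 1)).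
by rewrite !pureM !mulr1 !mul1r.
Qed.

Lemma tens_inl_graded : graded_hom tens_inl.
Proof.
move=> g a ga; rewrite -[g]mulg1; apply: (@tens_comp_pure _ _ A D gD) => //.
exact: (@acomp1 _ _ DG).
Qed.

Lemma tens_inr_graded : graded_hom (tens_inr : {lrmorphism DG -> AD}).
Proof.
move=> g d gd; rewrite -[g]mul1g; apply: (@tens_comp_pure _ _ A D gD) => //.
exact: acomp1.
Qed.

Lemma tens_inl_inj : injective tens_inl.
Proof.
apply: raddf_inj => a /ffunP E; apply/eqP; apply: contraT => nz.
have /eqP[] := oner_neq0 D; rewrite (coord_fullv 1) big1 // => i _.
move: (E i); rewrite !ffunE => /eqP.
by rewrite scaler_eq0 (negPf nz) orbF => /eqP ->; rewrite scale0r.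
Qed.

End TensorFactors.

Section TensorExpansion.
Variables (gT : finGroupType) (abG : abelian [set: gT]) (F : closedFieldType).
Variables (A : gralg gT F) (D : falgType F) (gD : grading gT D).
Hypothesis hDdiv : graded_division gD.

Lemma tens_expand (x : gtensor abG A gD) : exists a : gT -> A,
  x = \sum_(t in graded_support gD) pure (a t) (hbasis gD t).
Proof.
pose b := vbasis {:D}.
exists (fun t => \sum_(i < \dim {:D}) hcoef hDdiv t b`_i *: x i).
rewrite {1}(tensE x) (eq_bigr (fun i : 'I_(\dim {:D}) => \sum_(t in graded_support gD)
    pure_r (hbasis gD t) (hcoef hDdiv t b`_i *: x i))) => [|i _].
  by rewrite exchange_big; apply: eq_bigr => t _; rewrite -pure_rE linear_sum.
rewrite {1}(hbasis_expand hDdiv (vbasis _)`_i) linear_sum; apply: eq_bigr => t _.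
by rewrite linearZ /= -!pure_rE linearZ.
Qed.

End TensorExpansion.
(** * Absorbing a graded-division algebra *)

Section Flip.
Variables (gT : finGroupType) (abG : abelian [set: gT]) (F : closedFieldType).
Variables (D : falgType F) (gD : grading gT D).
Hypotheses (hDdiv : graded_division gD) (hDcs : central_simple D).
Variable A : gralg gT F.
Local Notation DG := (GrAlg gD).
Local Notation T := (graded_support gD).
Local Notation X := (hbasis gD).
Variables lam mu : {lrmorphism D -> A}.
Hypothesis comm : forall c d, lam c * mu d = mu d * lam c.

(** The Casimir element of [D], split between two commuting copies of [D]. *)
Definition flip : A := \sum_(t in T) lam (X t) * mu (X t)^-1.

(** The summand depends only on the degree, the scalars cancelling out; this
  allows reindexing by translations of the support. *)
Lemma flip_term t (x : D) : gcomp gD t x -> x != 0 ->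
  lam x * mu x^-1 = lam (X t) * mu (X t)^-1.
Proof.
move=> tx nz; have tT := support_in tx nz.
have [c E] := gcomp_hbasis hDdiv tx.
have nzc : c != 0 by apply: contraNneq nz => c0; rewrite E c0 scale0r.
rewrite E invrZ ?unitfE ?hbasis_unit // !linearZ /=.
by rewrite -scalerAl -scalerAr scalerA divff ?scale1r.
Qed.

Lemma flip_left d : flip * lam d = mu d * flip.
Proof.
have [w wE] : exists w, w = flip by exists flip.
rewrite -wE (hbasis_expand hDdiv d) !linear_sum mulr_suml mulr_sumr.
apply: eq_bigr => s sT; rewrite !linearZ /= -scalerAl -scalerAr; congr (_ *: _).
have us := hbasis_unit hDdiv sT.
rewrite wE /flip mulr_suml mulr_sumr [RHS](reindex_inj (mulIg s)) /=.
rewrite [RHS](eq_bigl (fun t => t \in T)) => [|t]; last first.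
  by rewrite (@groupMr _ (group (support_group hDdiv))).
apply: eq_bigr => t tT; have ut := hbasis_unit hDdiv tT.
rewrite -(@flip_term (t * s)%g (X t * X s)).
- by rewrite invrM // -mulrA -comm mulrA -rmorphM mulrA -comm -mulrA -rmorphM mulVKr.
- by apply: gcompM; apply: hbasisP.
by rewrite mulrI_eq0 ?hbasis_neq0 //; apply/mulrI.
Qed.

(** Moving the first factor across leaves averages of the [X_s^-1], which vanish
  except at [s = 1]. *)
Lemma flip_sqr : flip * flip = #|T|%:R.
Proof.
rewrite {2}/flip mulr_sumr.
transitivity (\sum_(t in T) \sum_(s in T) lam (X s) * mu (X t * (X s)^-1 * (X t)^-1)).
  apply: eq_bigr => t tT; rewrite mulrA flip_left mulr_sumr mulr_suml.
  by apply: eq_bigr => s sT; rewrite !mulrA -comm -!mulrA -!rmorphM !mulrA.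
rewrite exchange_big /=.
under eq_bigr => s sT do rewrite -mulr_sumr -linear_sum
  -[\sum_(t in _) _]/(avg gD (X s)^-1) avgE //.
rewrite (bigD1 1%g) ?support1 //= big1 ?addr0 => [|s /andP[sT ns]].
  by rewrite hbasis1 invr1 -(hbasis1 gD) hcoef_delta ?support1 // mulr1 hbasis1
             !rmorph1 mul1r linearZ rmorph1 /= scaler_nat.
rewrite (_ : hcoef _ _ _ = 0) ?mulr0 ?scale0r ?linear0 ?mulr0 //.
apply: hcoef_uniq; rewrite ?support1 // scale0r.
have sX : gcomp gD s^-1%g (X s)^-1.
  by apply: gcompV; rewrite ?hbasis_neq0 //; apply: hbasisP.
by rewrite (gproj_id _ sX) eq_sym invg_eq1 (negPf ns).
Qed.

Hypothesis hlam : graded_hom (lam : {lrmorphism DG -> A}).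
Hypothesis hmu : graded_hom (mu : {lrmorphism DG -> A}).

Lemma acomp_flip : acomp 1%g flip.
Proof.
apply: acomp_sum => t tT; rewrite -(mulgV t); apply: acompM.
  by apply: hlam; apply: hbasisP.
by apply: hmu; apply: gcompV; rewrite ?hbasis_neq0 //; apply: hbasisP.
Qed.

End Flip.
(** Let [B_0], [B_1], ... be a chain exhausting [A], with copies [lam k] of [D]
  commuting with [B_k] and contained in [B_(k+1)]. Conjugation by the product of
  the first [k] flips stabilizes on each [B_i], and in the limit it is an
  endomorphism of [A] carrying [lam k] to [lam (k+1)]. Its image commutes with
  [lam 0], so that [D] fits into the place left free. *)
Section Absorption.
Variables (gT : finGroupType) (abG : abelian [set: gT]) (F : closedFieldType).
Variables (D : falgType F) (gD : grading gT D).
Hypotheses (hDdiv : graded_division gD) (hDcs : central_simple D).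
Variable A : gralg gT F.
Local Notation DG := (GrAlg gD).
Local Notation T := (graded_support gD).
Local Notation X := (hbasis gD).

Variables (B : nat -> A -> Prop) (lam : nat -> {lrmorphism D -> A}).
Hypotheses (lamG : forall k, graded_hom (lam k : {lrmorphism DG -> A}))
  (lamC : forall k a d, B k a -> a * lam k d = lam k d * a)
  (lamB : forall k d, B k.+1 (lam k d))
  (Bmono : forall k a, B k a -> B k.+1 a)
  (Bfam : forall (I : finType) (f : I -> A), exists k, forall i, B k (f i)).

Let nzT : #|T|%:R != 0 :> F.
Proof. exact: card_support_neq0. Qed.

Let Ble k m a : (k <= m)%N -> B k a -> B m a.
Proof.
move=> /subnKC <-; elim: (m - k)%N => [|i IH]; first by rewrite addn0.
by rewrite addnS => /IH; apply: Bmono.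
Qed.

Let lam2C k c d : lam k c * lam k.+1 d = lam k.+1 d * lam k c.
Proof. by apply: lamC; apply: lamB. Qed.

Definition flips k : A := flip gD (lam k) (lam k.+1).

Let w_left k d : flips k * lam k d = lam k.+1 d * flips k.
Proof. by apply: flip_left => //; apply: lam2C. Qed.

Let w_sqr k : flips k * flips k = #|T|%:R.
Proof. by apply: flip_sqr => //; apply: lam2C. Qed.

Let w_comm k a : B k a -> a * flips k = flips k * a.
Proof.
move=> Ba; rewrite /flips /flip mulr_sumr mulr_suml; apply: eq_bigr => t _.
by rewrite mulrA [a * _]lamC // -!mulrA [a * _]lamC //; apply: Bmono.
Qed.

Fixpoint conjl k : A := if k is j.+1 then conjl j * flips j else 1.
Fixpoint conjr k : A :=
  if k is j.+1 then (#|T|%:R : F)^-1 *: (flips j * conjr j) else 1.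

Let uv k : conjl k * conjr k = 1.
Proof.
elim: k => [|k IH] /=; first by rewrite mulr1.
rewrite -scalerAr mulrA -(mulrA (conjl k)) w_sqr mulr_natr mulrnAl IH.
by rewrite -scaler_nat scalerA mulVf ?scale1r.
Qed.

Let vu k : conjr k * conjl k = 1.
Proof.
elim: k => [|k IH] /=; first by rewrite mulr1.
rewrite -scalerAl -mulrA (mulrA (conjr k)) IH mul1r w_sqr.
by rewrite -scaler_nat scalerA mulVf ?scale1r.
Qed.

Let acomp_w k : acomp 1%g (flips k).
Proof. exact: acomp_flip. Qed.

Let acomp_u k : acomp 1%g (conjl k).
Proof.
elim: k => [|k IH] /=; first exact: acomp1.
by rewrite -(mulg1 1%g); apply: acompM.
Qed.

Let acomp_v k : acomp 1%g (conjr k).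
Proof.
elim: k => [|k IH] /=; first exact: acomp1.
by apply: acompZ; rewrite -(mulg1 1%g); apply: acompM.
Qed.

(* Flips beyond level [k] commute with [B k], and cancel. *)
Let conj_stable k m a : B k a -> conjl (k + m) * a * conjr (k + m) = conjl k * a * conjr k.
Proof.
move=> Ba; elim: m => [|m IH]; first by rewrite addn0.
rewrite addnS /= -IH -scalerAr mulrA -(mulrA (conjl _) (flips _)).
rewrite -w_comm; last by apply: Ble Ba; rewrite leq_addr.
rewrite !mulrA -(mulrA _ (flips _) (flips _)) w_sqr mulr_natr mulrnAl.
by rewrite -scaler_nat scalerA mulVf ?scale1r.
Qed.

Let lev (a : A) : nat := projT1 (cid (Bfam (fun _ : 'I_1 => a))).

Let levP a : B (lev a) a.
Proof. by rewrite /lev; case: cid => k /= /(_ ord0). Qed.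

Definition shift_fun (a : A) : A := conjl (lev a) * a * conjr (lev a).

Let sE k a : B k a -> shift_fun a = conjl k * a * conjr k.
Proof.
move=> Ba; rewrite /shift_fun -(conj_stable k (levP a)) addnC.
exact: conj_stable.
Qed.

Let common2 a b c : exists k, [/\ B k a, B k b & B k c].
Proof.
have [k kP] := Bfam (fun i : 'I_3 => nth 0 [:: a; b; c] i).
by exists k; split; [have := kP (inord 0)|have := kP (inord 1)|have := kP (inord 2)];
  rewrite inordK.
Qed.

Let shift_linear : linear shift_fun.
Proof.
move=> c x y; have [k [Bx By Bz]] := common2 x y (c *: x + y).
by rewrite (sE Bx) (sE By) (sE Bz) mulrDr mulrDl -scalerAr -scalerAl.
Qed.

Let shift_monoid : monoid_morphism shift_fun.
Proof.
split=> [|x y].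
  by rewrite /shift_fun mulr1 uv.
have [k [Bx By Bz]] := common2 x y (x * y).
by rewrite (sE Bx) (sE By) (sE Bz) !mulrA -(mulrA _ (conjr k)) vu mulr1.
Qed.

HB.instance Definition _ := GRing.isLinear.Build F A A *:%R shift_fun shift_linear.
HB.instance Definition _ := GRing.isMonoidMorphism.Build A A shift_fun shift_monoid.

Definition shift_hom : {lrmorphism A -> A} := shift_fun.

Let shift_graded : graded_hom shift_hom.
Proof.
move=> g x gx; rewrite /= /shift_fun -(mulg1 g) -(mul1g g).
by apply: acompM => //; apply: acompM.
Qed.

Let v_lam k d : lam k d * conjr k = conjr k * lam 0 d.
Proof.
elim: k => [|k IH] /=; first by rewrite mulr1 mul1r.
by rewrite -scalerAr -scalerAl -mulrA -IH !mulrA w_left.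
Qed.

Let lam0E k d : lam 0 d = conjl k * lam k d * conjr k.
Proof. by rewrite -mulrA v_lam mulrA uv mul1r. Qed.

Let lam_u k m d : (k < m)%N -> lam m d * conjl k = conjl k * lam m d.
Proof.
elim: k => [|k IH] km /=; first by rewrite mulr1 mul1r.
rewrite mulrA IH; last exact: ltnW.
rewrite -!mulrA; congr (_ * _); rewrite /flips /flip mulr_sumr mulr_suml.
apply: eq_bigr => t _.
have cm j e : (j < m)%N -> lam m d * lam j e = lam j e * lam m d.
  by move=> jm; apply: esym; apply: lamC; apply: Ble (lamB _ _).
by rewrite mulrA cm ?(ltnW km) // -!mulrA cm.
Qed.

Let shift_lam k d : shift_hom (lam k d) = lam k.+1 d.
Proof.
rewrite /= (sE (lamB k d)) /=.
rewrite -(mulrA (conjl k)) w_left mulrA -lam_u // -!mulrA.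
rewrite -[conjl k * (flips k * _)]/(conjl k * (flips k * conjr k.+1)).
by rewrite (mulrA (conjl k)) (uv k.+1) mulr1.
Qed.

Let shift_comm a d : shift_hom a * lam 0 d = lam 0 d * shift_hom a.
Proof.
rewrite /= (sE (levP a)) (lam0E (lev a)); set u := conjl _; set v := conjr _.
rewrite !mulrA -!(mulrA _ v u) vu !mulr1.
by rewrite -(mulrA u) lamC ?mulrA //; apply: levP.
Qed.

Definition absorb : {lrmorphism gtensor abG A gD -> A} := tens_hom shift_comm.

Let absorb_pure a d : absorb (pure a d) = shift_hom a * lam 0 d.
Proof. exact: tens_hom_pure. Qed.

Let absorb_sum (I : Type) (r : seq I) (P : pred I) (f : I -> gtensor abG A gD) :
  absorb (\sum_(i <- r | P i) f i) = \sum_(i <- r | P i) absorb (f i).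
Proof. exact: linear_sum. Qed.

Lemma absorb_graded : graded_hom absorb.
Proof.
move=> g x [s [sP ->]]; rewrite absorb_sum big_seq; apply: acomp_sum => p /sP.
move=> [h [k [hp kp <-]]]; rewrite absorb_pure; apply: acompM.
  exact: shift_graded.
exact: lamG.
Qed.

Lemma absorb_inj : injective absorb.
Proof.
suff inj0 x : absorb x = 0 -> x = 0 by apply: raddf_inj => x /inj0.
have [a ->] := tens_expand hDdiv x; have [k kP] := Bfam a.
rewrite absorb_sum => E; rewrite big1 // => u uT.
have {}E : \sum_(t in T) a t * lam k (X t) = 0.
  rewrite -[LHS]mulr1 -(vu k) -[LHS]mul1r -(vu k) !mulrA.
  have -> : conjr k * conjl k * (\sum_(t in T) a t * lam k (X t)) * conjr k * conjl k =
     conjr k * (\sum_(t in T) absorb (pure (a t) (X t))) * conjl k.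
    congr (_ * _); rewrite -!mulrA; congr (_ * _).
    rewrite !mulr_suml !mulr_sumr; apply: eq_bigr => t tT.
    rewrite absorb_pure /= (sE (kP t)) (lam0E k) !mulrA -(mulrA _ (conjr k)) vu.
    by rewrite mulr1.
  by rewrite E mulr0 mul0r.
suff -> : a u = 0 by rewrite -pure_rE linear0.
(* Twist by X_u^-1 and average over conjugation: only the u-th term survives. *)
have uu := hbasis_unit hDdiv uT.
have : \sum_(s in T) lam k (X s) *
   ((\sum_(t in T) a t * lam k (X t)) * lam k (X u)^-1) * lam k (X s)^-1 = 0.
  by rewrite E big1 // => s _; rewrite mul0r mulr0 mul0r.
rewrite (eq_bigr (fun s => \sum_(t in T)
   a t * lam k (X s * (X t / X u) / X s))) => [|s sT]; last first.
  rewrite mulr_suml mulr_sumr mulr_suml; apply: eq_bigr => t tT.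
  by rewrite !mulrA -lamC // -!mulrA -!rmorphM !mulrA.
rewrite exchange_big (eq_bigr (fun t => a t *
    (#|T|%:R * hcoef hDdiv 1%g (X t / X u))%:A)) => [|t tT]; last first.
  rewrite -mulr_sumr -linear_sum -[\sum_(s in _) _]/(avg gD (X t / X u)).
  by rewrite avgE // linearZ rmorph1.
rewrite (bigD1 u) //= big1 ?addr0 => [|t /andP[tT nt]]; last first.
  rewrite (_ : hcoef _ _ _ = 0) ?mulr0 ?scale0r ?mulr0 //.
  apply: hcoef_uniq; rewrite ?support1 // scale0r.
  have tuX : gcomp gD (t * u^-1)%g (X t / X u).
    apply: gcompM; first exact: hbasisP.
    by apply: gcompV; rewrite ?hbasis_neq0 //; apply: hbasisP.
  by rewrite (gproj_id _ tuX) eq_sym -eq_mulgV1 (negPf nt).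
rewrite divrr // -(hbasis1 gD) hcoef_delta ?support1 // mulr1 -scalerAr mulr1.
by move/eqP; rewrite scaler_eq0 (negPf nzT) => /eqP.
Qed.

(** The image contains every [lam k], since the shift moves [lam k] to
  [lam k.+1]; hence it contains the flips and the conjugators, and with them
  the whole chain. *)
Lemma absorb_surj a : exists x, absorb x = a.
Proof.
pose im b := exists x, absorb x = b.
have imM b c : im b -> im c -> im (b * c).
  by move=> [x <-] [y <-]; exists (x * y); rewrite rmorphM.
have imZ c b : im b -> im (c *: b).
  by move=> [x <-]; exists (c *: x); rewrite linearZ.
have im1 : im 1 by exists 1; rewrite rmorph1.
have imS b : im (shift_hom b).
  by exists (pure b 1); rewrite absorb_pure rmorph1 mulr1.
have imL k d : im (lam k d).
  case: k => [|k]; last by rewrite -shift_lam.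
  by exists (pure 1 d); rewrite absorb_pure rmorph1 mul1r.
have imW k : im (flips k).
  rewrite /flips /flip; elim/big_rec: _ => [|t b _ [x xE]].
    by exists 0; rewrite linear0.
  have [y yE] := imM _ _ (imL k (X t)) (imL k.+1 (X t)^-1).
  by exists (y + x); rewrite -xE -yE; apply: linearD.
have imu k : im (conjl k) by elim: k => //= k IH; apply: imM.
have imv k : im (conjr k) by elim: k => //= k IH; apply: imZ; apply: imM.
have aE : conjr (lev a) * shift_hom a * conjl (lev a) = a.
  by rewrite /= (sE (levP a)) !mulrA vu mul1r -mulrA vu mulr1.
by rewrite -/(im a) -aE; apply: (imM _ _ (imM _ _ (imv _) (imS _)) (imu _)).
Qed.

Lemma absorb_iso : graded_iso (gtensor abG A gD) A.
Proof.
exists absorb; split; last exact: absorb_graded.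
have /choice [f fK] := absorb_surj.
by exists f => // x; apply: absorb_inj; rewrite fK.
Qed.

End Absorption.
(** ** Transport along isomorphisms and passage to a subsequence *)

Section LimitTransport.
Variables (gT : finGroupType) (F : fieldType).
Implicit Types A B : gralg gT F.

Lemma graded_iso_inverse A B (f : {lrmorphism A -> B}) :
  bijective f -> graded_hom f ->
  exists g : {lrmorphism B -> A}, [/\ cancel f g, cancel g f & graded_hom g].
Proof.
move=> bf hf; case: (bf) => g fK gK.
have gl : linear g by apply: can2_linear fK gK.
have gm : monoid_morphism g by apply: can2_monoid_morphism fK gK.
pose g' : {lrmorphism B -> A} := HB.pack g
  (GRing.isLinear.Build F B A *:%R g gl) (GRing.isMonoidMorphism.Build B A g gm).
exists g'; split=> // h x hx.
by apply: (graded_hom_reflect hf (bij_inj bf)); rewrite /= gK.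
Qed.

Lemma elementary_limit_iso A B :
  graded_iso B A -> elementary_limit A -> elementary_limit B.
Proof.
move=> [f [bf hf]] [n [d [phi [psi [phiP [hpsi compat univ]]]]]].
have [g [fK gK hg]] := graded_iso_inverse bf hf.
exists n, d, phi, (fun i => g \o psi i); split=> //; split=> [i h x /hpsi/hg //|i x|].
  by rewrite /= compat.
move=> C xi hxi xiE; have [h [hh hE] uq] := univ C xi hxi xiE.
exists (h \o f); first by split=> [k x /hf/hh //|i x]; rewrite /= gK hE.
move=> f' hf' f'E x; rewrite /= -(uq (f' \o g)) /= ?fK //.
by move=> k y /hg/hf'.
Qed.

End LimitTransport.

Section AbsorptionLevels.
Variables (gT : finGroupType) (abG : abelian [set: gT]) (F : closedFieldType).
Variables (D : falgType F) (gD : grading gT D).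
Hypotheses (hDdiv : graded_division gD) (hDcs : central_simple D).
Variables (A : gralg gT F) (n : nat -> nat).
Variables (d : forall i : nat, {ffun 'I_(n i).+1 -> gT}).
Variable psi : forall i, {lrmorphism elementary F (d i) -> A}.
Hypothesis psiP : exhausts psi.

Definition commuting_copy (i : nat) (lam : {lrmorphism D -> A}) : Prop :=
  graded_hom (lam : {lrmorphism GrAlg gD -> A}) /\
  forall a e, level psi i a -> a * lam e = lam e * a.

Lemma commuting_copies_absorb :
  (forall i, exists lam, commuting_copy i lam) -> graded_iso (gtensor abG A gD) A.
Proof.
move=> /choice [L LP].
have /choice [bnd bndP] : forall i, exists j, (i < j)%N /\ forall e, level psi j (L i e).
  move=> i; have [j [ij jP]] := level_family psiP
    (fun k : 'I_(\dim {:D}) => L i (vbasis {:D})`_k) i.+1.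
  exists j; split=> // e; rewrite (coord_fullv e) linear_sum.
  elim/big_rec: _ => [|k y _ Hy].
    by exists 0; rewrite linear0.
  by rewrite linearZ; apply: levelZD => //; apply: jP.
pose N k := iter k bnd 0%N.
apply: (@absorb_iso _ abG _ _ _ hDdiv hDcs _ (fun k => level psi (N k))
                    (fun k => L (N k))).
- by move=> k; case: (LP (N k)).
- by move=> k a e; case: (LP (N k)) => _; apply.
- by move=> k e; case: (bndP (N k)) => _; apply.
- by move=> k a; apply: level_le => //; apply: ltnW; case: (bndP (N k)).
move=> I f; have [j [_ jP]] := level_family psiP f 0%N; exists j => i.
apply: level_le (jP i) => //; elim: j {jP} => // j IH.
by apply: leq_ltn_trans IH _; case: (bndP (N j)).
Qed.

End AbsorptionLevels.
(** * The semimodule structure of the positive cone *)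

Section PositiveCone.
Variables (gT : finGroupType) (F : fieldType) (A : gralg gT F).
Implicit Types (x y v : K0plus A) (z : {ffun gT -> nat}).
Local Notation "x +k y" := (k0p_add x y) (at level 50, left associativity).
Local Notation "0k" := (k0p_zero A).

Lemma k0p_mulnE n x : k0p_muln n x = \big[@k0p_add gT F A/0k]_(i < n) x.
Proof. by rewrite big_const_ord. Qed.

Lemma k0p_mulnDr n x y : k0p_muln n (x +k y) = k0p_muln n x +k k0p_muln n y.
Proof. by rewrite !k0p_mulnE big_split. Qed.

Lemma k0p_mulnDl m n x : k0p_muln (m + n) x = k0p_muln m x +k k0p_muln n x.
Proof. by rewrite !k0p_mulnE big_split_ord. Qed.

Lemma k0p_mulnA m n x : k0p_muln (m * n) x = k0p_muln m (k0p_muln n x).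
Proof. by elim: m => [|m IH] //; rewrite mulSn k0p_mulnDl IH. Qed.

Lemma k0p_muln0 n : k0p_muln n 0k = 0k.
Proof. by rewrite k0p_mulnE big1. Qed.

Lemma k0p_muln1 x : k0p_muln 1 x = x.
Proof. by rewrite k0p_mulnE big_ord1. Qed.

Lemma k0p_muln_sum n (I : Type) (r : seq I) (P : pred I) (f : I -> K0plus A) :
  k0p_muln n (\big[@k0p_add gT F A/0k]_(i <- r | P i) f i) =
  \big[@k0p_add gT F A/0k]_(i <- r | P i) k0p_muln n (f i).
Proof.
by apply: (big_morph (k0p_muln n)) => [x y|]; [apply: k0p_mulnDr|apply: k0p_muln0].
Qed.

Lemma k0p_sum_muln (I : Type) (r : seq I) (P : pred I) (m : I -> nat) x :
  k0p_muln (\sum_(i <- r | P i) m i) x =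
  \big[@k0p_add gT F A/0k]_(i <- r | P i) k0p_muln (m i) x.
Proof.
by apply: (big_morph (fun n => k0p_muln n x)) => [a b|]; rewrite ?k0p_mulnDl.
Qed.

Lemma k0p_shift0 g : k0p_shift g 0k = 0k.
Proof.
rewrite k0p_shiftE; apply/k0p_classP.
by exists idfun; split=> //; exists idfun.
Qed.

Lemma k0p_shift_sum g (I : Type) (r : seq I) (P : pred I) (f : I -> K0plus A) :
  k0p_shift g (\big[@k0p_add gT F A/0k]_(i <- r | P i) f i) =
  \big[@k0p_add gT F A/0k]_(i <- r | P i) k0p_shift g (f i).
Proof. by apply: big_morph; [apply: k0p_shiftD|apply: k0p_shift0]. Qed.

Lemma k0p_shift_muln g n x : k0p_shift g (k0p_muln n x) = k0p_muln n (k0p_shift g x).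
Proof. by rewrite !k0p_mulnE k0p_shift_sum. Qed.

Lemma k0p_shiftM g h x : k0p_shift g (k0p_shift h x) = k0p_shift (h * g)%g x.
Proof.
elim/k0p_ind: x => P; rewrite !k0p_shiftE; apply/k0p_classP.
exists idfun; split; first by exists idfun.
by move=> k x /=; rewrite /shift_comp /= /shift_comp invMg mulgA.
Qed.

Lemma k0p_shift1 x : k0p_shift 1%g x = x.
Proof.
elim/k0p_ind: x => P; rewrite k0p_shiftE; apply/k0p_classP.
exists idfun; split; first by exists idfun.
by move=> k x /=; rewrite /shift_comp invg1 mulg1.
Qed.

(** Multiplication, and multiples of the unit, in the semiring of combinations
  of group elements with natural coefficients. *)
Definition conv z z' : {ffun gT -> nat} :=
  [ffun k => \sum_g z g * z' (k * g^-1)%g]%N.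
Definition gdelta (n : nat) : {ffun gT -> nat} := [ffun g => n * (g == 1%g)]%N.

Lemma k0p_act_conv z z' v : k0p_act z (k0p_act z' v) = k0p_act (conv z z') v.
Proof.
rewrite /k0p_act; under [RHS]eq_bigr => k _ do rewrite ffunE k0p_sum_muln.
rewrite exchange_big /=; apply: eq_bigr => g _.
rewrite k0p_shift_sum k0p_muln_sum (reindex_inj (mulIg g^-1%g)) /=.
apply: eq_bigr => k _.
by rewrite k0p_shift_muln k0p_shiftM mulgKV -k0p_mulnA.
Qed.

Lemma k0p_act_delta n v : k0p_act (gdelta n) v = k0p_muln n v.
Proof.
rewrite /k0p_act (bigD1 1%g) //= big1 => [|g /negPf ng].
  by rewrite ffunE eqxx muln1 k0p_shift1 (k0p_addC _ 0k) k0p_add0.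
by rewrite ffunE ng muln0.
Qed.

Lemma k0p_act_add z z' v :
  k0p_act [ffun g => z g + z' g]%N v = k0p_act z v +k k0p_act z' v.
Proof.
by rewrite /k0p_act -big_split; apply: eq_bigr => g _; rewrite ffunE k0p_mulnDl.
Qed.

Lemma k0p_act_muln n z v : k0p_act [ffun g => n * z g]%N v = k0p_muln n (k0p_act z v).
Proof.
by rewrite /k0p_act k0p_muln_sum; apply: eq_bigr => g _; rewrite ffunE k0p_mulnA.
Qed.

(** Sums of shifts are indexed by finite families of degrees; only the
  multiplicities of the degrees matter for the class. *)
Definition degree_count (I : finType) (c : I -> gT) : {ffun gT -> nat} :=
  [ffun g => #|[pred i | c i == g]|].

Lemma k0p_act_count (I : finType) (c : I -> gT) v :
  k0p_act (degree_count c) v = \big[@k0p_add gT F A/0k]_(i : I) k0p_shift (c i) v.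
Proof.
rewrite [RHS](partition_big c xpredT) //=; apply: eq_bigr => g _.
rewrite ffunE (eq_bigr (fun=> k0p_shift g v)) => [|i /eqP -> //].
by rewrite big_const.
Qed.

Lemma degree_count_surj z : exists (I : finType) (c : I -> gT), degree_count c = z.
Proof.
exists {g : gT & 'I_(z g)}, (fun p => tag p); apply/ffunP => g; rewrite ffunE.
rewrite -[RHS]card_ord -(card_imset _ (f := fun i : 'I_(z g) => Tagged (fun h => 'I_(z h)) i)).
  apply: eq_card => -[h i]; rewrite inE /=; apply/eqP/imsetP => [E|[j _ /(congr1 tag)/= ->] //].
  by simpl in E; subst h; exists i.
by move=> i j /eqP; rewrite eq_Tagged /= => /eqP.
Qed.

Lemma conv_count (I J : finType) (c : I -> gT) (e : J -> gT) :
  conv (degree_count c) (degree_count e) = degree_count (fun p : I * J => e p.2 * c p.1)%g.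
Proof.
apply/ffunP => k; rewrite !ffunE -sum1_card (partition_big (fun p => c p.1) xpredT) //=.
apply: eq_bigr => g _; rewrite !ffunE -!sum1_card big_distrlr /= pair_big.
apply: eq_big => // p; rewrite !inE andbC; case: (c p.1 =P g) => //= [->|].
  rewrite !andbT; apply/eqP/eqP => [->|<-]; first by rewrite mulgKV.
  by rewrite mulgK.
by rewrite !andbF.
Qed.

End PositiveCone.
(** * Corner modules and frames *)

Section CornerModule.
Variables (gT : finGroupType) (F : fieldType) (A : gralg gT F) (e : A).
Hypotheses (e1 : acomp 1%g e) (ee : e * e = e).

Definition corner_pred : {pred A^o} := [pred x : A^o | (x : A) * e == x].

Lemma corner_submod : GRing.submod_closed corner_pred.
Proof.
split=> [|a x y]; rewrite !inE ?mul0r // => /eqP xe /eqP ye.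
by rewrite mulrDl -mulrA xe ye.
Qed.

HB.instance Definition _ := GRing.isSubmodClosed.Build A A^o corner_pred corner_submod.

Record corner := Corner { corner_val :> A^o; corner_valP : corner_val \in corner_pred }.
HB.instance Definition _ := [isSub for corner_val].
HB.instance Definition _ := [Choice of corner by <:].
HB.instance Definition _ := [SubChoice_isSubLmodule of corner by <:].

Lemma corner_valE (x : corner) : (val x : A) * e = val x.
Proof. by have := corner_valP x; rewrite inE => /eqP. Qed.

Lemma corner_in_proof (a : A) : (a * e : A^o) \in corner_pred.
Proof. by rewrite inE -mulrA ee. Qed.

Definition corner_in (a : A) : corner := Corner (corner_in_proof a).

Definition corner_comp (g : gT) (x : corner) : Prop := acomp g (val x : A).

Lemma corner_comp0 g : corner_comp g 0. Proof. exact: acomp0. Qed.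

Lemma corner_compZD g (k : F) x y :
  corner_comp g x -> corner_comp g y -> corner_comp g (k%:A *: x + y).
Proof.
move=> gx gy; rewrite /corner_comp /= -[X in acomp g X]/(k%:A * (val x : A) + val y).
by rewrite mulr_algl; apply: gcompZD.
Qed.

Lemma corner_comp_decomp : direct_decomposition corner_comp.
Proof.
apply: direct_decompositionP; first exact: corner_comp0.
  move=> x; exists [ffun g => corner_in (hproj g (val x : A))].
    move=> g; rewrite ffunE /corner_comp /= -{1}[g]mulg1; apply: acompM => //.
    exact: hprojP.
  apply: val_inj; rewrite raddf_sum (eq_bigr (fun g => hproj g (val x : A) * e)).
    by rewrite -mulr_suml -hproj_sum corner_valE.
  by move=> g _; rewrite ffunE.
have key g (f : {ffun gT -> corner}) : (forall h, corner_comp h (f h)) ->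
    (val (f g) : A) = hproj g (val (\sum_h f h) : A).
  move=> Cf; rewrite raddf_sum linear_sum (bigD1 g) //= big1 ?addr0.
    by rewrite (hproj_id _ (Cf g)) eqxx.
  by move=> h nh; rewrite (hproj_id _ (Cf h)) eq_sym (negPf nh).
by move=> g f f' Cf Cf' E; apply: val_inj; rewrite [LHS]key // E -key.
Qed.

Lemma corner_compA g h a x :
  acomp g a -> corner_comp h x -> corner_comp (g * h)%g (a *: x).
Proof. exact: acompM. Qed.

Definition corner_gr : grmod A :=
  @GrMod gT F A corner corner_comp corner_comp0 corner_compZD corner_comp_decomp corner_compA.

Lemma corner_expand (x : corner) : x = (val x : A) *: corner_in 1.
Proof. by apply: val_inj; rewrite /= mul1r -[RHS]/((val x : A) * e) corner_valE. Qed.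

Lemma corner_fg : finitely_generated corner_gr.
Proof.
exists 1%N, (fun=> corner_in 1) => x; exists (fun=> val x : A).
by rewrite big_ord1; apply: corner_expand.
Qed.

Lemma corner_proj : projective corner_gr.
Proof.
move=> N N' p f ps; have [y yE] := ps (f (corner_in 1)).
have hl : linear (fun x : corner => (val x : A) *: y).
  move=> a u v; rewrite -[LHS]/((a * (val u : A) + (val v : A)) *: y).
  by rewrite scalerDl scalerA.
pose h : {linear corner_gr -> N} := HB.pack (fun x : corner => (val x : A) *: y)
  (GRing.isLinear.Build A corner N *:%R _ hl).
exists h => x; rewrite /= linearZ /= yE -linearZ /=; congr (f _).
by rewrite [RHS]corner_expand.
Qed.

Definition corner_fgp : fgpmod A := FgpMod corner_fg corner_proj.

Lemma acomp_corner_in1 : mcomp 1%g (corner_in 1 : corner_gr).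
Proof. by rewrite /= /corner_comp /= mul1r. Qed.

End CornerModule.
Section ModuleComponents.
Variables (gT : finGroupType) (F : fieldType) (A : gralg gT F).
Implicit Types M N : grmod A.

Definition mproj M (g : gT) (x : M) : M := projT1 (cid (mcomp_decomp x)) g.

Lemma mprojP M g (x : M) : mcomp g (mproj g x).
Proof. by rewrite /mproj; case: cid => f [] /= []. Qed.

Lemma mproj_sum M (x : M) : x = \sum_g mproj g x.
Proof. by rewrite /mproj; case: cid => f [] /= []. Qed.

Lemma mproj_uniq M (x : M) (f : gT -> M) :
  (forall g, mcomp g (f g)) -> x = \sum_g f g -> forall g, mproj g x = f g.
Proof.
rewrite /mproj; case: cid => f' [] /= _ uq Cf xE g.
rewrite (uq (finfun f)) ?ffunE //; split=> [h|]; first by rewrite ffunE.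
by rewrite xE; apply: eq_bigr => h _; rewrite ffunE.
Qed.

Lemma mproj_id M g h (x : M) : mcomp h x -> mproj g x = if g == h then x else 0.
Proof.
move=> hx; rewrite (@mproj_uniq _ _ (fun k => if k == h then x else 0)) // => [k|].
  by case: eqP => [->|_] //; apply: mcomp0.
by rewrite (bigD1 h) //= eqxx big1 ?addr0 // => k /negPf ->.
Qed.

Lemma mcompD M g (x y : M) : mcomp g x -> mcomp g y -> mcomp g (x + y).
Proof. by move=> gx gy; rewrite -[x]scale1r -[1]scale1r; apply: mcompZD. Qed.

Lemma mcomp_sum M (I : Type) (r : seq I) (P : pred I) g (u : I -> M) :
  (forall i, P i -> mcomp g (u i)) -> mcomp g (\sum_(i <- r | P i) u i).
Proof. by move=> uP; elim/big_ind: _ => //; [apply: mcomp0|apply: mcompD]. Qed.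

Lemma mcomp_mproj M g (x : M) : mproj g x = x -> mcomp g x.
Proof. by move=> <-; apply: mprojP. Qed.

Lemma mprojD M g (x y : M) : mproj g (x + y) = mproj g x + mproj g y.
Proof.
apply: (@mproj_uniq _ _ (fun g => mproj g x + mproj g y)) => [h|].
  by apply: mcompD; apply: mprojP.
by rewrite big_split -!mproj_sum.
Qed.

Lemma mproj_sumr M (I : Type) (r : seq I) (P : pred I) g (u : I -> M) :
  mproj g (\sum_(i <- r | P i) u i) = \sum_(i <- r | P i) mproj g (u i).
Proof.
apply: (big_morph (mproj g)) => [x y|]; first exact: mprojD.
by rewrite (mproj_id _ (mcomp0 M g)) eqxx.
Qed.

Lemma mproj_act M g h (a : A) (x : M) :
  acomp h a -> mproj (h * g)%g (a *: x) = a *: mproj g x.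
Proof.
move=> ha; rewrite (@mproj_uniq _ _ (fun k => a *: mproj (h^-1 * k)%g x)) ?mulKg // => [k|].
  by rewrite -{1}[k](mulKVg h); apply: mcompA => //; apply: mprojP.
rewrite {1}(mproj_sum x) scaler_sumr (reindex_inj (mulgI h^-1%g)).
by [].
Qed.

Lemma mproj_hom M N (f : {linear M -> N}) :
  (forall g x, mcomp g x -> mcomp g (f x)) -> forall g x, mproj g (f x) = f (mproj g x).
Proof.
move=> hf; move=> g x.
apply: (@mproj_uniq _ _ (fun g => f (mproj g x))) => [h|]; first by apply/hf/mprojP.
by rewrite {1}(mproj_sum x) linear_sum.
Qed.

Lemma grmod_iso_inverse M N : grmod_iso M N ->
  exists (f : {linear M -> N}) (g : {linear N -> M}),
    [/\ cancel f g, cancel g f, forall h x, mcomp h x -> mcomp h (f x) &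
        forall h x, mcomp h x -> mcomp h (g x)].
Proof.
move=> [f [[g fK gK] hf]].
have gl : linear g by apply: can2_linear fK gK.
pose g' : {linear N -> M} := HB.pack g (GRing.isLinear.Build A N M *:%R g gl).
exists f, g'; split=> // h x hx; apply: mcomp_mproj; apply: (can_inj fK).
by rewrite -(mproj_hom hf) /= gK (mproj_id _ hx) eqxx.
Qed.

End ModuleComponents.

Section Biproducts.
Variables (gT : finGroupType) (F : fieldType) (A : gralg gT F).
Implicit Types Q M N : grmod A.

(** A direct sum of shifts of [Q] by the degrees [c i]. All summands have the
  same underlying module, a shift changing the grading only, so that the family
  of injections and projections need not be dependent. *)
Definition biprod (I : eqType) (r : seq I) (c : I -> gT) Q M : Prop :=
  exists (inj : I -> {linear Q -> M}) (prj : I -> {linear M -> Q}),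
  [/\ forall i g x, i \in r -> mcomp g x -> mcomp (g * c i)%g (inj i x),
      forall i g x, i \in r -> mcomp (g * c i)%g x -> mcomp g (prj i x),
      forall i j x, i \in r -> j \in r -> prj i (inj j x) = if i == j then x else 0 &
      forall x, x = \sum_(i <- r) inj i (prj i x)].

Lemma biprod_iso (I : eqType) (r : seq I) c Q M N :
  grmod_iso M N -> biprod r c Q M -> biprod r c Q N.
Proof.
move=> /grmod_iso_inverse[f [g [fK gK hf hg]]] [inj [prj [hi hp ip pi]]].
exists (fun i => f \o inj i), (fun i => prj i \o g); split=> /=.
- by move=> i h x ir hx; apply/hf/hi.
- by move=> i h x ir hx; apply/hp/hg.
- by move=> i j x ir jr; rewrite fK ip.
by move=> x; rewrite -{1}(gK x) {1}(pi (g x)) linear_sum.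
Qed.

Lemma biprod_exists (I : eqType) (r : seq I) c (Q : fgpmod A) : uniq r ->
  exists2 M : fgpmod A, k0p_class M =
    \big[@k0p_add gT F A/k0p_zero A]_(i <- r) k0p_shift (c i) (k0p_class Q)
  & biprod r c Q M.
Proof.
elim: r => [_|i r IH /= /andP[ir /IH [M ME [inj [prj [hi hp ip pi]]]]]].
  exists (zero_fgp A); first by rewrite big_nil.
  exists (fun=> \0), (fun=> \0); split=> // x; exact: zero_all.
pose S := dsum (shift Q (c i)) M; exists S.
  by rewrite big_cons -ME k0p_shiftE k0p_addE.
have l1 : linear (fun x : Q => (x, 0) : S).
  by move=> a x y; apply/eqP; rewrite -pair_eqE /= scaler0 addr0 !eqxx.
pose i1 : {linear Q -> S} := HB.pack (fun x : Q => (x, 0) : S)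
  (GRing.isLinear.Build A Q S *:%R _ l1).
have l2 k : linear (fun x : Q => (0, inj k x) : S).
  by move=> a x y; apply/eqP; rewrite -pair_eqE /= scaler0 addr0 linearP !eqxx.
pose i2 k : {linear Q -> S} := HB.pack (fun x : Q => (0, inj k x) : S)
  (GRing.isLinear.Build A Q S *:%R _ (l2 k)).
have l3 : linear (fun z : S => z.1 : Q) by [].
pose p1 : {linear S -> Q} := HB.pack (fun z : S => z.1 : Q)
  (GRing.isLinear.Build A S Q *:%R _ l3).
have l4 k : linear (fun z : S => prj k z.2 : Q) by move=> a x y; rewrite linearP.
pose p2 k : {linear S -> Q} := HB.pack (fun z : S => prj k z.2 : Q)
  (GRing.isLinear.Build A S Q *:%R _ (l4 k)).
exists (fun k => if k == i then i1 else i2 k), (fun k => if k == i then p1 else p2 k).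
split.
- move=> k g x; rewrite inE; case: eqP => [-> _ gx|_ /= kr gx]; split=> /=.
  + by rewrite /shift_comp mulgK.
  + exact: mcomp0.
  + exact: mcomp0.
  + exact: hi.
- move=> k g x; rewrite inE; case: eqP => [-> _ [/= +]|_ /= kr [_ /=]].
    by rewrite /shift_comp mulgK.
  exact: hp.
- move=> k l x; rewrite !inE.
  have [->|nk] := eqVneq k i; have [->|nl] := eqVneq l i => /= kr lr.
  + by [].
  + by [].
  + by rewrite (negPf nk) linear0.
  by apply: ip.
move=> [x y]; rewrite big_cons eqxx big_seq (eq_bigr (fun k => i2 k (prj k y))).
  rewrite -big_seq [in LHS](pi y) -[x in LHS]addr0 -[X in (_, X) = _]add0r.
  rewrite -[LHS]/((x, 0) + (0, \sum_(k <- r) inj k (prj k y))); congr (_ + _).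
  elim: (r) => [|k s IHs]; first by rewrite !big_nil.
  by rewrite !big_cons -IHs; apply/eqP; rewrite -pair_eqE /= addr0 !eqxx.
move=> k kr; case: eqP => // ki; by rewrite -ki kr in ir.
Qed.

End Biproducts.
Section Frames.
Variables (gT : finGroupType) (F : fieldType) (A : gralg gT F).
Variables (e : A) (e1 : acomp 1%g e) (ee : e * e = e).
Implicit Types M N : grmod A.

(** Coordinates exhibiting [M] as a sum of shifts of the corner module [A e]:
  [p i] is the image of [e] in the [i]-th summand, [q i] the [i]-th projection. *)
Definition is_frame (I : finType) (c : I -> gT) M (p : I -> M)
    (q : I -> {linear M -> A^o}) : Prop :=
  [/\ forall i, mcomp (c i) (p i),
      forall i g x, mcomp (g * c i)%g x -> acomp g (q i x : A),
      forall i j, q i (p j) = (if i == j then e else 0 : A) &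
      forall x, x = \sum_i (q i x : A) *: p i].

Lemma frame_fixl (I : finType) (c : I -> gT) M p q (i : I) :
  @is_frame I c M p q -> e *: p i = p i.
Proof.
move=> [_ _ qp pq]; rewrite [RHS]pq (bigD1 i) //= qp eqxx big1 ?addr0 // => j ji.
by rewrite qp (negPf ji) scale0r.
Qed.

Lemma frame_fixr (I : finType) (c : I -> gT) M p q (i : I) x :
  @is_frame I c M p q -> (q i x : A) * e = q i x.
Proof.
move=> [_ _ qp pq]; rewrite [in RHS](pq x) linear_sum (bigD1 i) //= big1 ?addr0.
  by rewrite linearZ /= qp eqxx.
by move=> j ji; rewrite linearZ /= qp eq_sym (negPf ji) scaler0.
Qed.

Lemma frame_iso (I : finType) (c : I -> gT) M N p q p' q' :
  @is_frame I c M p q -> @is_frame I c N p' q' -> grmod_iso M N.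
Proof.
move=> fM fN; case: (fM) => [hp hq qp pq]; case: (fN) => [hp' hq' qp' pq'].
have lin (M1 N1 : grmod A) (r : I -> N1) (s : I -> {linear M1 -> A^o}) :
    linear (fun x : M1 => \sum_i (s i x : A) *: r i).
  move=> a x y; rewrite scaler_sumr -big_split; apply: eq_bigr => i _ /=.
  by rewrite linearP scalerDl scalerA.
pose f : {linear M -> N} := HB.pack (fun x : M => \sum_i (q i x : A) *: p' i)
  (GRing.isLinear.Build A M N *:%R _ (lin _ _ _ _)).
exists f; split; last first.
  move=> g x gx; apply: mcomp_sum => i _; rewrite -[g](mulgKV (c i)).
  by apply: mcompA => //; apply: hq; rewrite mulgKV.
exists (fun y => \sum_i (q' i y : A) *: p i) => x.
  rewrite [RHS](pq x); apply: eq_bigr => i _; rewrite /= linear_sum (bigD1 i) //= big1.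
    by rewrite addr0 linearZ /= qp' eqxx -{2}(frame_fixl i fM) scalerA.
  by move=> j ji; rewrite linearZ /= qp' eq_sym (negPf ji) scaler0.
rewrite [RHS](pq' x); apply: eq_bigr => i _; rewrite /= linear_sum (bigD1 i) //= big1.
  by rewrite addr0 linearZ /= qp eqxx -{2}(frame_fixl i fN) scalerA.
by move=> j ji; rewrite linearZ /= qp eq_sym (negPf ji) scaler0.
Qed.

Definition corner_class : K0plus A := k0p_class (corner_fgp e1 ee).

Lemma biprod_frame (I : finType) (c : I -> gT) M :
  biprod (index_enum I) c (corner_gr e1 ee) M -> exists p q, @is_frame I c M p q.
Proof.
move=> [inj [prj [hi hp ip pi]]]; have enum_in (i : I) := mem_index_enum i.
have l i : linear (fun x : M => val (prj i x) : A^o).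
  by move=> a x y; rewrite !linearP.
pose q i : {linear M -> A^o} := HB.pack (fun x : M => val (prj i x) : A^o)
  (GRing.isLinear.Build A M A^o *:%R _ (l i)).
exists (fun i => inj i (corner_in ee 1)), q; split=> /=.
- by move=> i; rewrite -(mul1g (c i)); apply: hi => //; apply: (acomp_corner_in1 e1 ee).
- by move=> i g x gx; apply: (hp i g x).
- by move=> i j; rewrite ip //; case: eqP => _; rewrite /= ?mul1r.
move=> x; rewrite {1}(pi x); apply: eq_bigr => i _.
by rewrite {1}(corner_expand ee (prj i x)) linearZ.
Qed.

Lemma frame_of_class (I : finType) (c : I -> gT) (M : fgpmod A) :
  k0p_class M = k0p_act (degree_count c) corner_class ->
  exists p q, @is_frame I c M p q.
Proof.
rewrite k0p_act_count => ME.
have [N NE bN] := biprod_exists c (corner_fgp e1 ee) (index_enum_uniq I).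
apply: biprod_frame; apply: biprod_iso bN; apply/k0p_classP.
by rewrite NE ME.
Qed.

Lemma class_of_frame (I : finType) (c : I -> gT) (M : fgpmod A) p q :
  @is_frame I c M p q -> k0p_class M = k0p_act (degree_count c) corner_class.
Proof.
move=> fM; rewrite k0p_act_count.
have [N NE bN] := biprod_exists c (corner_fgp e1 ee) (index_enum_uniq I).
have [p' [q' fN]] := biprod_frame bN.
by rewrite -NE; apply/k0p_classP; apply: frame_iso fM fN.
Qed.

End Frames.

Section DualBasis.
Variables (gT : finGroupType) (F : fieldType) (A : gralg gT F).

(** A graded surjection from a free module splits, and the neutral component
  of a splitting is a graded splitting. *)
Lemma graded_dual_basis (P : fgpmod A) :
  exists (I : finType) (c : I -> gT) (p : I -> P) (q : I -> {linear P -> A^o}),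
  [/\ forall i, mcomp (c i) (p i),
      forall i g x, mcomp (g * c i)%g x -> acomp g (q i x : A) &
      forall x, x = \sum_i (q i x : A) *: p i].
Proof.
have [n [v vP]] := fgp_fg P.
pose I : finType := ('I_n * gT)%type; pose c (i : I) := i.2.
pose p (i : I) : P := mproj i.2 (v i.1).
pose N : lmodType A := {ffun I -> A^o}.
have pl : linear (fun x : N => \sum_i (x i : A) *: p i).
  move=> a x y; rewrite scaler_sumr -big_split; apply: eq_bigr => i _ /=.
  by rewrite !ffunE scalerDl scalerA.
pose pr : {linear N -> P} := HB.pack (fun x : N => \sum_i (x i : A) *: p i)
  (GRing.isLinear.Build A N P *:%R _ pl).
have ps y : exists x, pr x = y.
  have [a ->] := vP y; exists [ffun i => a i.1 : A^o] => /=.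
  rewrite (eq_bigr (fun i : I => a i.1 *: mproj i.2 (v i.1))) => [|i _]; last first.
    by rewrite ffunE.
  rewrite -(pair_bigA _ (fun i g => a i *: mproj g (v i))) /=.
  by apply: eq_bigr => i _; rewrite [in RHS](mproj_sum (v i)) scaler_sumr.
have [s sP] := fgp_proj (idfun : {linear P -> P}) ps.
pose q0 (i : I) (x : P) : A^o :=
  \sum_g hproj (g * (c i)^-1)%g (s (mproj g x) i : A).
have sD x y i : (s (x + y) i : A) = s x i + s y i by rewrite linearD ffunE.
have sZ (a : A) x i : (s (a *: x) i : A) = a * s x i by rewrite linearZ /= ffunE.
have q0D i x y : q0 i (x + y) = q0 i x + q0 i y.
  by rewrite /q0 -big_split; apply: eq_bigr => g _; rewrite mprojD sD linearD.
have q0Z i a x : q0 i (a *: x) = a *: q0 i x.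
  have hom h (b : A) y : acomp h b -> q0 i (b *: y) = b *: q0 i y.
    move=> hb; rewrite /q0 scaler_sumr (reindex_inj (mulgI h)); apply: eq_bigr => g _.
    by rewrite mproj_act // sZ -mulgA hprojM.
  rewrite {1}(hproj_sum a) [in RHS](hproj_sum a) !scaler_suml.
  have q00 : q0 i 0 = 0 by have := hom 1%g 0 0 (acomp0 A 1%g); rewrite !scale0r.
  rewrite (big_morph (q0 i) (q0D i) q00).
  by apply: eq_bigr => h _; apply: hom; apply: hprojP.
have ql i : linear (q0 i) by move=> a x y; rewrite q0D q0Z.
pose q i : {linear P -> A^o} := HB.pack (q0 i) (GRing.isLinear.Build A P A^o *:%R _ (ql i)).
exists I, c, p, q; split=> [i|i g x gx|x].
- exact: mprojP.
- rewrite /= /q0 (bigD1 (g * c i)%g) //= big1 => [|h nh].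
    by rewrite addr0 mulgK; apply: hprojP.
  by rewrite (mproj_id _ gx) (negPf nh) linear0 ffunE linear0.
rewrite {1}(mproj_sum x) /= /q0.
under [RHS]eq_bigr => i _ do rewrite scaler_suml.
rewrite exchange_big; apply: eq_bigr => g _ /=.
have {1}<- : mproj g (pr (s (mproj g x))) = mproj g x.
  by rewrite sP /= (mproj_id _ (mprojP g x)) eqxx.
rewrite /= mproj_sumr; apply: eq_bigr => i _.
rewrite {1}(hproj_sum (s (mproj g x) i : A)) scaler_suml mproj_sumr.
rewrite (bigD1 (g * (c i)^-1)%g) //= big1 ?addr0 => [|h nh].
  by rewrite -{1}[g](mulgKV (c i)) mproj_act ?(mproj_id _ (mprojP _ _)) ?eqxx //; apply: hprojP.
rewrite -{1}[g](mulKVg h) mproj_act; last exact: hprojP.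
rewrite (mproj_id _ (mprojP _ _)); case: eqP => [E|]; last by rewrite scaler0.
by case/eqP: nh; rewrite /c -E invMg invgK mulKVg.
Qed.

End DualBasis.
(** * Splitting homogeneous idempotent matrices *)

(** Peel off rank-one pieces: a nonzero entry [C x y] of an idempotent makes
  [col y * row x / C x y] a homogeneous idempotent below [C]. *)
Lemma split_homogeneous_idempotent (F : fieldType) (S : eqType) (N : nat)
    (C : 'M[F]_N) (delta : 'I_N -> S) :
  C *m C = C -> (forall x y, C x y != 0 -> delta x = delta y) ->
  exists (r : nat) (L : 'M[F]_(r, N)) (R : 'M[F]_(N, r)) (s : 'I_r -> S),
  [/\ L *m R = 1%:M, R *m L = C, forall w y, L w y != 0 -> s w = delta y &
      forall x w, R x w != 0 -> delta x = s w].
Proof.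
have [k] := ubnP (\rank C); elim: k C => // k IH C rk CC hC.
have [C0|/matrix0Pn[x [y nz]]] := eqVneq C 0.
  exists 0%N, 0, 0, (fun i : 'I_0 => False_rect S (notF (ltn_ord i))).
  by split; rewrite ?C0 ?mul0mx; [apply/matrixP => -[]| |case|move=> ? []].
pose l := row x C; pose r := (C x y)^-1 *: col y C.
have Cr : C *m r = r by rewrite /r colE -scalemxAr mulmxA CC.
have lC : l *m C = l by rewrite /l rowE -mulmxA CC.
have lr : l *m r = 1%:M.
  rewrite /l /r rowE colE -scalemxAr mulmxA -(mulmxA _ C C) CC -rowE -colE; apply/matrixP => i j.
  by rewrite !ord1 !mxE eqxx mulVf.
(* Now [r *m l] is an idempotent below [C], and [C'] has smaller rank. *)
pose C' := C - r *m l.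
have C'r : C' *m r = 0 by rewrite mulmxBl Cr -mulmxA lr mulmx1 subrr.
have lC' : l *m C' = 0 by rewrite mulmxBr lC mulmxA lr mul1mx subrr.
have C'C' : C' *m C' = C'.
  by rewrite {2}/C' mulmxBr mulmxA C'r mul0mx subr0 mulmxBl CC -mulmxA lC.
have hC' i j : C' i j != 0 -> delta i = delta j.
  rewrite !mxE big_ord1 !mxE => nz'.
  have [/hC //|Cij] := boolP (C i j != 0).
  move: nz'; rewrite negbK in Cij; rewrite (eqP Cij) sub0r oppr_eq0 !mulf_eq0 !negb_or.
  by move=> /andP[/andP[_ /hC ->] /hC <-]; rewrite (hC _ _ nz).
have rC' : (\rank C' < \rank C)%N.
  apply: rank_ltmx; rewrite ltmxE; apply/andP; split.
    by rewrite /C' /l -[C in C - _]mul1mx rowE mulmxA -mulmxBl submxMl.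
  apply/negP => /submxP[E CE]; have := oner_neq0 F; rewrite -(mulVf nz).
  have -> : (C x y)^-1 * C x y = (l *m r) ord0 ord0 by rewrite lr mxE mulVf ?eqxx.
  by rewrite -lC -mulmxA -Cr CE -!mulmxA (mulmxA C') C'r ?mulmx0 mxE eqxx.
have [|m [L [R [s [LR RL hL hR]]]]] := IH C' _ C'C' hC'; first exact: leq_trans rC' _.
have C'R : C' *m R = R by rewrite -RL -mulmxA LR mulmx1.
have LC' : L *m C' = L by rewrite -RL mulmxA LR mul1mx.
exists (1 + m)%N, (col_mx l L), (row_mx r R),
  (fun i => match split i with inl _ => delta x | inr j => s j end).
split.
- rewrite mul_col_row lr LR -C'R mulmxA lC' mul0mx -LC' -mulmxA C'r mulmx0.
  by rewrite -scalar_mx_block.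
- by rewrite mul_row_col RL /C' addrC subrK.
- move=> w z; rewrite mxE; case: (split w) => j; last exact: hL.
  by rewrite mxE => /hC.
move=> z w; rewrite mxE; case: (split w) => j; last exact: hR.
by rewrite !mxE mulf_eq0 negb_or => /andP[_ /hC ->]; rewrite (hC _ _ nz).
Qed.

Section LevelSplitting.
Variables (gT : finGroupType) (F : fieldType) (A : gralg gT F).
Variables (n : nat -> nat) (d : forall i : nat, {ffun 'I_(n i).+1 -> gT}).
Variable psi : forall i, {lrmorphism elementary F (d i) -> A}.
Hypothesis psiP : exhausts psi.
Local Notation eps := (corner_idem psi).
Local Notation E := (unit_mx psi).

Definition splits (k : nat) (I : finType) (c : I -> gT) (C : I -> I -> A)
    (J : finType) (u : J -> gT) (L : J -> I -> A) (R : I -> J -> A) : Prop :=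
  [/\ forall w a, level psi k (L w a) /\ acomp (u w * (c a)^-1)%g (L w a),
      forall a w, level psi k (R a w) /\ acomp (c a * (u w)^-1)%g (R a w),
      forall w v, \sum_a L w a * R a v = if w == v then eps k else 0 &
      forall a b, \sum_w R a w * L w b = C a b].

(** Entries in level [k] are themselves matrices over the field, so the matrix
  over [A] unfolds into a scalar idempotent whose rows and columns carry
  degrees; a rank-one piece of it is a product through the corner [eps k]. *)
Lemma split_level k (I : finType) (c : I -> gT) (C : I -> I -> A) :
  (forall a b, level psi k (C a b)) ->
  (forall a b, acomp (c a * (c b)^-1)%g (C a b)) ->
  (forall a b, \sum_e C a e * C e b = C a b) ->
  exists (J : finType) (u : J -> gT) L R, @splits k I c C J u L R.
Proof.
move=> lC hC CC; pose K : finType := (I * 'I_(n k).+1)%type.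
have /choice[Ch1 Ch1P] : forall p : I * I, exists M, psi k M = C p.1 p.2 by move=> p; apply: lC.
pose Ch a b : 'M[F]_((n k).+1) := Ch1 (a, b).
have ChP a b : psi k (Ch a b) = C a b by apply: (Ch1P (a, b)).
pose M : 'M[F]_#|K| := \matrix_(x, y)
  Ch (enum_val x).1 (enum_val y).1 (enum_val x).2 (enum_val y).2.
pose delta (x : 'I_#|K|) := ((d k (enum_val x).2)^-1 * c (enum_val x).1)%g.
have sumK (V : nmodType) (f : K -> V) : \sum_(x < #|K|) f (enum_val x) = \sum_a \sum_i f (a, i).
  rewrite pair_bigA /= (reindex_onto (@enum_rank K) enum_val) /=; last first.
    by move=> x _; rewrite enum_valK.
  by apply: eq_big => [x|x _]; rewrite enum_rankK ?eqxx //; case: x.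
have MM : M *m M = M.
  apply/matrixP => x y; rewrite [in RHS]mxE mxE.
  set a := enum_val x; set b := enum_val y.
  pose f (z : K) := Ch a.1 z.1 a.2 z.2 * Ch z.1 b.1 z.2 b.2.
  transitivity (\sum_(z < #|K|) f (enum_val z)).
    by apply: eq_bigr => z _; rewrite !mxE.
  transitivity ((\sum_e Ch a.1 e *m Ch e b.1) a.2 b.2).
    by rewrite sumK summxE; apply: eq_bigr => e _; rewrite mxE.
  congr (fun_of_matrix _ _ _); apply: (@psi_inj _ _ _ _ _ psi k).
  rewrite raddf_sum ChP -CC; apply: eq_bigr => e _.
  by rewrite -!ChP -rmorphM.
have hM x y : M x y != 0 -> delta x = delta y.
  rewrite mxE /delta; set a := enum_val x; set b := enum_val y => nz.
  have := psi_reflect psiP (M := Ch a.1 b.1) (g := (c a.1 * (c b.1)^-1)%g).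
  rewrite ChP => /(_ (hC _ _)) /(_ _ _ nz) E'.
  by apply: (mulgI (d k a.2)); rewrite mulKVg mulgA E' mulgKV.
have [r [Lh [Rh [s [LR RL hL hR]]]]] := split_homogeneous_idempotent MM hM.
pose rk (a : I) (i : 'I_(n k).+1) : 'I_#|K| := enum_rank ((a, i) : K).
have deltaE a i : delta (rk a i) = ((d k i)^-1 * c a)%g by rewrite /delta enum_rankK.
exists 'I_r, (fun w => d k ord0 * s w)%g,
  (fun w a => \sum_j Lh w (rk a j) *: E ord0 j),
  (fun a w => \sum_i Rh (rk a i) w *: E i ord0).
have lev_sum (J : finType) (x : J -> F) (y : J -> A) :
    (forall j, level psi k (y j)) -> level psi k (\sum_j x j *: y j).
  move=> ly; elim/big_rec: _ => [|j z _ lz]; first by exists 0; rewrite linear0.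
  exact: levelZD.
have lE (i j : 'I_(n k).+1) : level psi k (E i j) by exists (delta_mx i j).
have mul_rc (x y : 'I_(n k).+1 -> F) :
    (\sum_j x j *: E ord0 j) * (\sum_i y i *: E i ord0) = (\sum_j x j * y j) *: eps k.
  rewrite mulr_suml scaler_suml; apply: eq_bigr => j _.
  rewrite mulr_sumr (bigD1 j) //= big1 => [|i /negPf ij].
    by rewrite addr0 -scalerAl -scalerAr scalerA unit_mxM eqxx.
  by rewrite -scalerAl -scalerAr unit_mxM eq_sym ij !scaler0.
have mul_cr (x y : 'I_(n k).+1 -> F) :
    (\sum_i y i *: E i ord0) * (\sum_j x j *: E ord0 j) =
    \sum_i \sum_j (y i * x j) *: E i j.
  rewrite mulr_suml; apply: eq_bigr => i _; rewrite mulr_sumr; apply: eq_bigr => j _.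
  by rewrite -scalerAl -scalerAr scalerA unit_mxM eqxx.
split.
- move=> w a; split; first exact: lev_sum.
  apply: acomp_sum => j _; have [->|nz] := eqVneq (Lh w (rk a j)) 0.
    by rewrite scale0r; apply: acomp0.
  rewrite (hL _ _ nz) deltaE !mulgA mulgK; apply: acompZ; exact: acomp_unit_mx.
- move=> a w; split; first exact: lev_sum.
  apply: acomp_sum => i _; have [->|nz] := eqVneq (Rh (rk a i) w) 0.
    by rewrite scale0r; apply: acomp0.
  rewrite -(hR _ _ nz) deltaE !invMg invgK !mulgA mulgV mul1g.
  by apply: acompZ; exact: acomp_unit_mx.
- move=> w v; transitivity ((Lh *m Rh) w v *: eps k); last first.
    by rewrite LR mxE; case: eqP; rewrite ?scale1r ?scale0r.
  rewrite mxE scaler_suml.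
  pose f (p : K) := (Lh w (enum_rank p) * Rh (enum_rank p) v) *: eps k.
  rewrite (eq_bigr (fun z => f (enum_val z))) => [|z _]; last by rewrite /f enum_valK.
  by rewrite sumK; apply: eq_bigr => a _; rewrite mul_rc scaler_suml.
move=> a b; rewrite -ChP psi_unit_mx; under eq_bigr => w _ do rewrite mul_cr.
rewrite exchange_big; apply: eq_bigr => i _; rewrite exchange_big; apply: eq_bigr => j _ /=.
rewrite -scaler_suml; congr (_ *: _).
have /matrixP/(_ (rk a i) (rk b j)) := RL; rewrite !mxE !enum_rankK.
by move=> ->.
Qed.

End LevelSplitting.
(** * The positive cone of a limit of matrix algebras *)

Section LimitCone.
Variables (gT : finGroupType) (F : fieldType) (A : gralg gT F).
Variables (n : nat -> nat) (d : forall i : nat, {ffun 'I_(n i).+1 -> gT}).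
Variable psi : forall i, {lrmorphism elementary F (d i) -> A}.
Hypothesis psiP : exhausts psi.
Local Notation eps := (corner_idem psi).
Local Notation "x +k y" := (k0p_add x y) (at level 50, left associativity).

Definition cone_gen (k : nat) : K0plus A :=
  corner_class (acomp_corner_idem psiP k) (corner_idemM psi k).

(** A graded dual basis [p], [q] of [M] presents [M] by the idempotent matrix
  of the [q b (p a)]; splitting the matrix over [eps k] splits the module. *)
Lemma split_frame k (M : grmod A) (I : finType) (c : I -> gT) (p : I -> M)
    (q : I -> {linear M -> A^o}) (J : finType) (u : J -> gT) L R :
  (forall i, mcomp (c i) (p i)) ->
  (forall i g x, mcomp (g * c i)%g x -> acomp g (q i x : A)) ->
  (forall x, x = \sum_i (q i x : A) *: p i) ->
  splits psi k c (fun a b => q b (p a) : A) u L R ->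
  exists p' q', is_frame (eps k) u (M := M) p' q'.
Proof.
move=> hp hq pq [hL hR LR RL].
have RL' a b : \sum_w R a w * L w b = q b (p a) := RL a b.
have ql w : linear (fun x : M => \sum_a (q a x : A) * R a w : A^o).
  move=> a x y; rewrite scaler_sumr -big_split; apply: eq_bigr => b _ /=.
  by rewrite linearP mulrDl -[a * _ * _]mulrA.
pose q' w : {linear M -> A^o} := HB.pack (fun x : M => \sum_a (q a x : A) * R a w : A^o)
  (GRing.isLinear.Build A M A^o *:%R _ (ql w)).
exists (fun w => \sum_a L w a *: p a), q'; split=> /=.
- move=> w; apply: mcomp_sum => a _; rewrite -[u w](mulgKV (c a)).
  by apply: mcompA => //; case: (hL w a).
- move=> w g x gx; apply: acomp_sum => a _.
  rewrite -[g](mulgK (u w)) -[(g * u w)%g](mulgKV (c a)) -[(_ * c a * _)%g]mulgA.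
  apply: acompM; last by case: (hR a w).
  by apply: hq; rewrite mulgKV.
- move=> w v.
  transitivity (\sum_a \sum_b \sum_z (L v b * R b z) * (L z a * R a w)).
    apply: eq_bigr => a _; rewrite linear_sum mulr_suml; apply: eq_bigr => b _.
    rewrite linearZ /= -[_ *: _]/(L v b * (q a (p b) : A)) -(RL' b a).
    rewrite mulr_sumr mulr_suml; apply: eq_bigr => z _; rewrite !mulrA //.
  rewrite exchange_big /=; under eq_bigr => b _ do rewrite exchange_big /=.
  rewrite exchange_big /=.
  transitivity (\sum_z (\sum_b L v b * R b z) * (\sum_a L z a * R a w)).
    apply: eq_bigr => z _; rewrite mulr_suml; apply: eq_bigr => b _.
    by rewrite mulr_sumr.
  under eq_bigr => z _ do rewrite !LR.
  rewrite (bigD1 w) //= big1 => [|z /negPf zw]; last by rewrite zw mulr0.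
  rewrite addr0 eqxx eq_sym; case: eqP => _; rewrite ?mul0r //.
  exact: corner_idemM.
move=> x; rewrite [LHS]pq.
transitivity (\sum_a (q a x : A) *: \sum_w R a w *: \sum_b L w b *: p b).
  apply: eq_bigr => a _; congr (_ *: _); rewrite [LHS]pq.
  under [RHS]eq_bigr => w _ do rewrite scaler_sumr.
  rewrite exchange_big; apply: eq_bigr => b _ /=; rewrite -(RL' a b) scaler_suml.
  by apply: eq_bigr => w _; rewrite scalerA.
under [LHS]eq_bigr => a _ do rewrite scaler_sumr.
rewrite [LHS]exchange_big; apply: eq_bigr => w _ /=; rewrite scaler_suml.
by apply: eq_bigr => a _; rewrite scalerA.
Qed.

(** Finitely many coordinates already live at a finite level. *)
Lemma cone_generated (y : K0plus A) :
  exists k0, forall k, (k0 <= k)%N -> exists z, y = k0p_act z (cone_gen k).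
Proof.
elim/k0p_ind: y => P; have [I [c [p [q [hp hq pq]]]]] := graded_dual_basis P.
have [k0 [_ k0P]] := level_family psiP (fun ab : I * I => q ab.2 (p ab.1) : A) 0.
exists k0 => k k0k.
have [| | |J [u [L [R sp]]]] := @split_level _ _ _ _ _ _ psiP k I c (fun a b => q b (p a) : A).
- by move=> a b; apply: level_le (k0P (a, b)).
- by move=> a b; apply: hq; rewrite mulgKV.
- move=> a b; rewrite [in RHS](pq (p a)) linear_sum; apply: eq_bigr => e _.
  by rewrite linearZ.
have [p' [q' fP]] := split_frame hp hq pq sp.
exists (degree_count u); exact: class_of_frame fP.
Qed.

(** Two frames at the same level differ by an invertible homogeneous matrix of
  scalars, so they have as many vectors in each degree. *)
Lemma frames_degree_count k (M : grmod A) (I J : finType) (c : I -> gT) (e : J -> gT) p q p' q' :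
  is_frame (eps k) c (M := M) p q -> is_frame (eps k) e (M := M) p' q' ->
  (forall a b, level psi k (q' b (p a) : A)) ->
  (forall a b, level psi k (q a (p' b) : A)) ->
  degree_count c = degree_count e.
Proof.
(* Restricted to the vectors of degree [g], the two transition matrices still
  compose to the identity, because their entries are homogeneous. *)
have half (I1 J1 : finType) (c1 : I1 -> gT) (e1 : J1 -> gT) r s r' s' g :
    is_frame (eps k) c1 (M := M) r s -> is_frame (eps k) e1 (M := M) r' s' ->
    (forall a b, level psi k (s' b (r a) : A)) ->
    (forall a b, level psi k (s a (r' b) : A)) ->
    (degree_count c1 g <= degree_count e1 g)%N.
  move=> f1 f2 lf lg; case: (f1) => hr hs sr rs; case: (f2) => hr' hs' sr' rs'.
  have /choice[f fP] : forall ab, exists x : F, (s' ab.2 (r ab.1) : A) = x *: eps k.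
    move=> [a b] /=; apply: (corner_scalar (lf a b)); last exact: frame_fixr f2.
    by rewrite -{2}(frame_fixl a f1) linearZ.
  have /choice[h hP] : forall ba, exists x : F, (s ba.2 (r' ba.1) : A) = x *: eps k.
    move=> [b a] /=; apply: (corner_scalar (lg a b)); last exact: frame_fixr f1.
    by rewrite -{2}(frame_fixl b f2) linearZ.
  have fh a a' : \sum_b f (a, b) * h (b, a') = (a' == a)%:R.
    apply/eqP; rewrite -subr_eq0 -[_ == 0]orbF -[false](negPf (corner_idem_neq0 psi k)).
    rewrite -scaler_eq0 scalerBl subr_eq0 scaler_suml; apply/eqP.
    transitivity (s a' (r a) : A); last by rewrite sr; case: eqP; rewrite ?scale1r ?scale0r.
    rewrite {1}(rs' (r a)) linear_sum; apply: eq_bigr => b _.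
    rewrite linearZ /= (fP (a, b)) (hP (b, a')) -[RHS]/((_ *: _) * (_ *: _)).
    by rewrite -scalerAl -scalerAr corner_idemM scalerA.
  have f0 a b : f (a, b) != 0 -> c1 a = e1 b.
    move=> nz; have : acomp (c1 a * (e1 b)^-1)%g (s' b (r a) : A).
      by apply: hs'; rewrite mulgKV.
    rewrite (fP (a, b)) => /acomp_neq0_inj /(_ (acompZ _ (acomp_corner_idem psiP k))).
    rewrite scaler_eq0 (negPf nz) (negPf (corner_idem_neq0 psi k)) => /(_ isT)/eqP.
    by rewrite -eq_mulgV1 => /eqP.
  pose P1 := [pred a | c1 a == g]; pose P2 := [pred b | e1 b == g].
  rewrite !ffunE -/P1 -/P2.
  pose X := \matrix_(x < #|P1|, y < #|P2|) f (enum_val x, enum_val y).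
  pose Y := \matrix_(y < #|P2|, x < #|P1|) h (enum_val y, enum_val x).
  apply: (@mulmx1_min _ _ _ X Y); apply/matrixP => x z; rewrite !mxE.
  transitivity (\sum_b f (enum_val x, b) * h (b, enum_val z)); last first.
    by rewrite fh (inj_eq enum_val_inj) eq_sym.
  have gx : c1 (enum_val x) = g by apply/eqP; have := enum_valP x.
  rewrite (bigID P2) /= [X in _ + X]big1 ?addr0 => [|b nb]; last first.
    suff -> : f (enum_val x, b) = 0 by rewrite mul0r.
    by apply: contraNeq nb => /f0 <-; rewrite gx.
  transitivity (\sum_(b in P2) f (enum_val x, b) * h (b, enum_val z)) => //.
  by rewrite [RHS]big_enum_val; apply: eq_bigr => b _; rewrite !mxE.
move=> f1 f2 l1 l2; apply/ffunP => g; apply/eqP; rewrite eqn_leq.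
apply/andP; split; first exact: half f1 f2 l1 l2.
by apply: half f2 f1 _ _.
Qed.

Definition corner_splits (i k : nat) (J : finType) (u : J -> gT) (L : J -> A) (R : J -> A) :=
  splits psi k (fun _ : unit => 1%g) (fun _ _ => eps i) u (fun w _ => L w) (fun _ w => R w).

Lemma corner_split_exists i k : (i <= k)%N ->
  exists (J : finType) (u : J -> gT) L R, @corner_splits i k J u L R.
Proof.
move=> ik.
have [| | |J [u [L [R sp]]]] :=
  @split_level _ _ _ _ _ _ psiP k unit (fun=> 1%g) (fun _ _ => eps i).
- by move=> _ _; apply: (level_le psiP ik); exists (delta_mx ord0 ord0).
- by move=> _ _; rewrite mulgV; apply: acomp_corner_idem.
- by move=> _ _; rewrite (bigD1 tt) //= big1 ?addr0 ?corner_idemM // => -[].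
exists J, u, (fun w => L w tt), (fun w => R tt w).
case: sp => hL hR LR RL; split.
- by move=> w []; apply: hL.
- by move=> [] w; apply: hR.
- by move=> w v; rewrite -LR; apply: eq_bigr => -[].
by move=> [] []; apply: RL.
Qed.

Lemma corner_split_class i k (J : finType) (u : J -> gT) L R :
  corner_splits i k u L R -> cone_gen i = k0p_act (degree_count u) (cone_gen k).
Proof.
set e1 := acomp_corner_idem psiP i; set ee := corner_idemM psi i => sp.
pose M := corner_fgp e1 ee.
have vl : linear (fun x : M => val x : A^o) by move=> a x y; apply: linearP.
pose q : {linear M -> A^o} := HB.pack (fun x : M => val x : A^o)
  (GRing.isLinear.Build A M A^o *:%R _ vl).
pose p : M := corner_in ee 1.
have qp : (q p : A) = eps i by rewrite /= mul1r.
have [| | | |p' [q' fM]] := @split_frame k M unit (fun=> 1%g) (fun=> p) (fun=> q) J u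
    (fun w _ => L w) (fun _ w => R w).
- by move=> _; apply: (acomp_corner_in1 e1 ee).
- by move=> _ g x; rewrite mulg1.
- by move=> x; rewrite (bigD1 tt) //= big1 ?addr0 => [|[] //]; apply: corner_expand.
- by case: sp => hL hR LR RL; split=> // a b; rewrite [RHS]qp; apply: RL.
exact: class_of_frame fM.
Qed.

Lemma refine_frame i k (M : grmod A) (I J : finType) (c : I -> gT) (u : J -> gT) p q L R :
  is_frame (eps i) c (M := M) p q -> corner_splits i k u L R ->
  exists (p' : I * J -> M) (q' : I * J -> {linear M -> A^o}),
  [/\ is_frame (eps k) (fun ax => u ax.2 * c ax.1)%g p' q',
      forall ax, p' ax = L ax.2 *: p ax.1 &
      forall ax x, q' ax x = (q ax.1 x : A) * R ax.2].
Proof.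
move=> fM [hL hR LR RL]; case: (fM) => hp hq qp pq.
have ql ax : linear (fun x : M => (q ax.1 x : A) * R ax.2 : A^o).
  by move=> a x y; rewrite linearP mulrDl -[a * _ * _]mulrA.
pose q' (ax : I * J) : {linear M -> A^o} := HB.pack (fun x : M => (q ax.1 x : A) * R ax.2 : A^o)
  (GRing.isLinear.Build A M A^o *:%R _ (ql ax)).
have LR' w v : L w * R v = if w == v then eps k else 0.
  by rewrite -LR (bigD1 tt) //= big1 ?addr0 // => -[].
have RL' : \sum_w R w * L w = eps i := RL tt tt.
exists (fun ax => L ax.2 *: p ax.1), q'; split=> //; split.
- move=> [a x] /=; apply: mcompA => //.
  by case: (hL x tt) => _; rewrite invg1 mulg1.
- move=> [a x] g y gy /=; rewrite -[g](mulgK (u x)); apply: acompM.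
    by apply: hq; rewrite -mulgA.
  by case: (hR tt x) => _; rewrite mul1g.
- move=> [b y] [a x]; rewrite /= linearZ /= qp -[X in X * _]/(L x * _).
  rewrite xpair_eqE; case: eqP => [_|_] /=; last by rewrite mulr0 mul0r.
  rewrite -RL' mulr_sumr mulr_suml.
  under eq_bigr => w _ do rewrite mulrA LR' -mulrA LR'.
  rewrite (bigD1 x) //= eqxx big1 => [|w /negPf wx]; last by rewrite eq_sym wx mul0r.
  by rewrite addr0 eq_sym; case: eqP; rewrite ?mulr0 ?corner_idemM.
move=> x; rewrite [LHS]pq -(pair_bigA _ (fun a w => ((q a x : A) * R w) *: (L w *: p a))) /=.
apply: eq_bigr => a _; rewrite -{1}(frame_fixl a fM) -RL' scaler_suml scaler_sumr.
by apply: eq_bigr => w _; rewrite !scalerA mulrA.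
Qed.

(** An isomorphism between sums of shifted generators involves finitely many
  elements of [A], so it already holds at a finite level, where sums of
  shifts are determined by their degrees. *)
Lemma cone_relation i (z1 z2 : {ffun gT -> nat}) :
  k0p_act z1 (cone_gen i) = k0p_act z2 (cone_gen i) ->
  exists k u, cone_gen i = k0p_act u (cone_gen k) /\ conv z1 u = conv z2 u.
Proof.
have [I1 [c1 <-]] := degree_count_surj z1; have [I2 [c2 <-]] := degree_count_surj z2.
have [M ME] : exists M, k0p_class M = k0p_act (degree_count c1) (cone_gen i).
  by elim/k0p_ind: (k0p_act _ _) => M; exists M.
move=> E12; have [p1 [q1 f1]] := frame_of_class ME.
have [p2 [q2 f2]] := frame_of_class (etrans ME E12).
have [k1 [ik1 k1P]] := level_family psiP (fun ab : I1 * I2 => q2 ab.2 (p1 ab.1) : A) i.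
have [k [k1k kP]] := level_family psiP (fun ab : I1 * I2 => q1 ab.1 (p2 ab.2) : A) k1.
have [J [u [L [R sp]]]] := corner_split_exists (leq_trans ik1 k1k).
exists k, (degree_count u); split; first exact: corner_split_class sp.
have [p1' [q1' [f1' p1E q1E]]] := refine_frame f1 sp.
have [p2' [q2' [f2' p2E q2E]]] := refine_frame f2 sp.
have [lL lR] : (forall x, level psi k (L x)) /\ (forall y, level psi k (R y)).
  by case: sp => hL hR _ _; split=> x; [case: (hL x tt)|case: (hR tt x)].
rewrite !conv_count; apply: (frames_degree_count f1' f2') => -[a x] [b y].
  rewrite q2E p1E /= linearZ /= -[_ *: _]/(L x * _); apply: levelM => //.
  by apply: levelM => //; apply: (level_le psiP k1k); apply: (k1P (a, b)).
rewrite q1E p2E /= linearZ /= -[_ *: _]/(L y * _); apply: levelM => //.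
by apply: levelM => //; apply: (kP (a, b)).
Qed.

(** The positive cone is a limit of free commutative monoids, hence
  cancellative and torsion-free. *)
Lemma cone_cancel m (a b c : K0plus A) : (0 < m)%N ->
  k0p_muln m a +k c = k0p_muln m b +k c -> a = b.
Proof.
have [ka kaP] := cone_generated a; have [kb kbP] := cone_generated b.
have [kc kcP] := cone_generated c; pose i := (ka + kb + kc)%N.
have [za aE] : exists z, a = k0p_act z (cone_gen i) by apply: kaP; rewrite /i -addnA leq_addr.
have [zb bE] : exists z, b = k0p_act z (cone_gen i).
  by apply: kbP; rewrite /i addnAC leq_addl.
have [zc cE] : exists z, c = k0p_act z (cone_gen i) by apply: kcP; rewrite leq_addl.
move=> m0; rewrite {1}aE {1}bE {1 2}cE -!k0p_act_muln -!k0p_act_add => /cone_relation[k [u [vE E]]].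
rewrite aE bE vE !k0p_act_conv; congr (k0p_act _ _); apply/ffunP => g.
move/ffunP/(_ g): E; rewrite !ffunE => E; apply/eqP; rewrite -(eqn_pmul2l m0).
move: E; under eq_bigr => h _ do rewrite !ffunE mulnDl -mulnA.
under [in RHS]eq_bigr => h _ do rewrite !ffunE mulnDl -mulnA.
by rewrite !big_split -!big_distrr /= => /addIn ->.
Qed.

End LimitCone.
(** ** Classes invariant under a subgroup *)

Section InvariantCone.
Variables (gT : finGroupType) (abG : abelian [set: gT]).

Lemma convC (z z' : {ffun gT -> nat}) : conv z z' = conv z' z.
Proof.
apply/ffunP => k; rewrite !ffunE (reindex_inj invg_inj) (reindex_inj (mulgI k^-1%g)) /=.
apply: eq_bigr => g _; rewrite invgK mulKVg invMg invgK.
by rewrite (centsP abG k _ g^-1%g) ?inE // mulnC.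
Qed.

Variable T : {group gT}.

Lemma conv_subset_sum (z : {ffun gT -> nat}) g :
  conv (subset_sum nat T) z g = (\sum_(t in T) z (g * t^-1)%g)%N.
Proof.
rewrite ffunE [RHS]big_mkcond; apply: eq_bigr => t _ /=; rewrite ffunE.
by case: ifP => _; rewrite /= ?mul1n ?mul0n.
Qed.

(** Functions constant on cosets are multiples of the sum over the subgroup:
  keep the values at coset representatives. *)
Lemma invariant_conv (z : {ffun gT -> nat}) :
  (forall g t, t \in T -> z (t * g)%g = z g) ->
  exists z', conv (subset_sum nat T) z' = z.
Proof.
move=> zT; pose rep g := repr (T :* g)%g.
exists [ffun g => if g == rep g then z g else 0]%N; apply/ffunP => g.
have rg : rep g \in (T :* g)%g by apply: (mem_repr g); apply: rcoset_refl.
have [t0 t0T rE] := rcosetP rg.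
rewrite conv_subset_sum (bigD1 t0^-1%g) ?groupV //= big1 ?addn0 => [|t /andP[tT nt]].
  rewrite invgK ffunE (centsP abG g _ t0) ?inE // -rE.
  have -> : rep (rep g) = rep g.
    by rewrite -[rep (rep g)]/(repr (T :* rep g)%g) rE rcosetM rcoset_id.
  by rewrite eqxx rE zT.
rewrite ffunE (centsP abG g _ t^-1%g) ?inE //.
have -> : rep (t^-1 * g)%g = rep g.
  by rewrite /rep rcosetM rcoset_id // groupV.
rewrite rE (inj_eq (mulIg g)); case: eqP => // E.
by case/eqP: nt; rewrite -E invgK.
Qed.

Variables (F : fieldType) (A : gralg gT F).
Variables (n : nat -> nat) (d : forall i : nat, {ffun 'I_(n i).+1 -> gT}).
Variable psi : forall i, {lrmorphism elementary F (d i) -> A}.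
Hypothesis psiP : exhausts psi.

(** Invariance of the generator reads [x_T v = |T| v]; at a deeper level this
  becomes an equality of combinations, which makes the coefficients of the
  generator constant on cosets. *)
Lemma invariant_cone_divisible :
  (forall i t, t \in T -> k0p_shift t (cone_gen psiP i) = cone_gen psiP i) ->
  forall y : K0plus A, exists x, k0p_act (subset_sum nat T) x = y.
Proof.
move=> inv y; have [i /(_ i (leqnn i)) [z ->]] := cone_generated psiP y.
have : k0p_act (subset_sum nat T) (cone_gen psiP i) =
       k0p_act (gdelta gT #|T|) (cone_gen psiP i).
  rewrite k0p_act_delta k0p_mulnE big_const_ord /k0p_act -big_const.
  rewrite [RHS]big_mkcond /=; apply: eq_bigr => t _; rewrite ffunE.
  case: ifP => tT; last by [].
  by rewrite -[LHS]/(k0p_muln 1 (k0p_shift t (cone_gen psiP i))) k0p_muln1 inv.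
move=> /cone_relation[k [u [vE E]]].
have [w wE] : exists w, conv (subset_sum nat T) w = u.
  apply: invariant_conv => g t tT; apply/eqP.
  have T0 : (0 < #|T|)%N by apply: cardG_gt0.
  have uE h : (#|T| * u h = \sum_(s in T) u (h * s^-1)%g)%N.
    rewrite -conv_subset_sum E ffunE (bigD1 1%g) //= big1 ?addn0 => [|s /negPf ns].
      by rewrite ffunE eqxx muln1 invg1 mulg1.
    by rewrite ffunE ns muln0.
  rewrite -(eqn_pmul2l T0) !uE (reindex_inj (mulgI t)) /=; apply/eqP.
  apply: eq_big => [s|s _]; first by rewrite groupMl.
  rewrite invMg mulgA [(t * g)%g](centsP abG t _ g) ?inE //.
  by rewrite -!mulgA [(t * _)%g](centsP abG t _ (s^-1 * t^-1)%g) ?inE // mulgKV.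
exists (k0p_act z (k0p_act w (cone_gen psiP k))).
by rewrite vE -wE -[in RHS]k0p_act_conv !(k0p_act_conv _ z) (k0p_act_conv z) convC.
Qed.

End InvariantCone.
(** * Homogeneous units in the commutant of a level *)

Section UnitsShift.
Variables (gT : finGroupType) (F : fieldType) (A : gralg gT F).
Variables (n : nat -> nat) (d : forall i : nat, {ffun 'I_(n i).+1 -> gT}).
Variable psi : forall i, {lrmorphism elementary F (d i) -> A}.
Hypothesis psiP : exhausts psi.

Definition commuting_unit (i : nat) (t : gT) : Prop :=
  exists y y' : A, [/\ acomp t y, y * y' = 1, y' * y = 1 &
                       forall a, level psi i a -> a * y = y * a].

(** Right multiplication by the unit shifts the corner module. *)
Lemma commuting_unit_shift i t : commuting_unit i t ->
  k0p_shift t (cone_gen psiP i) = cone_gen psiP i.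
Proof.
move=> [y [y' [ty yy' y'y yC]]]; rewrite k0p_shiftE; apply/k0p_classP.
apply: grmod_iso_sym; set e1 := acomp_corner_idem psiP i; set ee := corner_idemM psi i.
have ty' : acomp t^-1%g y' by apply: acomp_inverse yy' y'y.
have Ce : corner_idem psi i * y = y * corner_idem psi i.
  by apply: yC; exists (delta_mx ord0 ord0).
have Ce' : corner_idem psi i * y' = y' * corner_idem psi i.
  by rewrite -[LHS]mul1r -y'y -!mulrA (mulrA y) -Ce -mulrA yy' mulr1.
have in_f (z : A) (x : corner (corner_idem psi i)) :
    corner_idem psi i * z = z * corner_idem psi i ->
    ((val x : A) * z : A^o) \in corner_pred (corner_idem psi i).
  by move=> Cz; rewrite inE -mulrA -Cz mulrA corner_valE.
pose f x := Corner (in_f y' x Ce').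
pose g x := Corner (in_f y x Ce).
have fl : linear f.
  move=> a u v; apply: val_inj; rewrite /= -[X in _ = X]/(a * ((val u : A) * y') + (val v : A) * y').
  by rewrite mulrDl mulrA.
pose h : {linear corner_gr e1 ee -> shift_gr t (corner_gr e1 ee)} := HB.pack f
  (GRing.isLinear.Build A (corner_gr e1 ee) (shift_gr t (corner_gr e1 ee)) *:%R f fl).
exists h; split; last by move=> k x kx; apply: acompM.
by exists g => x; apply: val_inj; rewrite /= -mulrA ?yy' ?y'y mulr1.
Qed.

End UnitsShift.

Section LimitUnits.
Variables (gT : finGroupType) (abG : abelian [set: gT]) (F : closedFieldType).
Variables (D : falgType F) (gD : grading gT D).
Hypotheses (hDdiv : graded_division gD) (hDcs : central_simple D).
Local Notation DG := (GrAlg gD).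
Local Notation T := (graded_support gD).
Local Notation X := (hbasis gD).
Variables (A : gralg gT F) (n : nat -> nat).
Variables (d : forall i : nat, {ffun 'I_(n i).+1 -> gT}).
Variable psi : forall i, {lrmorphism elementary F (d i) -> A}.
Hypothesis psiP : exhausts psi.
Local Notation AD := (gtensor abG A gD).

(** The centralizer of [D] in [A (x) D] is [A]: averaging over conjugation by
  the [X_t] fixes the centralizer and keeps only the [X_1]-coordinate. *)
Lemma centralizer_inl (x : AD) :
  (forall t, t \in T -> tens_inr abG A gD (X t) * x = x * tens_inr abG A gD (X t)) ->
  exists a, x = tens_inl abG A gD a.
Proof.
move=> xC; have [a aE] := tens_expand hDdiv x; exists (a 1%g).
have nzT : #|T|%:R != 0 :> F by apply: card_support_neq0.
set r := tens_inr abG A gD; set l := tens_inl abG A gD.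
apply: (scalerI nzT).
transitivity (\sum_(s in T) r (X s) * x * r (X s)^-1).
  rewrite (eq_bigr (fun=> x)) => [|s sT]; first by rewrite sumr_const scaler_nat.
  by rewrite xC // -mulrA -rmorphM divrr ?hbasis_unit // rmorph1 mulr1.
transitivity (\sum_(t in T) l (a t) * r (avg gD (X t))).
  rewrite {1}aE; under eq_bigr => s sT do rewrite mulr_sumr mulr_suml.
  rewrite exchange_big; apply: eq_bigr => t tT.
  rewrite /avg linear_sum mulr_sumr; apply: eq_bigr => s sT.
  by rewrite pure_inlr mulrA -tens_inlrC -!mulrA -!rmorphM !mulrA.
rewrite (bigD1 1%g) ?support1 //= big1 => [|t /andP[tT nt]].
  by rewrite addr0 avgE // hcoef_delta ?support1 // mulr1 linearZ rmorph1 -scalerAr mulr1.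
by rewrite avgE // hcoef_hbasis ?support1 // eq_sym (negPf nt) mulr0 scale0r linear0 mulr0.
Qed.

Lemma commutation_shift s t u c b : s \in T -> t \in T -> u \in T ->
  X s * X t = c *: (X t * X s) -> X u * X t = b *: (X t * X u) ->
  X (u * s)%g * X t = (b * c) *: (X t * X (u * s)%g).
Proof.
move=> sT tT uT cE bE.
have [k kE] := gcomp_hbasis hDdiv (gcompM (hbasisP gD u) (hbasisP gD s)).
have nzk : k != 0.
  apply: contraTneq (hbasis_unit hDdiv sT) => k0.
  have : X u * X s == 0 by rewrite kE k0 scale0r.
  rewrite mulrI_eq0; last exact/mulrI/hbasis_unit.
  by move=> /eqP ->; rewrite unitr0.
have -> : X (u * s)%g = k^-1 *: (X u * X s) by rewrite kE scalerA mulVf ?scale1r.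
rewrite -scalerAl -scalerAr scalerA mulrC -scalerA; congr (_ *: _).
by rewrite -mulrA cE -scalerAr mulrA bE -scalerAl scalerA mulrC mulrA.
Qed.

Lemma commutation_character t : t \in T -> exists beta : gT -> F,
  [/\ forall s, s \in T -> beta s != 0,
      forall s, s \in T -> X s * X t = beta s *: (X t * X s) &
      forall u s, u \in T -> s \in T -> beta (u * s)%g = beta u * beta s].
Proof.
move=> tT.
have /choice[beta betaP] : forall s, exists c, s \in T ->
    c != 0 /\ X s * X t = c *: (X t * X s).
  move=> s; have [sT|] := boolP (s \in T); last by exists 0.
  by have [c nzc E] := commutation_scalar abG hDdiv sT tT; exists c.
have bE s : s \in T -> X s * X t = beta s *: (X t * X s) by move=> /betaP[].
exists beta; split=> [s /betaP[]//|//|u s uT sT].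
have usT := supportM hDdiv uT sT.
have := bE _ usT; rewrite (commutation_shift sT tT uT (bE _ sT) (bE _ uT)) => /eqP.
rewrite eq_sym -subr_eq0 -scalerBl scaler_eq0 orbC.
have : X t * X (u * s)%g != 0.
  by rewrite mulrI_eq0 ?hbasis_neq0 //; apply/mulrI/hbasis_unit.
by move=> /negPf -> /=; rewrite subr_eq0 => /eqP.
Qed.

(** Dividing each element by the representative of its coset. *)
Lemma support_equivariant : exists sigma : gT -> gT,
  (forall g, sigma g \in T) /\
  (forall u g, u \in T -> sigma (u * g)%g = (u * sigma g)%g).
Proof.
pose H := group (support_group hDdiv).
exists (fun g => g * (repr (H :* g))^-1)%g; split=> [g|u g uT].
  rewrite -[T]/(gval H); have /rcosetP[h hH ->] : repr (H :* g)%g \in (H :* g)%g.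
    by apply: (mem_repr g); apply: rcoset_refl.
  by rewrite invMg mulKVg groupV.
by rewrite -mulgA rcosetM rcoset_id.
Qed.

(** Once [A_i] and [D] sit in a matrix algebra [M_N], twisting [X_t] by the
  diagonal matrix of the values of the commutation character (made to commute
  with [A_i]) gives a unit of degree [t] centralizing both: this is right
  multiplication by [X_t] on the free [D]-module [F^N]. *)
Lemma limit_commuting_unit i t :
  elementary_limit AD -> t \in T -> commuting_unit psi i t.
Proof.
move=> /elementary_limit_exhausted[m [b [chi chiP]]] tT.
set r := tens_inr abG A gD; set l := tens_inl abG A gD.
have [k1 [_ k1P]] := level_family chiP
  (fun p : 'I_(n i).+1 * 'I_(n i).+1 => l (unit_mx psi p.1 p.2)) 0.
have [k [k1k kP]] := level_family chiP (fun s : gT => r (X s)) k1.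
have /choice[e1 e1P] : forall p : 'I_(n i).+1 * 'I_(n i).+1,
    exists M, chi k M = l (unit_mx psi p.1 p.2).
  by move=> p; apply: (level_le chiP k1k); apply: k1P.
pose e x y := e1 (x, y).
have eP x y : chi k (e x y) = l (unit_mx psi x y) by apply: (e1P (x, y)).
have /choice[Y YP] : forall s, exists M, chi k M = r (X s) by move=> s; apply: kP.
have cI := @psi_inj _ _ _ _ _ chi k.
have ut := hbasis_unit hDdiv tT.
have [Y' Y'P] : exists M, chi k M = r (X t)^-1.
  have [c ->] : exists c : F, (X t)^-1 = c *: X t^-1%g.
    by apply: gcomp_hbasis => //; apply: gcompV; rewrite ?hbasis_neq0 //; apply: hbasisP.
  by exists (c *: Y t^-1%g); rewrite linearZ /= YP [RHS]linearZ.
have eM x y z w : e x y * e z w = if y == z then e x w else 0.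
  apply: cI; rewrite rmorphM /= !eP -rmorphM unit_mxM.
  by case: eqP => _; rewrite ?eP ?rmorph0.
have eS : \sum_x e x x = 1.
  apply: cI; rewrite raddf_sum rmorph1 -(rmorph1 l) -(unit_mx_sum psi i) raddf_sum.
  by apply: eq_bigr => x _; apply: eP.
have eY s x y : Y s * e x y = e x y * Y s.
  by apply: cI; rewrite !rmorphM /= !eP !YP tens_inlrC.
have YY' : Y t * Y' = 1.
  by apply: cI; rewrite rmorphM /= YP Y'P -rmorphM divrr // !rmorph1.
have Y'Y : Y' * Y t = 1.
  by apply: cI; rewrite rmorphM /= YP Y'P -rmorphM mulVr // !rmorph1.
have hY s : @acomp _ _ (elementary F (b k)) s (Y s).
  apply: (psi_reflect chiP); rewrite YP; apply: (@tens_inr_graded _ abG _ A _ gD).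
  exact: hbasisP.
have he x y : @acomp _ _ (elementary F (b k)) (d i x * (d i y)^-1)%g (e x y).
  apply: (psi_reflect chiP); rewrite eP; apply: tens_inl_graded.
  exact: acomp_unit_mx.
have [beta [beta0 betaE betaM]] := commutation_character tT.
have [sg [sgT sgM]] := support_equivariant.
have YYt s : s \in T -> Y s * Y t = beta s *: (Y t * Y s).
  move=> sT; apply: cI; rewrite linearZ /= !rmorphM /= !YP -!rmorphM betaE //.
  exact: (linearZ_LR r).
pose dg f : 'M[F]_((m k).+1) := diag_mx (\row_z f (beta (sg (b k z)))).
have dgM f u (M : 'M[F]_((m k).+1)) : {morph f : x y / x * y} -> u \in T ->
    @acomp _ _ (elementary F (b k)) u M -> dg f * M = f (beta u) *: (M * dg f).
  move=> fM uT hM; apply/matrixP => z w.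
  rewrite -[(dg f * M)]/(_ *m _) -[(M * dg f)]/(_ *m _) mul_diag_mx mul_mx_diag !mxE.
  have [->|nz] := eqVneq (M z w) 0; first by rewrite mul0r !mulr0.
  have <- : (u * b k w)%g = b k z by rewrite -(hM z w nz) mulgKV.
  by rewrite sgM // betaM // fM [M z w * _]mulrC mulrA.
have T1 := support1 gD.
have b1 : beta 1%g = 1.
  by apply: (mulfI (beta0 _ T1)); rewrite -betaM // mulg1 mulr1.
have hdg f : @acomp _ _ (elementary F (b k)) 1%g (dg f).
  by move=> z w; rewrite !mxE; case: (z =P w) => [->|_]; rewrite ?mulgV // mulr0n eqxx.
have idM : {morph (id : F -> F) : x y / x * y} by [].
have invM : {morph (@GRing.inv F) : x y / x * y} by move=> x y; apply: invfM.
(* Spreading the [(0, 0)] block over all blocks makes it commute with [A_i]. *)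
pose Z f := \sum_x e x ord0 * dg f * e ord0 x.
have dgV : dg id * dg (@GRing.inv F) = 1 /\ dg (@GRing.inv F) * dg id = 1.
  split; rewrite -[LHS]/(_ *m _) mul_diag_mx; apply/matrixP => z w; rewrite !mxE;
  by case: eqP; rewrite ?mulr0n ?mulr0 // mulr1n ?mulfV ?mulVf ?beta0.
have ZM f g : {morph f : x y / x * y} -> f 1 = 1 -> dg f * dg g = 1 -> Z f * Z g = 1.
  move=> fM f1 fg; rewrite /Z -[RHS]eS mulr_suml; apply: eq_bigr => x _.
  rewrite mulr_sumr (bigD1 x) //= big1 => [|y yx]; last first.
    by rewrite !mulrA -(mulrA _ (e ord0 x)) eM eq_sym (negPf yx) mulr0 !mul0r.
  rewrite addr0 !mulrA -(mulrA _ (e ord0 x)) eM eqxx -(mulrA _ (dg f)).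
  rewrite (dgM f 1%g) //; last first.
    by have := he ord0 ord0; rewrite mulgV.
  by rewrite b1 f1 scale1r !mulrA eM eqxx -(mulrA _ (dg f)) fg mulr1 eM eqxx.
have Ze f y z : e y z * Z f = Z f * e y z.
  rewrite /Z mulr_sumr mulr_suml (bigD1 z) //= [RHS](bigD1 y) //= !big1 ?addr0.
  - by rewrite !mulrA eM eqxx -[RHS]mulrA eM eqxx.
  - by move=> x /negPf xy; rewrite -mulrA eM xy mulr0.
  by move=> x /negPf xy; rewrite !mulrA eM eq_sym xy !mul0r.
have ZY f s : {morph f : x y / x * y} -> s \in T -> Z f * Y s = f (beta s) *: (Y s * Z f).
  move=> fM sT; rewrite /Z mulr_suml mulr_sumr scaler_sumr; apply: eq_bigr => x _.
  rewrite -mulrA -eY mulrA -(mulrA _ (dg f)) (dgM f s) // -scalerAr -scalerAl.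
  by rewrite !mulrA eY.
(* Passing a [Y s] across produces the scalar [beta s] twice, once from [Y t] and
  once from the diagonal matrix, on opposite sides. *)
pose W := Y t * Z id; pose W' := Z (@GRing.inv F) * Y'.
have WW' : W * W' = 1.
  by rewrite /W /W' !mulrA -(mulrA (Y t)) ZM ?mulr1 //; case: dgV.
have W'W : W' * W = 1.
  by rewrite /W /W' !mulrA -(mulrA _ Y') Y'Y mulr1 ZM ?invr1 //; case: dgV.
have We y z : e y z * W = W * e y z by rewrite /W mulrA -eY -!mulrA Ze.
have WY s : s \in T -> Y s * W = W * Y s.
  move=> sT; rewrite /W mulrA YYt // -scalerAl -[RHS]mulrA ZY // -scalerAr.
  by rewrite !mulrA.
have W'Y s : s \in T -> Y s * W' = W' * Y s.
  move=> sT; rewrite -[LHS]mul1r -W'W -[LHS]mulrA [W * (Y s * W')]mulrA -WY //.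
  by rewrite -[Y s * W * W']mulrA WW' mulr1.
have [y yE] : exists y, chi k W = l y.
  by apply: centralizer_inl => s sT; rewrite -/r -YP -!rmorphM /= WY.
have [y' y'E] : exists y, chi k W' = l y.
  by apply: centralizer_inl => s sT; rewrite -/r -YP -!rmorphM /= W'Y.
have lI : injective l by apply: tens_inl_inj.
have lM a c : l (a * c) = l a * l c by rewrite rmorphM.
have chiM M N : chi k (M * N) = chi k M * chi k N by rewrite rmorphM.
exists y, y'; split.
- apply: (graded_hom_reflect (@tens_inl_graded _ abG _ A _ gD) lI); rewrite -/l -yE.
  apply: (psi_graded chiP); rewrite -[t]mulg1; apply: acompM; first exact: hY.
  apply: acomp_sum => x _.
  have -> : 1%g = ((d i x * (d i ord0)^-1) * 1 * (d i ord0 * (d i x)^-1))%g.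
    by rewrite mulg1 mulgA mulgKV mulgV.
  by apply: acompM; [apply: acompM|].
- by apply: lI; rewrite lM -yE -y'E -chiM WW' !rmorph1.
- by apply: lI; rewrite lM -yE -y'E -chiM W'W !rmorph1.
move=> a [M <-]; rewrite psi_unit_mx mulr_suml mulr_sumr; apply: eq_bigr => x _.
rewrite mulr_suml mulr_sumr; apply: eq_bigr => z _.
rewrite -scalerAl -scalerAr; congr (_ *: _); apply: lI.
by rewrite !lM -yE -eP -!chiM We.
Qed.

End LimitUnits.
(** * Copies of the division algebra in the commutant of a level *)

Section CopiesFromDivisibility.
Variables (gT : finGroupType) (abG : abelian [set: gT]) (F : closedFieldType).
Variables (D : falgType F) (gD : grading gT D).
Hypothesis hDdiv : graded_division gD.
Local Notation DG := (GrAlg gD).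
Local Notation T := (graded_support gD).
Local Notation X := (hbasis gD).
Local Notation h := (hcoef hDdiv).

Section RightAction.
Variables (A : gralg gT F) (Q M : grmod A).
Variables (inj : gT -> {linear Q -> M}) (prj : gT -> {linear M -> Q}).
Hypotheses
  (hi : forall t g x, t \in T -> mcomp g x -> mcomp (g * t)%g (inj t x))
  (hp : forall t g x, t \in T -> mcomp (g * t)%g x -> mcomp g (prj t x))
  (ip : forall s t x, s \in T -> t \in T -> prj s (inj t x) = if s == t then x else 0)
  (pi : forall x, x = \sum_(t in T) inj t (prj t x)).

(** Identifying [M] with [Q (x) D] along the basis [X], right multiplication
  by [d]. *)
Definition ract (d : D) (m : M) : M :=
  \sum_(t in T) \sum_(s in T) (h s (X t * d))%:A *: inj s (prj t m).

Lemma ract_linear d : linear (ract d).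
Proof.
move=> a m m'; rewrite /ract scaler_sumr -big_split; apply: eq_bigr => t _ /=.
rewrite scaler_sumr -big_split; apply: eq_bigr => s _ /=.
rewrite !linearP scalerDr !scalerA; congr (_ *: _ + _).
by rewrite mulr_algl mulr_algr.
Qed.

HB.instance Definition _ d := GRing.isLinear.Build A M M *:%R (ract d) (ract_linear d).

Lemma prj_ract r d m : r \in T ->
  prj r (ract d m) = \sum_(t in T) (h r (X t * d))%:A *: prj t m.
Proof.
move=> rT; rewrite linear_sum; apply: eq_bigr => t tT; rewrite linear_sum.
rewrite (bigD1 r) //= linearZ /= ip // eqxx big1 ?addr0 // => s /andP[sT sr].
by rewrite linearZ /= ip // eq_sym (negPf sr) scaler0.
Qed.

Lemma ractM d e m : ract e (ract d m) = ract (d * e) m.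
Proof.
rewrite {1}/ract.
transitivity (\sum_(r in T) \sum_(s in T) \sum_(t in T)
    ((h r (X t * d)) * (h s (X r * e)))%:A *: inj s (prj t m)).
  apply: eq_bigr => r rT; apply: eq_bigr => s sT.
  rewrite prj_ract // linear_sum scaler_sumr; apply: eq_bigr => t tT.
  by rewrite linearZ scalerA mulr_algl scalerA mulrC.
rewrite exchange_big /=; under eq_bigr => s _ do rewrite exchange_big /=.
rewrite exchange_big; apply: eq_bigr => t tT; apply: eq_bigr => s sT /=.
rewrite -!scaler_suml; congr (_%:A *: _).
rewrite mulrA [in RHS](hbasis_expand hDdiv (X t * d)) mulr_suml.
under [in RHS]eq_bigr => r _ do rewrite -scalerAl.
by rewrite hcoef_sum.
Qed.

Lemma ract1 m : ract 1 m = m.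
Proof.
rewrite [RHS]pi /ract; apply: eq_bigr => t tT; rewrite (bigD1 t) //= big1 ?addr0.
  by rewrite mulr1 hcoef_delta // !scale1r.
by move=> s /andP[sT st]; rewrite mulr1 hcoef_hbasis // (negPf st) !scale0r.
Qed.

Lemma ractP (k : F) d e m : ract (k *: d + e) m = k%:A *: ract d m + ract e m.
Proof.
rewrite /ract scaler_sumr -big_split; apply: eq_bigr => t _ /=.
rewrite scaler_sumr -big_split; apply: eq_bigr => s sT /=.
rewrite mulrDr -scalerAr hcoef_linear // !scalerDl scalerA; congr (_ *: _ + _).
by rewrite mulr_algl scalerA.
Qed.

Lemma ract_graded d m g k : gcomp gD g d -> mcomp k m -> mcomp (k * g)%g (ract d m).
Proof.
move=> gd km; apply: mcomp_sum => t tT; apply: mcomp_sum => s sT.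
have [E|ne] := eqVneq s (t * g)%g; last first.
  rewrite (_ : h s _ = 0) ?scale0r ?scale0r; first exact: mcomp0.
  apply: hcoef_uniq => //; rewrite scale0r.
  by rewrite (gproj_id _ (gcompM (hbasisP gD t) gd)) (negPf ne).
rewrite -[_ *: _]addr0; apply: mcompZD; last exact: mcomp0.
have -> : (k * g = k * t^-1 * s)%g by rewrite E mulgA mulgKV.
by apply: hi => //; apply: hp => //; rewrite mulgKV.
Qed.

End RightAction.

Variables (A : gralg gT F) (n : nat -> nat).
Variables (d : forall i : nat, {ffun 'I_(n i).+1 -> gT}).
Variable psi : forall i, {lrmorphism elementary F (d i) -> A}.
Hypothesis psiP : exhausts psi.

(** Endomorphisms of the corner module are elements of [eps A eps], and these
  extend along the matrix units to elements commuting with the level. *)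
Lemma divisible_copies :
  (forall y : K0plus A, exists x, k0p_act (subset_sum nat T) x = y) ->
  forall i, exists lam, commuting_copy gD psi i lam.
Proof.
move=> div i; have [x xE] := div (cone_gen psiP i).
set e1 := acomp_corner_idem psiP i; set ee := corner_idemM psi i.
pose M := corner_gr e1 ee.
have [Q [inj [prj [hi hp ip pi]]]] : exists Q : grmod A, biprod (enum T) id Q M.
  elim/k0p_ind: x xE => Q QE; exists Q.
  have [N NE bN] := biprod_exists id Q (enum_uniq T).
  apply: biprod_iso bN; apply/(k0p_classP N (corner_fgp e1 ee)).
  rewrite NE -[RHS]QE big_enum /= big_mkcond; apply: eq_bigr => t _; rewrite ffunE.
  case: ifP => _; last by [].
  by rewrite -[RHS]/(k0p_muln 1 _) k0p_muln1.
have hi' t g y : t \in T -> mcomp g y -> mcomp (g * t)%g (inj t y).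
  by move=> tT; apply: hi; rewrite mem_enum.
have hp' t g y : t \in T -> mcomp (g * t)%g y -> mcomp g (prj t y).
  by move=> tT; apply: hp; rewrite mem_enum.
have ip' s t y : s \in T -> t \in T -> prj s (inj t y) = if s == t then y else 0.
  by move=> sT tT; apply: ip; rewrite mem_enum.
have pi' y : y = \sum_(t in T) inj t (prj t y) by rewrite {1}(pi y) big_enum.
pose R := ract inj prj; pose eh : M := corner_in ee 1.
pose w (f : D) : A := val (R f eh).
have eh_e : corner_idem psi i *: eh = eh.
  by apply: val_inj; rewrite /= mul1r -[LHS]/(_ * _) ee.
have we f : w f * corner_idem psi i = w f by apply: corner_valE.
have ew f : corner_idem psi i * w f = w f.
  rewrite -[LHS]/(val (corner_idem psi i *: R f eh) : A) /R.
  have := ract_linear inj prj f (corner_idem psi i) eh 0.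
  by rewrite addr0 eh_e -[X in _ + X]/(ract inj prj f 0) linear0 addr0 => <-.
have wM f g : w (f * g) = w f * w g.
  rewrite {1}/w /R -ractM // (corner_expand ee (ract inj prj f eh)) linearZ.
  by [].
have w1 : w 1 = corner_idem psi i by rewrite /w /R ract1 //= mul1r.
have wP (k : F) f g : w (k *: f + g) = k *: w f + w g.
  rewrite /w /R ractP -[LHS]/(k%:A * w f + w g) mulr_algl //.
have w_graded g f : gcomp gD g f -> acomp g (w f).
  move=> gf; rewrite -[g]mul1g; apply: (ract_graded hi' hp' gf).
  exact: (acomp_corner_in1 e1 ee).
pose E := @unit_mx _ _ _ _ _ psi i.
pose lam0 f : A := \sum_a E a ord0 * w f * E ord0 a.
have lamL : linear lam0.
  move=> k f g; rewrite /lam0 scaler_sumr -big_split; apply: eq_bigr => a _ /=.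
  by rewrite wP mulrDr mulrDl -scalerAr -scalerAl.
have lamM : monoid_morphism lam0.
  split=> [|f g].
    rewrite /lam0 -(unit_mx_sum psi i); apply: eq_bigr => a _.
    by rewrite w1 /E /corner_idem unit_mxM eqxx unit_mxM eqxx.
  rewrite /lam0 mulr_suml; apply: eq_bigr => a _.
  rewrite mulr_sumr (bigD1 a) //= big1 ?addr0 => [|b ba]; last first.
    by rewrite !mulrA -(mulrA _ (E ord0 a)) unit_mxM eq_sym (negPf ba) mulr0 !mul0r.
  rewrite !mulrA -(mulrA _ (E ord0 a)) unit_mxM eqxx -[unit_mx _ _ _]/(corner_idem psi i).
  by rewrite -(mulrA _ (w f)) we wM !mulrA.
pose lam : {lrmorphism D -> A} := HB.pack lam0
  (GRing.isLinear.Build F D A *:%R lam0 lamL) (GRing.isMonoidMorphism.Build D A lam0 lamM).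
exists lam; split=> {x xE} [g f gf|a f [N <-]].
  apply: acomp_sum => a _.
  have -> : (g = (d i a * (d i ord0)^-1) * g * (d i ord0 * (d i a)^-1))%g.
    rewrite -!mulgA (centsP abG g _ (d i ord0 * (d i a)^-1)%g) ?inE //.
    by rewrite !mulgA mulgKV mulgV mul1g.
  by apply: acompM; [apply: acompM; [exact: acomp_unit_mx|exact: w_graded]|exact: acomp_unit_mx].
rewrite psi_unit_mx mulr_suml mulr_sumr; apply: eq_bigr => x _.
rewrite mulr_suml mulr_sumr; apply: eq_bigr => y _.
rewrite -scalerAl -scalerAr; congr (_ *: _).
rewrite /= /lam0 /E mulr_sumr mulr_suml (bigD1 y) //= [RHS](bigD1 x) //= !big1 ?addr0.
- by rewrite !mulrA !unit_mxM eqxx -[RHS]mulrA unit_mxM eqxx.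
- by move=> z /negPf zx; rewrite -[LHS]mulrA unit_mxM zx mulr0.
by move=> z /negPf zy; rewrite !mulrA unit_mxM eq_sym zy !mul0r.
Qed.

End CopiesFromDivisibility.
(** * Characters, orbits and the subgroup sum *)

Section GaloisOrbits.
Variables (gT : finGroupType) (abG : abelian [set: gT]) (T : {group gT}).
Local Notation G := [set: gT]%G.
Implicit Types (i k : Iirr G) (j : {set Iirr G}).

Lemma lin_irr i : 'chi_i \is a linear_char.
Proof. exact/char_abelianP. Qed.

Lemma char_dualT : char_dual gT = setT.
Proof. by apply/setP => i; rewrite !inE lin_irr. Qed.

Lemma galois_orbitP i k :
  reflect (exists u : {rmorphism algC -> algC}, k = aut_Iirr u i) (k \in galois_orbit i).
Proof.
rewrite inE; apply: (iffP (asboolP _)) => -[u E]; exists u.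
  by apply: irr_inj; rewrite aut_IirrE.
by rewrite E aut_IirrE.
Qed.

Lemma galois_orbit_refl i : i \in galois_orbit i.
Proof.
apply/galois_orbitP; exists idfun; apply: irr_inj; rewrite aut_IirrE.
by apply/cfunP => g; rewrite cfunE.
Qed.

Lemma galois_orbit_trans i k l :
  k \in galois_orbit i -> l \in galois_orbit k -> l \in galois_orbit i.
Proof.
move=> /galois_orbitP[u ->] /galois_orbitP[v ->]; apply/galois_orbitP.
exists (v \o u); apply: irr_inj; rewrite !aut_IirrE.
by apply/cfunP => g; rewrite !cfunE.
Qed.

(** A ring endomorphism permutes the finitely many irreducible characters, so
  that some iterate inverts it on them. *)
Lemma galois_orbit_sym i k : k \in galois_orbit i -> i \in galois_orbit k.
Proof.
move=> /galois_orbitP[u ->]; pose f := aut_Iirr u : Iirr G -> Iirr G.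
have : fconnect f (f i) i.
  rewrite fconnect_sym; first exact: fconnect1.
  exact: aut_Iirr_inj.
rewrite -/(f i); move: (f i) => k' /iter_findex <-.
elim: (findex _ _ _) => [|m IH]; first exact: galois_orbit_refl.
by rewrite iterS; apply: galois_orbit_trans IH _; apply/galois_orbitP; exists u.
Qed.

Lemma galois_orbits_partition : partition (galois_orbits gT) setT.
Proof.
have -> : galois_orbits gT =
    equivalence_partition (fun i k => k \in galois_orbit i) [set: Iirr G].
  rewrite /galois_orbits /equivalence_partition char_dualT; apply: eq_imset => i.
  by apply/setP => k; rewrite [RHS]inE in_setT.
apply: equivalence_partitionP => i k l _ _ _; split; first exact: galois_orbit_refl.
move=> ik; apply/idP/idP; last exact: galois_orbit_trans.
exact/galois_orbit_trans/galois_orbit_sym.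
Qed.

Lemma e_orbit_sum g : \sum_(j in galois_orbits gT) e_orbit j g = (g == 1%g)%:R.
Proof.
transitivity (\sum_(i : Iirr G) e_chi i g).
  transitivity (\sum_(i in [set: Iirr G]) e_chi i g); last first.
    by apply: eq_bigl => i; rewrite inE.
  rewrite (set_partition_big _ galois_orbits_partition) /=.
  by apply: eq_bigr => j _; rewrite sum_ffunE.
transitivity ((#|gT|%:R)^-1 * cfReg G (g^-1)%g).
  rewrite cfReg_sum sum_cfunE mulr_sumr; apply: eq_bigr => i _.
  by rewrite ffunE cfunE lin_char1 ?lin_irr // mul1r lin_charV ?lin_irr ?inE.
rewrite cfRegE invg_eq1 cardsT; case: eqP => _; last by rewrite mulr0.
by rewrite mulVf // pnatr_eq0 -lt0n; apply/card_gt0P; exists 1%g.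
Qed.

Definition char_mass i : algC := \sum_(t in T) 'chi_i t.

Lemma char_mass_cases i : char_mass i = 0 \/ char_mass i = #|T|%:R.
Proof.
have [triv|] := boolP [forall t in T, 'chi_i t == 1].
  right; rewrite /char_mass (eq_bigr (fun=> 1)) ?sumr_const // => t tT.
  by move/forall_inP: triv => /(_ t tT)/eqP.
rewrite negb_forall_in => /exists_inP[s sT nt]; left.
have : 'chi_i s * char_mass i = char_mass i.
  rewrite /char_mass mulr_sumr [RHS](reindex_inj (mulgI s)) /=.
  apply: eq_big => [t|t tT]; first by rewrite groupMl.
  by rewrite lin_charM ?lin_irr ?inE.
move/eqP; rewrite -subr_eq0 -{2}[char_mass i]mul1r -mulrBl mulf_eq0 subr_eq0.
by rewrite (negPf nt) => /eqP.
Qed.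

(** The sum takes rational values, on which Galois conjugation is trivial. *)
Lemma char_mass_orbit i k : k \in galois_orbit i -> char_mass k = char_mass i.
Proof.
move=> /galois_orbitP[u ->].
have -> : char_mass (aut_Iirr u i) = u (char_mass i).
  by rewrite /char_mass rmorph_sum; apply: eq_bigr => t _; rewrite aut_IirrE cfunE.
by case: (char_mass_cases i) => ->; rewrite ?rmorph0 ?rmorph_nat.
Qed.

(** Each [e_chi] is an eigenvector of the multiplication by the subgroup sum. *)
Lemma e_orbit_subset_sum j g : j \in galois_orbits gT ->
  gring_mul (e_orbit j) (subset_sum algC T) g =
  if j \in gring_supp (subset_sum algC T) then #|T|%:R * e_orbit j g else 0.
Proof.
move=> jO; rewrite [X in if X then _ else _]inE jO /=.
case: eqP => [->|/eqP nz] /=; first by rewrite ffunE.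
case/imsetP: jO nz => i _ -> nz.
have key h : gring_mul (e_orbit (galois_orbit i)) (subset_sum algC T) h =
    char_mass i * e_orbit (galois_orbit i) h.
  rewrite ffunE (reindex_inj invg_inj) (reindex_inj (mulIg h^-1%g)) /=.
  rewrite (eq_bigr (fun t => \sum_(k in galois_orbit i)
     (t \in T)%:R * ((#|gT|%:R)^-1 * ('chi_k h)^-1 * 'chi_k t))) => [|t _].
    rewrite exchange_big /e_orbit sum_ffunE [RHS]big_distrr; apply: eq_bigr => k ki /=.
    rewrite ffunE -(char_mass_orbit ki) /char_mass [RHS]big_distrl [RHS]big_mkcond.
    by apply: eq_bigr => t _; case: (t \in T); rewrite /= ?mul0r // mul1r mulrC.
  rewrite /e_orbit sum_ffunE mulr_suml; apply: eq_bigr => k _; rewrite !ffunE.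
  have -> : ((t * h^-1)^-1^-1 * h)%g = t by rewrite invgK mulgKV.
  rewrite mulrC invMg invgK lin_charM ?lin_irr ?inE // lin_charV ?lin_irr ?inE //.
  by rewrite invfM invrK !mulrA.
rewrite key; case: (char_mass_cases i) => [m0|-> //].
by case/eqP: nz; apply/ffunP => h; rewrite key m0 mul0r ffunE.
Qed.

Lemma off_support_sum g :
  \sum_(j in galois_orbits gT | j \notin gring_supp (subset_sum algC T)) #|T|%:R * e_orbit j g =
  #|T|%:R * (g == 1%g)%:R - (g \in T)%:R.
Proof.
rewrite -e_orbit_sum mulr_sumr.
have -> : (g \in T)%:R =
    \sum_(j in galois_orbits gT) gring_mul (e_orbit j) (subset_sum algC T) g.
  under eq_bigr => j _ do rewrite ffunE.
  rewrite exchange_big (bigD1 1%g) //= -mulr_suml e_orbit_sum eqxx mul1r big1.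
    by rewrite addr0 ffunE invg1 mul1g.
  by move=> h /negPf nh; rewrite -mulr_suml e_orbit_sum nh mul0r.
rewrite -sumrB big_mkcondr; apply: eq_bigr => j jO /=.
by rewrite e_orbit_subset_sum //; case: (j \in _); rewrite /= ?subrr ?subr0.
Qed.

End GaloisOrbits.
(** * Divisibility of the positive cone *)

Section Divisibility.
Variables (gT : finGroupType) (abG : abelian [set: gT]) (T : {group gT}).
Variables (F : fieldType) (A : gralg gT F).
Local Notation "x +k y" := (k0p_add x y) (at level 50, left associativity).
Local Notation xT := (subset_sum nat T).

(** Splitting an integral combination into its positive and negative parts
  expresses the action on [K0] through the one on the positive cone. *)
Definition zpos (z : {ffun gT -> int}) : {ffun gT -> nat} :=
  [ffun g => if z g is Posz m then m else 0%N].
Definition zneg (z : {ffun gT -> int}) : {ffun gT -> nat} :=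
  [ffun g => if z g is Negz m then m.+1 else 0%N].

Lemma zpos_zneg (z : {ffun gT -> int}) g : z g = (zpos z g)%:Z - (zneg z g)%:Z.
Proof. by rewrite !ffunE; case: (z g) => m; rewrite ?subr0 ?sub0r ?NegzE. Qed.

Lemma k0_mulz_diff (m : int) (a b : K0plus A) :
  k0_mulz m (k0_diff a b) =
  k0_diff (k0p_muln (if m is Posz k then k else 0%N) a +k
           k0p_muln (if m is Negz k then k.+1 else 0%N) b)
          (k0p_muln (if m is Negz k then k.+1 else 0%N) a +k
           k0p_muln (if m is Posz k then k else 0%N) b).
Proof.
have it k : iter k (k0_add (k0_diff a b)) (k0_zero A) = k0_diff (k0p_muln k a) (k0p_muln k b).
  by elim: k => [|k IH] //=; rewrite IH k0_addE.
case: m => k; rewrite /k0_mulz it ?k0_oppE.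
  by rewrite (k0p_addC _ (k0p_zero A)) !k0p_add0.
by rewrite k0p_add0 (k0p_addC _ (k0p_zero A)) k0p_add0.
Qed.

Lemma k0_act_diff z (a b : K0plus A) :
  k0_act z (k0_diff a b) = k0_diff (k0p_act (zpos z) a +k k0p_act (zneg z) b)
                                   (k0p_act (zneg z) a +k k0p_act (zpos z) b).
Proof.
rewrite /k0_act /k0p_act -!big_split /=.
apply: (big_rec3 (fun x y w => w = k0_diff x y)) => // g p q w _ ->.
by rewrite k0_shiftE k0_mulz_diff k0_addE !ffunE.
Qed.

(** The sum over the subgroup squares to [|T|] times itself. *)
Lemma divisible_card :
  (forall y : K0plus A, exists x, k0p_act xT x = y) ->
  forall y : K0plus A, exists x, k0p_muln #|T| x = y.
Proof.
move=> div y; have [x <-] := div y; have [x' <-] := div x.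
exists (k0p_act xT x'); rewrite -k0p_act_muln k0p_act_conv; congr (k0p_act _ _).
apply/ffunP => g; rewrite conv_subset_sum !ffunE.
rewrite (eq_bigr (fun=> (g \in T)%:R)) => [|t tT]; last first.
  by rewrite ffunE groupMr ?groupV.
by rewrite sum_nat_const.
Qed.

Variables (n : {set Iirr [set: gT]} -> nat) (e' : {set Iirr [set: gT]} -> {ffun gT -> int}).
Hypothesis he' : forall j, j \in galois_orbits gT ->
  (0 < n j)%N /\ forall g, (e' j g)%:~R = (n j)%:R * e_orbit j g.

(** Outside the support the orbit idempotent annihilates [x_T], and with it
  all of [x_T K0 = K0]. *)
Lemma divisible_support :
  (forall y : K0plus A, exists x, k0p_act xT x = y) ->
  forall j, j \in galois_orbits gT ->
  (exists x : K0 A, k0_act (e' j) x <> k0_zero A) -> j \in gring_supp (subset_sum algC T).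
Proof.
move=> div j jO [x nz]; apply: contra_notT nz => jS.
have E : conv (zpos (e' j)) xT = conv (zneg (e' j)) xT.
  apply/ffunP => g; apply/eqP; rewrite -eqz_nat -subr_eq0; apply/eqP.
  apply: (@intr_inj algC); rewrite rmorphB /= !ffunE.
  rewrite -[RHS]/(0 : algC) -(mulr0 (n j)%:R).
  have := e_orbit_subset_sum abG T g jO; rewrite (negPf jS) => <-.
  rewrite ffunE mulr_sumr -!pmulrn !natr_sum -sumrB; apply: eq_bigr => h _.
  have [_ /(_ h)] := he' jO; rewrite zpos_zneg mulrA => <-.
  rewrite rmorphB /= mulrBl !ffunE !natrM -!pmulrn.
  have -> : (h^-1 * g)%g = (g * h^-1)%g by apply: (centsP abG); rewrite inE.
  by case: (_ \in T).
elim/k0_ind: x => a b; have [a' <-] := div a; have [b' <-] := div b.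
rewrite k0_act_diff !k0p_act_conv E; apply/k0_diffP; exists (k0p_zero A).
by rewrite [X in k0p_add X _]k0p_addC.
Qed.

Hypothesis cancel_cone : forall m (a b c : K0plus A), (0 < m)%N ->
  k0p_muln m a +k c = k0p_muln m b +k c -> a = b.

(** Off the support of [x_T] the orbit idempotents kill [K0], and the weighted
  sum of these idempotents is [|T| - x_T]; so [x_T] and [|T|] act alike. *)
Lemma support_divisible :
  (forall y : K0plus A, exists x, k0p_muln #|T| x = y) ->
  (forall j, j \in galois_orbits gT ->
    (exists x : K0 A, k0_act (e' j) x <> k0_zero A) -> j \in gring_supp (subset_sum algC T)) ->
  forall y : K0plus A, exists x, k0p_act xT x = y.
Proof.
move=> div supp y; have [a <-] := div y; exists a.
have kill j : j \in galois_orbits gT -> j \notin gring_supp (subset_sum algC T) ->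
    k0p_act (zpos (e' j)) a = k0p_act (zneg (e' j)) a.
  move=> jO jS; have [//|ne] := pselect (k0p_act (zpos (e' j)) a = k0p_act (zneg (e' j)) a).
  case/negP: jS; apply: supp => //; exists (k0_diff a (k0p_zero A)) => E; apply: ne.
  move: E; rewrite k0_act_diff => /k0_diffP[c].
  have act0 z : k0p_act z (k0p_zero A) = k0p_zero A.
    by rewrite /k0p_act big1 // => g _; rewrite k0p_shift0 k0p_muln0.
  rewrite !act0 !(k0p_addC _ (k0p_zero A)) !k0p_add0 => E.
  by apply: (@cancel_cone 1 _ _ c) => //; rewrite !k0p_muln1.
pose off j := (j \in galois_orbits gT) && (j \notin gring_supp (subset_sum algC T)).
pose N := (\prod_(j in galois_orbits gT) n j)%N.
(* The weights clear the denominators [n j]: [c j * e' j = N * |T| * e_orbit j]. *)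
pose c j := (#|T| * \prod_(k in galois_orbits gT | k != j) n k)%N.
have N0 : (0 < N)%N by apply: prodn_cond_gt0 => j /he'[].
have act_sum (z : {set Iirr [set: gT]} -> {ffun gT -> nat}) :
    k0p_act [ffun g => \sum_(j | off j) c j * z j g]%N a =
    \big[@k0p_add gT F A/k0p_zero A]_(j | off j) k0p_muln (c j) (k0p_act (z j) a).
  rewrite /k0p_act; under [RHS]eq_bigr => j _ do rewrite k0p_muln_sum.
  rewrite exchange_big; apply: eq_bigr => g _ /=.
  by rewrite ffunE k0p_sum_muln; apply: eq_bigr => j _; rewrite k0p_mulnA.
pose P := k0p_act [ffun g => \sum_(j | off j) c j * zpos (e' j) g]%N a.
have PE : P = k0p_act [ffun g => \sum_(j | off j) c j * zneg (e' j) g]%N a.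
  rewrite /P !act_sum; apply: eq_bigr => j /andP[jO jS].
  by rewrite kill.
apply: (@cancel_cone N _ _ P) => //; rewrite {2}PE.
rewrite -(k0p_act_delta #|T| a) -!k0p_act_muln -!k0p_act_add; congr (k0p_act _ _).
apply/ffunP => g; rewrite !ffunE; apply/eqP; rewrite -(eqr_nat algC).
rewrite !natrD !natr_sum !natrM -subr_eq0 opprD addrACA -mulrBr -sumrB.
rewrite (eq_bigr (fun j => N%:R * (#|T|%:R * e_orbit j g))) => [|j /andP[jO jS]].
  rewrite -mulr_sumr off_support_sum // -mulrDr natn addrA subrK subrr mulr0.
  exact: eqxx.
rewrite !natrM -mulrBr; have [_ /(_ g)] := he' jO.
rewrite zpos_zneg rmorphB /= -!pmulrn => ->.
have -> : N = (n j * \prod_(k in galois_orbits gT | k != j) n k)%N.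
  by rewrite /N (bigD1 j).
by rewrite natrM [X in X * _]mulrC mulrACA [X in X * _]mulrC.
Qed.

End Divisibility.
Theorem theorem19
    (gT : finGroupType) (abG : abelian [set: gT]) (F : closedFieldType)
    (A : gralg gT F) (hA : elementary_limit A)
    (D : falgType F) (gD : grading gT D)
    (hDdiv : graded_division gD) (hDcs : central_simple D)
    (T : {set gT}) (hT : T = graded_support gD)
    (n : {set Iirr [set: gT]} -> nat)
    (e' : {set Iirr [set: gT]} -> {ffun gT -> int})
    (he' : forall j, j \in galois_orbits gT ->
       (0 < n j)%N /\ forall g, (e' j g)%:~R = (n j)%:R * e_orbit j g) :
  let AD := gtensor abG A gD in
  let cond_i := elementary_limit AD in
  let cond_ii := forall y : K0plus A, exists x : K0plus A,
    k0p_act (subset_sum nat T) x = y in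
  let cond_iii :=
    (forall y : K0plus A, exists x : K0plus A, k0p_muln #|T| x = y) /\
    (forall j, j \in galois_orbits gT ->
       (exists x : K0 A, k0_act (e' j) x <> k0_zero A) ->
       j \in gring_supp (subset_sum algC T)) in
  [/\ cond_i <-> cond_ii, cond_ii <-> cond_iii & cond_i -> graded_iso AD A].
Proof.
move=> AD cond_i cond_ii cond_iii.
have [m [d [psi psiP]]] := elementary_limit_exhausted hA.
pose TG := group (support_group hDdiv).
have ii_iso : cond_ii -> graded_iso AD A.
  rewrite /cond_ii hT => div.
  exact: (commuting_copies_absorb abG hDdiv hDcs psiP (divisible_copies abG hDdiv psiP div)).
have i_ii : cond_i -> cond_ii.
  rewrite /cond_ii hT => lim.
  apply: (@invariant_cone_divisible _ abG TG _ _ _ _ _ psiP) => i t tT.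
  apply: commuting_unit_shift.
  exact: (limit_commuting_unit hDdiv hDcs psiP i lim tT).
have ii_i : cond_ii -> cond_i by move=> /ii_iso iso; apply: elementary_limit_iso iso hA.
split; first by split; [apply: i_ii|apply: ii_i].
  rewrite /cond_ii /cond_iii hT -/(gval TG); split=> [div|[card supp]].
    split; first exact: (@divisible_card _ TG _ _ div).
    by move=> j; apply: (@divisible_support _ abG TG _ _ _ _ he' div).
  apply: (@support_divisible _ abG TG _ _ _ _ he' _ card supp) => k a b c.
  exact: (cone_cancel psiP).
by move=> /i_ii; apply: ii_iso.
Qed.
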